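(* Let $(M,g)$ be a compact Hermitian manifold of complex dimension $n$. Then $$\kappa(M)\ \le\ \frac{\mathcal R_g+2n}{3}\ =\ \mathcal R_g+\frac23\,(n-\mathcal R_g).$$
   Context: The Kodaira dimension of $M$ is $\kappa(M)=\limsup_{m\to+\infty}\frac{\log P_m(M)}{\log m}$, where $P_m(M)=\dim\Gamma(M,mK_M)$ and $K_M$ is the canonical line bundle (with $\log 0=-\infty$). If $g=\sum g_{j\bar k}\,dz_j\otimes d\bar z_k$ locally, with Kähler form $\omega=i\sum g_{j\bar k}\,dz_j\wedge d\bar z_k$, the Chern Ricci form is $Ric(\omega)=-i\partial\bar\partial\log\det(g_{j\bar k})=i\sum R_{j\bar k}\,dz_j\wedge d\bar z_k$, and its eigenvalues at a point are those of the matrix $(g_{j\bar k})^{-1}(R_{j\bar k})$. The Ricci rank $\mathcal R_g$ is the maximum over $x\in M$ of the number of negative eigenvalues (counted with multiplicity) of $Ric(\omega)$ at $x$. *)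

(* Defs.v *)
From HB Require Import structures.
From mathcomp Require Import all_boot all_order all_algebra.
From mathcomp Require Import all_classical all_reals all_analysis.
From mathcomp Require Import complex.

Set Implicit Arguments.
Unset Strict Implicit.
Unset Printing Implicit Defensive.

Import Order.TTheory GRing.Theory Num.Theory.
Import numFieldNormedType.Exports.

Local Open Scope classical_set_scope.
Local Open Scope complex_scope.
Local Open Scope sesquilinear_scope.
Local Open Scope ring_scope.

(* The topology of the modulus on R[i], which the library only attaches to
   abstract numFieldTypes. *)
HB.instance Definition _ (R : realType) := NormedModule.copy R[i] R[i]^o.

Section Calculus.
Variables (R : realType) (n : nat).
Local Notation C := R[i].
Local Notation Cn := 'rV[C]_n.

(* [differentiable] is Frechet differentiability over the scalar field of the
   source, here R[i]: this is complex differentiability. *)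
Definition holomorphic (W : normedModType C) (U : set Cn) (f : Cn -> W) : Prop :=
  forall z, U z -> differentiable f z.

(* Real directional derivative d/dt f(z + t v) at t = 0, with t real. *)
Definition rderivable (v : Cn) (f : Cn -> C) (z : Cn) : Prop :=
  derivable (fun t : R => complex.Re (f (z + t%:C *: v))) 0 1 /\
  derivable (fun t : R => complex.Im (f (z + t%:C *: v))) 0 1.

Definition rderive (v : Cn) (f : Cn -> C) (z : Cn) : C :=
  derive1 (fun t : R => complex.Re (f (z + t%:C *: v))) 0 +i*
  derive1 (fun t : R => complex.Im (f (z + t%:C *: v))) 0.

(* C^k in the sense of real calculus on an open set U: all iterated directional
   derivatives of order at most k exist and are continuous on U. *)
Fixpoint class_C (k : nat) (U : set Cn) (f : Cn -> C) : Prop :=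
  (forall z, U z -> {for z, continuous f}) /\
  if k is k'.+1 then
    forall v, (forall z, U z -> rderivable v f z) /\ class_C k' U (rderive v f)
  else True.

Definition smooth (U : set Cn) (f : Cn -> C) : Prop := forall k, class_C k U f.

(* With z_j = x_j + i y_j, the vector e_j is the direction of x_j and i e_j
   that of y_j; d/dz_j = (d/dx_j - i d/dy_j) / 2, d/dzbar_j its conjugate. *)
Definition dz (j : 'I_n) (f : Cn -> C) (z : Cn) : C :=
  (rderive (delta_mx 0 j) f z - 'i * rderive ('i *: delta_mx 0 j) f z) / 2.

Definition dzbar (j : 'I_n) (f : Cn -> C) (z : Cn) : C :=
  (rderive (delta_mx 0 j) f z + 'i * rderive ('i *: delta_mx 0 j) f z) / 2.

(* Eigenvalues, repeated according to algebraic multiplicity. *)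
Definition eigenvalues (A : 'M[C]_n) : seq C :=
  sval (closed_field_poly_normal (char_poly A)).

(* In R[i], [a < 0] means that a is real and negative. *)
Definition num_neg_eigenvalues (A : 'M[C]_n) : nat :=
  count (fun a => a < 0) (eigenvalues A).

End Calculus.

Record complexManifold (R : realType) (n : nat) := ComplexManifold {
  points :> topologicalType ;
  manifold_hausdorff : hausdorff_space points ;
  manifold_second_countable : @second_countable points ;
  chart_index : Type ;
  cdom : chart_index -> set points ;
  chart : chart_index -> points -> 'rV[R[i]]_n ;
  ichart : chart_index -> 'rV[R[i]]_n -> points ;
  cdom_open : forall i, open (cdom i) ;
  cdom_cover : forall x, exists i, cdom i x ;
  cimage_open : forall i, open (chart i @` cdom i) ;
  chartK : forall i x, cdom i x -> ichart i (chart i x) = x ;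
  chart_continuous : forall i x, cdom i x -> {for x, continuous (chart i)} ;
  ichart_continuous : forall i z, (chart i @` cdom i) z ->
    {for z, continuous (ichart i)} ;
  transition_holomorphic : forall i j,
    holomorphic (chart i @` (cdom i `&` cdom j)) (chart j \o ichart i)
}.

Section Manifold.
Variables (R : realType) (n : nat).
Local Notation C := R[i].
Local Notation Cn := 'rV[C]_n.

Definition cimage (M : complexManifold R n) (i : chart_index M) : set Cn :=
  chart i @` cdom i.

(* The library's Jacobian acts on row vectors: if z and w are the coordinates
   of the charts i and j, its (a, b) entry is dw_b/dz_a. *)
Definition transition_jacobian (M : complexManifold R n) (i j : chart_index M)
    (x : M) : 'M[C]_n :=
  jacobian (chart j \o ichart i) (chart i x).

(* The matrices (g_{j kbar}) in the charts; the metric pairs u and v to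
   sum_{j,k} g_{j kbar} u_j conj(v_k). *)
Record hermitianMetric (M : complexManifold R n) := HermitianMetric {
  metric_mx :> chart_index M -> Cn -> 'M[C]_n ;
  metric_smooth : forall i j k,
    smooth (cimage i) (fun z => metric_mx i z j k) ;
  metric_hermitian : forall i z, cimage i z -> metric_mx i z \is hermsymmx ;
  metric_positive : forall i z, cimage i z -> forall v : Cn, v != 0 ->
    0 < (v *m metric_mx i z *m v ^t* ) 0 0 ;
  metric_compatible : forall i j x, cdom i x -> cdom j x ->
    metric_mx i (chart i x) =
    transition_jacobian i j x *m metric_mx j (chart j x)
      *m (transition_jacobian i j x) ^t*
}.

(* Holomorphic sections of m K_M = (K_M)^{tensor m}, given by their coefficients
   f_i on (dz_1 /\ ... /\ dz_n)^{tensor m} in the charts. The coefficients are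
   extended by 0 outside the images of the charts, so that a section is
   determined by the family (f_i) and conversely. *)
Definition pluricanonical_sections (M : complexManifold R n) (m : nat) :
    set (chart_index M -> Cn -> C) :=
  [set f | [/\ forall i, holomorphic (cimage i) (f i),
               forall i j x, cdom i x -> cdom j x ->
                 f i (chart i x) =
                 (\det (transition_jacobian i j x)) ^+ m * f j (chart j x)
             & forall i z, ~ cimage i z -> f i z = 0]].

Definition linearly_independent (V : lmodType C) (k : nat) (s : 'I_k -> V) :
    Prop :=
  forall c : 'I_k -> C, \sum_a c a *: s a = 0 -> forall a, c a = 0.

(* Dimension over R[i] of a linear subspace, +oo if it is infinite. *)
Definition dimension (V : lmodType C) (A : set V) : \bar R :=
  ereal_sup [set (k%:R)%:E | k in
    [set k | exists s : 'I_k -> V,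
       (forall a, A (s a)) /\ linearly_independent s]].

Definition plurigenus (M : complexManifold R n) (m : nat) : \bar R :=
  dimension (@pluricanonical_sections M m).

(* [lne 0 = -oo]. *)
Definition kodaira_dim (M : complexManifold R n) : \bar R :=
  limn_esup (fun m => lne (plurigenus M m) / (ln m%:R)%:E)%E.

(* The determinant is a positive real number on the image of the chart. *)
Definition log_det (M : complexManifold R n) (g : hermitianMetric M)
    (i : chart_index M) (z : Cn) : C :=
  (ln (complex.Re (\det (g i z))))%:C.

(* The matrix (R_{j kbar}) of the Chern Ricci form. *)
Definition chern_ricci (M : complexManifold R n) (g : hermitianMetric M)
    (i : chart_index M) (z : Cn) : 'M[C]_n :=
  \matrix_(j, k) - dz j (dzbar k (log_det g i)) z.

Definition ricci_neg (M : complexManifold R n) (g : hermitianMetric M)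
    (i : chart_index M) (x : M) : nat :=
  num_neg_eigenvalues
    (invmx (g i (chart i x)) *m chern_ricci g i (chart i x)).

(* [ricci_neg g i x] is at most n and does not depend on the chart i at x. *)
Definition ricci_rank (M : complexManifold R n) (g : hermitianMetric M) : nat :=
  \max_(k < n.+1 |
    `[< exists i x, @cdom R n M i x /\ ricci_neg g i x = k >]) k.

End Manifold.

(* Main.v *)
Require Import Defs.
From HB Require Import structures.
From mathcomp Require Import all_boot all_order all_algebra.
From mathcomp Require Import all_classical all_reals all_analysis.
From mathcomp Require Import complex zify ring lra.

Set Implicit Arguments.
Unset Strict Implicit.
Unset Printing Implicit Defensive.

Import Order.TTheory GRing.Theory Num.Theory.
Import numFieldNormedType.Exports.

Local Open Scope classical_set_scope.
Local Open Scope ring_scope.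

(** The theorem says that the plurigenera grow at most like m^((r + 2n) / 3),
where r is the Ricci rank.

In a chart put phi = log det g ([weight]). A section f of m K_M has a squared
pointwise norm |f|^2 exp(- m phi), which does not depend on the chart
([section_norm]), and the Chern Ricci matrix is minus the Levi matrix of phi, so
that at each point the Levi form of phi has at most r positive directions. Near
a point c, the restriction of phi to a complex line t |-> p + t v is the real
part of a polynomial in t, plus levi(v) |t|^2, plus a remainder that is cubic in
the distance to c ([taylor_local], [line_expansion]). Divide f by the
exponential of half that polynomial, raised to the power m: this gives a
holomorphic function of t whose modulus is comparable to the pointwise norm
times exp(m levi(v) |t|^2 / 2), as long as m times the cubic remainder stays
bounded. If f vanishes at p, the Schwarz lemma on a disc of large radius rho
gains a factor 1 / rho, and the weight loses at most exp(m levi(v) rho^2 / 2).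
So if m levi(v) rho^2 is bounded above and rho is large enough, the norm of f is
not maximal at p + v, unless f vanishes identically ([weighted_schwarz],
[line_vanish]).

The cubic remainder asks for v of size m^(-1/3) in all directions, the Levi form
for components of size m^(-1/2) in its r positive directions; in the other ones
levi(v) is at most 0, whatever its size. So cut each chart into cells of size
m^(-1/3), which makes m^(2n/3) cells in real dimension 2n, and each cell into
slices that have size m^(-1/2) in r complex directions chosen at its centre,
which makes m^(2r (1/2 - 1/3)) = m^(r/3) slices. One point in each slice gives a
net of O(m^((2n + r) / 3)) points. The norm of a section is maximal somewhere by
compactness of M, so a section that vanishes on the net is zero ([local_net],
[global_net]), and P_m is at most the cardinality of the net ([plurigenus_le]).

The powers of m are handled through an integer q with m <= q^6 <= 64 m: the two
sizes are proportional to 1 / q^2 and 1 / q^3, the net has O(q^(4n + 2r)) points.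
The directions come from diagonalizing the Levi matrix with respect to g
([positive_part]), which also identifies their number with a number of
eigenvalues of g^(-1) Ric. The Schwarz lemma is derived from the mere existence
of complex derivatives, by Goursat's argument ([goursat_rect]) in logarithmic
polar coordinates, which gives the mean value property ([no_strict_local_max])
and the maximum principle ([max_principle]). *)

(** * Integrals of continuous functions over segments *)

Section Integral.
Variable R : realType.
Implicit Types (f g : R -> R) (a b c : R).

Definition segint f a b : R := Rintegral (@lebesgue_measure R) `[a, b] f.

Definition cont_on f a b := forall x, a <= x <= b -> {for x, continuous f}.

Lemma cont_onS f a b c d : a <= c -> d <= b -> cont_on f a b -> cont_on f c d.
Proof. by move=> ac db cf x /andP[cx xd]; apply: cf; lra. Qed.

Lemma cont_on_integrable f a b : cont_on f a b ->
  (@lebesgue_measure R).-integrable `[a, b] (EFin \o f).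
Proof.
move=> cf; apply: continuous_compact_integrable; first exact: segment_compact.
apply: continuous_in_subspaceT => x; rewrite inE /= in_itv /= => xab.
exact: cf.
Qed.

Lemma segint_split f a b c : a <= b -> b <= c -> cont_on f a c ->
  segint f a c = segint f a b + segint f b c.
Proof.
move=> ab bc cf.
have H := @Rintegral_itvB R f (BLeft a) (BRight c) b (cont_on_integrable cf).
move: H; rewrite !bnd_simp => /(_ ab bc) H.
rewrite /segint -[X in _ = _ + X]Rintegral_itv_obnd_cbnd; first by rewrite -H; ring.
apply: integrableS (cont_on_integrable (cont_onS ab (lexx c) cf)) => //.
by apply: subset_itvr; rewrite bnd_simp.
Qed.

Lemma segint_cst a b (k : R) : a <= b -> segint (fun=> k) a b = k * (b - a).
Proof.
move=> ab; rewrite /segint Rintegral_cst//= lebesgue_measure_itv /= lte_fin.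
by move: ab; rewrite le_eqVlt => /orP[/eqP->|->//]; rewrite ltxx subrr.
Qed.

Lemma segint_le f g a b : cont_on f a b -> cont_on g a b ->
  (forall x, a <= x <= b -> f x <= g x) -> segint f a b <= segint g a b.
Proof.
move=> cf cg fg; by apply: le_Rintegral => //; exact: cont_on_integrable.
Qed.

Lemma segintB f g a b : cont_on f a b -> cont_on g a b ->
  segint (fun x => f x - g x) a b = segint f a b - segint g a b.
Proof. by move=> cf cg; rewrite /segint RintegralB//; exact: cont_on_integrable. Qed.

Lemma cont_on_cst (k : R) a b : cont_on (fun=> k) a b.
Proof. by move=> x _; exact: cst_continuous. Qed.

Lemma segint_near_cst f a b (k e : R) : a <= b -> cont_on f a b ->
  (forall x, a <= x <= b -> `|f x - k| <= e) ->
  `|segint f a b - k * (b - a)| <= e * (b - a).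
Proof.
move=> ab cf fe.
have H1 : segint f a b <= segint (fun=> k + e) a b.
  by apply: segint_le => // [|x /fe]; [exact: cont_on_cst | rewrite ler_norml; lra].
have H2 : segint (fun=> k - e) a b <= segint f a b.
  by apply: segint_le => // [|x /fe]; [exact: cont_on_cst | rewrite ler_norml; lra].
move: H1 H2; rewrite !segint_cst// ler_norml => H1 H2.
by move: H1 H2; rewrite mulrDl mulrBl => H1 H2; lra.
Qed.

End Integral.

(** * Goursat's theorem on rectangles *)

Section Goursat.
Variable R : realType.
Variables P Q : R -> R -> R.

(** The 1-form P dx + Q dy is differentiable at (x, y) and d(P dx + Q dy) = 0 there:
r is both the y-derivative of P and the x-derivative of Q. *)
Definition form_closed_at (x y : R) := exists p r q : R,
  forall e, 0 < e -> exists2 d, 0 < d & forall h k, `|h| < d -> `|k| < d ->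
    `|P (x + h) (y + k) - P x y - (p * h + r * k)| <= e * (`|h| + `|k|) /\
    `|Q (x + h) (y + k) - Q x y - (r * h + q * k)| <= e * (`|h| + `|k|).

(** The integral of P dx + Q dy over the boundary of [a, b] x [c, d], anticlockwise. *)
Definition rect_itg a b c d : R :=
  segint (P ^~ c) a b + segint (Q b) c d - segint (P ^~ d) a b - segint (Q a) c d.

Definition form_closed_on a b c d :=
  forall x y, a <= x <= b -> c <= y <= d -> form_closed_at x y.

Lemma form_closed_bound x y : form_closed_at x y -> exists2 K, 0 < K &
  exists2 d, 0 < d & forall h k, `|h| < d -> `|k| < d ->
  `|P (x + h) (y + k) - P x y| <= K * (`|h| + `|k|) /\
  `|Q (x + h) (y + k) - Q x y| <= K * (`|h| + `|k|).
Proof.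
move=> [p [r [q /(_ 1 ltr01)[d d0 H]]]].
exists (`|p| + `|r| + `|q| + 1); first by rewrite ltr_wpDl// !addr_ge0.
exists d => // h k hd kd; have [H1 H2] := H h k hd kd.
have E u v : `|u * h + v * k| <= (`|u| + `|v|) * (`|h| + `|k|).
  rewrite (le_trans (ler_normD _ _))// !normrM.
  have := mulr_ge0 (normr_ge0 u) (normr_ge0 k).
  have := mulr_ge0 (normr_ge0 v) (normr_ge0 h); nra.
have E1 := E p r; have E2 := E r q.
have N1 := mulr_ge0 (normr_ge0 q) (addr_ge0 (normr_ge0 h) (normr_ge0 k)).
have N2 := mulr_ge0 (normr_ge0 p) (addr_ge0 (normr_ge0 h) (normr_ge0 k)).
have T1 := ler_normD (P (x + h) (y + k) - P x y - (p * h + r * k)) (p * h + r * k).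
have T2 := ler_normD (Q (x + h) (y + k) - Q x y - (r * h + q * k)) (r * h + q * k).
by move: T1 T2; rewrite !subrK; nra.
Qed.

Lemma continuous_of_bound (f : R -> R) (x K d : R) : 0 < K -> 0 < d ->
  (forall h, `|h| < d -> `|f (x + h) - f x| <= K * `|h|) -> {for x, continuous f}.
Proof.
move=> K0 d0 H; apply/cvgrPdist_le => /= e e0.
have m0 : 0 < Num.min d (e / K) by rewrite lt_min d0 divr_gt0.
exists (Num.min d (e / K)) => //= t /=; rewrite lt_min => /andP[td te].
have := H (t - x); rewrite (_ : x + (t - x) = t); last by ring.
rewrite ![`|t - x|]distrC [`|f x - _|]distrC => /(_ td)/le_trans; apply.
by rewrite mulrC -ler_pdivlMr// ltW.
Qed.

Lemma form_closed_cont_horiz a b c d y : c <= y <= d -> form_closed_on a b c d ->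
  cont_on (P ^~ y) a b.
Proof.
move=> ycd H x xab; have [K K0 [e e0 B]] := form_closed_bound (H x y xab ycd).
apply: (continuous_of_bound K0 e0) => h he.
by have [] := B h 0 he; rewrite ?normr0// !addr0.
Qed.

Lemma form_closed_cont_vert a b c d x : a <= x <= b -> form_closed_on a b c d ->
  cont_on (Q x) c d.
Proof.
move=> xab H y ycd; have [K K0 [e e0 B]] := form_closed_bound (H x y xab ycd).
apply: (continuous_of_bound K0 e0) => h he.
by have [] := B 0 h _ he; rewrite ?normr0// !(addr0, add0r).
Qed.

Lemma form_closed_onS a b c d a' b' c' d' : a <= a' -> b' <= b -> c <= c' -> d' <= d ->
  form_closed_on a b c d -> form_closed_on a' b' c' d'.
Proof. by move=> ? ? ? ? H x y hx hy; apply: H; lra. Qed.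

(** The integrals over the inner sides cancel. *)
Lemma rect_itg_split a b c d x y : a <= x <= b -> c <= y <= d ->
  form_closed_on a b c d ->
  rect_itg a b c d = rect_itg a x c y + rect_itg x b c y +
                     (rect_itg a x y d + rect_itg x b y d).
Proof.
move=> /andP[ax xb] /andP[cy yd] H; rewrite /rect_itg.
have sh z : c <= z <= d -> segint (P ^~ z) a b = segint (P ^~ z) a x + segint (P ^~ z) x b.
  by move=> hz; apply: segint_split => //; exact: form_closed_cont_horiz hz H.
have sv z : a <= z <= b -> segint (Q z) c d = segint (Q z) c y + segint (Q z) y d.
  by move=> hz; apply: segint_split => //; exact: form_closed_cont_vert hz H.
by rewrite !sh ?sv ?lexx ?(le_trans cy) ?(le_trans ax)//; ring.
Qed.

(** The affine part of a form that is closed at (x0, y0) is exact and contributes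
nothing; the rest is o(diameter), integrated over the perimeter. *)
Lemma rect_itg_small x0 y0 (e : R) : form_closed_at x0 y0 -> 0 < e ->
  exists2 d0, 0 < d0 & forall a b c d, a <= x0 <= b -> c <= y0 <= d ->
    b - a < d0 -> d - c < d0 -> form_closed_on a b c d ->
    `|rect_itg a b c d| <= e * (b - a + (d - c)) ^+ 2.
Proof.
move=> [p [r [q H]]] e0; have e20 : 0 < e / 2 by rewrite divr_gt0.
have [d0 d00 {}H] := H _ e20; exists d0 => // a b c d hx hy w h C.
set s := b - a + (d - c).
have B x y : a <= x <= b -> c <= y <= d ->
    `|P x y - P x0 y0 - (p * (x - x0) + r * (y - y0))| <= e / 2 * s /\
    `|Q x y - Q x0 y0 - (r * (x - x0) + q * (y - y0))| <= e / 2 * s.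
  move=> xab ycd; have xd : `|x - x0| < d0 by rewrite ltr_norml; lra.
  have yd : `|y - y0| < d0 by rewrite ltr_norml; lra.
  have := H (x - x0) (y - y0) xd yd.
  have -> : x0 + (x - x0) = x by ring.
  have -> : y0 + (y - y0) = y by ring.
  have E : `|x - x0| + `|y - y0| <= s.
    by apply: lerD; rewrite ler_norml; lra.
  by move=> [] /le_trans h1 /le_trans h2; split; [apply: h1|apply: h2];
    rewrite ler_pM2l.
have ab : a <= b by lra.
have cd : c <= d by lra.
have I1 : `|segint (fun x => P x c - P x d) a b - r * (c - d) * (b - a)|
    <= e * s * (b - a).
  apply: segint_near_cst => // [x hx'|x hx'].
    by apply: cvgB; apply: (form_closed_cont_horiz _ C); rewrite ?lexx ?andbT.
  have [B1 _] := B x c hx' ltac:(lra); have [B2 _] := B x d hx' ltac:(lra).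
  by move: B1 B2; rewrite !ler_norml; lra.
have I2 : `|segint (fun y => Q b y - Q a y) c d - r * (b - a) * (d - c)|
    <= e * s * (d - c).
  apply: segint_near_cst => // [x hx'|x hx'].
    by apply: cvgB; apply: (form_closed_cont_vert _ C); rewrite ?lexx ?andbT.
  have [_ B1] := B b x ltac:(lra) hx'; have [_ B2] := B a x ltac:(lra) hx'.
  by move: B1 B2; rewrite !ler_norml; lra.
rewrite segintB in I1; [|by apply: (form_closed_cont_horiz _ C); lra..].
rewrite segintB in I2; [|by apply: (form_closed_cont_vert _ C); lra..].
have -> : rect_itg a b c d = (segint (P^~ c) a b - segint (P^~ d) a b - r * (c - d) * (b - a))
   + (segint [eta Q b] c d - segint [eta Q a] c d - r * (b - a) * (d - c)).
  by rewrite /rect_itg; ring.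
rewrite (le_trans (ler_normD _ _))// (le_trans (lerD I1 I2))//.
by rewrite -mulrDr -/s expr2 mulrA.
Qed.

Definition rect := (R * R * R * R)%type.

(** Bisecting both sides halves b - a + (d - c) and divides its square by 4, whence
one of the four quarters of a bad rectangle is again bad. *)
Definition bad_rect (e : R) (s : rect) : Prop := let: (a, b, c, d) := s in
  [/\ a <= b, c <= d, form_closed_on a b c d &
      e * (b - a + (d - c)) ^+ 2 < `|rect_itg a b c d|].

Definition quarter_of (s t : rect) : Prop :=
  let: (a, b, c, d) := s in let: (a', b', c', d') := t in
  [/\ a <= a' /\ b' <= b, c <= c' /\ d' <= d, b' - a' = (b - a) / 2
    & d' - c' = (d - c) / 2].

Lemma bad_rect_quarter e s : bad_rect e s -> exists2 t, bad_rect e t & quarter_of s t.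
Proof.
case: s => [[[a b] c] d] [ab cd C]; set x := (a + b) / 2; set y := (c + d) / 2.
have hx : a <= x <= b by rewrite /x; lra.
have hy : c <= y <= d by rewrite /y; lra.
rewrite (rect_itg_split hx hy C) => L.
apply/not_exists2P => N.
have S a' b' c' d' : a <= a' -> a' <= b' -> b' <= b -> c <= c' -> c' <= d' ->
    d' <= d -> b' - a' = (b - a) / 2 -> d' - c' = (d - c) / 2 ->
    `|rect_itg a' b' c' d'| <= e * ((b - a) / 2 + (d - c) / 2) ^+ 2.
  move=> h1 h2 h3 h4 h5 h6 h7 h8; have [nb|nh] := N (a', b', c', d'); last by case: nh; split.
  rewrite leNgt -h7 -h8; apply/negP => l; apply: nb; split => //.
  exact: form_closed_onS C.
have S1 := S a x c y ltac:(lra) ltac:(lra) ltac:(lra) ltac:(lra) ltac:(lra)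
  ltac:(lra) ltac:(rewrite /x; lra) ltac:(rewrite /y; lra).
have S2 := S x b c y ltac:(lra) ltac:(lra) ltac:(lra) ltac:(lra) ltac:(lra)
  ltac:(lra) ltac:(rewrite /x; lra) ltac:(rewrite /y; lra).
have S3 := S a x y d ltac:(lra) ltac:(lra) ltac:(lra) ltac:(lra) ltac:(lra)
  ltac:(lra) ltac:(rewrite /x; lra) ltac:(rewrite /y; lra).
have S4 := S x b y d ltac:(lra) ltac:(lra) ltac:(lra) ltac:(lra) ltac:(lra)
  ltac:(lra) ltac:(rewrite /x; lra) ltac:(rewrite /y; lra).
have T1 := ler_normD (rect_itg a x c y + rect_itg x b c y)
                     (rect_itg a x y d + rect_itg x b y d).
have T2 := ler_normD (rect_itg a x c y) (rect_itg x b c y).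
have T3 := ler_normD (rect_itg a x y d) (rect_itg x b y d).
have E : e * (b - a + (d - c)) ^+ 2 =
   4 * (e * ((b - a) / 2 + (d - c) / 2) ^+ 2) by field.
by rewrite E in L; lra.
Qed.

(** Goursat's bisection: quarters of bad rectangles shrink to a point, where
[rect_itg_small] contradicts badness. Green's theorem would ask for continuous
partial derivatives; a holomorphic function is only known to be differentiable. *)
Lemma goursat_rect a b c d : a <= b -> c <= d -> form_closed_on a b c d ->
  rect_itg a b c d = 0.
Proof.
move=> ab cd C; apply/eqP; rewrite -normr_le0; apply/ler_addgt0Pl => e e0.
rewrite addr0; set s := b - a + (d - c).
suff H : `|rect_itg a b c d| <= e / (s ^+ 2 + 1) * s ^+ 2.
  rewrite (le_trans H)// mulrAC ler_pdivrMr ?ler_pM2l//.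
    by rewrite lerDl.
  by rewrite ltr_wpDl ?sqr_ge0.
set e' := e / _; have e'0 : 0 < e'.
  by rewrite divr_gt0 // ltr_wpDl ?sqr_ge0.
rewrite leNgt; apply/negP => L.
pose s0 : rect := (a, b, c, d).
have bad0 : bad_rect e' s0 by split.
have /choice[step stepP] : forall s, exists t, bad_rect e' s -> bad_rect e' t /\ quarter_of s t.
  move=> t; have [/bad_rect_quarter[u]|] := pselect (bad_rect e' t); last by exists t.
  by exists u.
pose u k := iter k step s0.
have badu k : bad_rect e' (u k) by elim: k => // k /stepP[].
have halfu k : quarter_of (u k) (u k.+1) by have [] := stepP _ (badu k).
pose A k := (u k).1.1.1; pose B k := (u k).1.1.2.
pose Cc k := (u k).1.2; pose D k := (u k).2.
have uE k : u k = (A k, B k, Cc k, D k).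
  by rewrite /A /B /Cc /D; case: (u k) => [[[]]].
have AB k : A k <= B k by have := badu k; rewrite uE => -[].
have CD k : Cc k <= D k by have := badu k; rewrite uE => -[].
have inc k j : [/\ A k <= A (k + j)%N, B (k + j)%N <= B k,
                   Cc k <= Cc (k + j)%N & D (k + j)%N <= D k].
  elim: j => [|j [h1 h2 h3 h4]]; first by rewrite addn0.
  have := halfu (k + j)%N; rewrite !uE addnS => -[[? ?] [? ?] _ _].
  by split; lra.
have width k : B k - A k = (b - a) / 2 ^+ k /\ D k - Cc k = (d - c) / 2 ^+ k.
  elim: k => [|k [h1 h2]]; first by rewrite expr0 !divr1.
  have := halfu k; rewrite !uE => -[_ _ -> ->].
  by rewrite h1 h2 !exprSr !invfM !mulrA.
have lub (X Y : nat -> R) : (forall k, X k <= Y k) ->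
    (forall k j, X k <= X (k + j)%N /\ Y (k + j)%N <= Y k) ->
    exists x0, forall k, X k <= x0 <= Y k.
  move=> XY mon; have XYjk j k : X j <= Y k.
    have [h1 _] := mon j k; have [_ h2] := mon k j.
    by have := XY (j + k)%N; rewrite [in Y _]addnC; lra.
  have hs : has_sup (range X).
    by split; [exists (X 0%N); exists 0%N | exists (Y 0%N) => _ [j _ <-]].
  exists (sup (range X)) => k; apply/andP; split.
    by apply: sup_upper_bound => //; exists k.
  by apply: ge_sup; [case: hs | move=> _ [j _ <-]].
have [x0 hx0] := lub A B AB (fun k j => let: And4 h1 h2 _ _ := inc k j in conj h1 h2).
have [y0 hy0] := lub Cc D CD (fun k j => let: And4 _ _ h1 h2 := inc k j in conj h1 h2).
have [d0 d00 small] := rect_itg_small (C x0 y0 (hx0 0%N) (hy0 0%N)) e'0.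
have [k Hk] : exists k, (b - a + (d - c)) / 2 ^+ k < d0.
  set w := b - a + (d - c).
  have w0 : 0 <= w by rewrite /w; lra.
  exists (Num.bound (w / d0)).
  rewrite ltr_pdivrMr ?exprn_gt0// mulrC -ltr_pdivrMr//.
  have /archi_boundP/lt_le_trans : 0 <= w / d0 by rewrite divr_ge0// ltW.
  by apply; rewrite -natrX ler_nat ltnW// ltn_expl.
have [wk hk] := width k.
have := badu k; rewrite uE => -[_ _ Ck].
have p2 : 0 < (2 ^+ k : R)^-1 by rewrite invr_gt0 exprn_gt0.
have n1 : 0 <= (b - a) / 2 ^+ k by rewrite mulr_ge0 ?subr_ge0// ltW.
have n2 : 0 <= (d - c) / 2 ^+ k by rewrite mulr_ge0 ?subr_ge0// ltW.
rewrite ltNge small//; rewrite ?wk ?hk.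
  by move: Hk; rewrite mulrDl; lra.
by move: Hk; rewrite mulrDl; lra.
Qed.

End Goursat.

(** * The real-valued modulus of a complex number *)

Section Modulus.
Variable R : realType.
Local Notation C := R[i].
Implicit Types z w : C.

(** The norm of C has values in C; inequalities between reals are stated with this
one. *)
Definition cabs z : R := complex.Re `|z|.

Lemma cabsE z : `|z| = (cabs z)%:C%C.
Proof. by rewrite /cabs normc_def. Qed.

Lemma cabs_def z : cabs z = Num.sqrt (complex.Re z ^+ 2 + complex.Im z ^+ 2).
Proof. by rewrite /cabs normc_def. Qed.

Lemma cabs_ge0 z : 0 <= cabs z.
Proof. by rewrite cabs_def sqrtr_ge0. Qed.

Lemma cabs2 z : cabs z ^+ 2 = complex.Re z ^+ 2 + complex.Im z ^+ 2.
Proof. by rewrite cabs_def sqr_sqrtr// addr_ge0 ?sqr_ge0. Qed.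

Lemma cabsM z w : cabs (z * w) = cabs z * cabs w.
Proof. by apply: complexI; rewrite rmorphM /= -!cabsE normrM. Qed.

Lemma cabsV z : cabs z^-1 = (cabs z)^-1.
Proof. by apply: complexI; rewrite fmorphV /= -!cabsE normfV. Qed.

Lemma cabsX z k : cabs (z ^+ k) = cabs z ^+ k.
Proof. by apply: complexI; rewrite rmorphXn /= -!cabsE normrX. Qed.

Lemma cabsN z : cabs (- z) = cabs z.
Proof. by rewrite /cabs normrN. Qed.

Lemma cabsBC z w : cabs (z - w) = cabs (w - z).
Proof. by rewrite /cabs distrC. Qed.

Lemma cabsD z w : cabs (z + w) <= cabs z + cabs w.
Proof. by rewrite -lecR rmorphD /= -!cabsE ler_normD. Qed.

Lemma cabs0 : cabs 0 = 0.
Proof. by rewrite /cabs normr0. Qed.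

Lemma cabs1 : cabs 1 = 1.
Proof. by rewrite /cabs normr1. Qed.

Lemma cabs_eq0 z : (cabs z == 0) = (z == 0).
Proof. by rewrite -(normr_eq0 z) cabsE (inj_eq (@complexI _) _ 0). Qed.

Lemma cabs_gt0 z : (0 < cabs z) = (z != 0).
Proof. by rewrite lt_def cabs_ge0 andbT cabs_eq0. Qed.

Lemma cabsR (x : R) : cabs x%:C%C = `|x|.
Proof. by rewrite cabs_def /= expr0n addr0 sqrtr_sqr. Qed.

Lemma Re_le_cabs z : `|complex.Re z| <= cabs z.
Proof. by rewrite cabs_def -sqrtr_sqr ler_sqrt ?lerDl ?addr_ge0 ?sqr_ge0. Qed.

Lemma Im_le_cabs z : `|complex.Im z| <= cabs z.
Proof. by rewrite cabs_def -sqrtr_sqr ler_sqrt ?lerDr ?addr_ge0 ?sqr_ge0. Qed.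

Lemma cabs_le_ReIm z : cabs z <= `|complex.Re z| + `|complex.Im z|.
Proof.
rewrite -(ler_pXn2r (n:=2)) ?nnegrE ?addr_ge0 ?cabs_ge0//.
rewrite cabs2 sqrrD !real_normK ?num_real//.
by have := mulr_ge0 (normr_ge0 (complex.Re z)) (normr_ge0 (complex.Im z)); lra.
Qed.

Lemma cReM z w : complex.Re (z * w) =
  complex.Re z * complex.Re w - complex.Im z * complex.Im w.
Proof. by case: z; case: w. Qed.

Lemma cImM z w : complex.Im (z * w) =
  complex.Re z * complex.Im w + complex.Im z * complex.Re w.
Proof. by case: z => a b; case: w => c d /=; ring. Qed.

Lemma cReD z w : complex.Re (z + w) = complex.Re z + complex.Re w.
Proof. by case: z; case: w. Qed.
Lemma cImD z w : complex.Im (z + w) = complex.Im z + complex.Im w.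
Proof. by case: z; case: w. Qed.
Lemma cReN z : complex.Re (- z) = - complex.Re z. Proof. by case: z. Qed.
Lemma cImN z : complex.Im (- z) = - complex.Im z. Proof. by case: z. Qed.

Lemma posC_real (e : C) : 0 < e -> exists2 r : R, 0 < r & e = r%:C%C.
Proof.
case: e => a b; rewrite ltcE /= => /andP[/eqP-> a0].
by exists a.
Qed.

End Modulus.

(** * Complex derivatives and the complex exponential *)

Section ComplexDerivative.
Variable R : realType.
Local Notation C := R[i].

(** Complex differentiability as an estimate between real numbers. *)
Definition has_cderiv (F : C -> C) (z d : C) := forall e : R, 0 < e ->
  exists2 r : R, 0 < r & forall s, cabs s < r ->
    cabs (F (z + s) - F z - d * s) <= e * cabs s.

Lemma has_cderiv_differentiable (F : C -> C) (z d : C) : has_cderiv F z d ->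
  differentiable F z.
Proof.
move=> H; apply/derivable1_diffP; apply/cvg_ex; exists d.
apply/cvgrPdist_le => /= e /posC_real[e' e'0 ->].
have [r r0 Hr] := H e' e'0.
exists r%:C%C => /=; first by rewrite ltcR.
move=> h /=; rewrite sub0r normrN cabsE ltcR => hr h0.
rewrite cabsE lecR.
have := Hr h hr; rewrite [z + h]addrC => H1.
rewrite -(ler_pM2r (_ : 0 < cabs h)) ?cabs_gt0// cabsBC -cabsM.
rewrite /shift /= [h%:A](_ : _ = h); last by rewrite /GRing.scale /= mulr1.
move: H1; rewrite /GRing.scale /= => H1.
by rewrite (_ : _ * h = F (h + z) - F z - d * h) //; field.
Qed.

Lemma differentiable_has_cderiv (F : C -> C) (z : C) : differentiable F z ->
  exists d, has_cderiv F z d.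
Proof.
move=> /derivable1_diffP /cvg_ex[d /cvgrPdist_le H].
exists d => e e0; have /H[r /= /posC_real[r' r'0 ->] Hr] : 0 < e%:C%C :> C by rewrite ltcR.
exists r' => // s sr.
have [->|s0] := eqVneq s 0; first by rewrite mulr0 addr0 subrr subr0 cabs0 mulr0.
have := Hr s; rewrite /= sub0r normrN cabsE ltcR => /(_ sr s0).
rewrite cabsE lecR => H1.
rewrite -(ler_pM2r (_ : 0 < cabs s)) ?cabs_gt0// in H1.
move: H1; rewrite cabsBC -cabsM.
rewrite /shift /= [s%:A](_ : _ = s); last by rewrite /GRing.scale /= mulr1.
rewrite /GRing.scale /=.
rewrite (_ : _ * s = F (z + s) - F z - d * s) // [s + z]addrC; by field.
Qed.

Lemma continuousC_eps (F : C -> C) (z : C) : {for z, continuous F} <->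
  forall e : R, 0 < e -> exists2 r : R, 0 < r & forall s, cabs s < r ->
    cabs (F (z + s) - F z) <= e.
Proof.
split=> [/cvgrPdist_le H e e0|H].
  have /H[r /= /posC_real[r' r'0 ->] Hr] : 0 < e%:C%C :> C by rewrite ltcR.
  exists r' => // s sr; have := Hr (z + s); rewrite /= opprD addNKr normrN !cabsE.
  by rewrite ltcR lecR cabsBC; exact.
apply/(@cvgrPdist_le _ _ _ (nbhs z) (nbhs_filter z)) => e /posC_real[e' e'0 ->].
have [r r0 Hr] := H e' e'0; exists r%:C%C => /=; first by rewrite ltcR.
move=> t /=; rewrite !cabsE ltcR lecR => tr; rewrite cabsBC.
have := Hr (t - z); rewrite (_ : z + (t - z) = t); last by ring.
by rewrite [cabs (t - z)]cabsBC; apply.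
Qed.

Lemma is_derive_eps (f : R -> R) (x l : R) : is_derive x 1 f l ->
  forall e, 0 < e -> exists2 d, 0 < d &
    forall h, `|h| < d -> `|f (x + h) - f x - l * h| <= e * `|h|.
Proof.
move=> [df dl] e e0.
have := df; rewrite /derivable => /cvg_ex[l' Hl].
have El : l = l' by rewrite -dl; apply: cvg_lim.
rewrite {}El; move/cvgrPdist_le : Hl => /(_ e e0)[r /= r0 Hr].
exists r => // h hr.
have [->|h0] := eqVneq h 0; first by rewrite mulr0 addr0 subrr subr0 normr0 mulr0.
have := Hr h; rewrite /= sub0r normrN => /(_ hr h0) H1.
rewrite -(ler_pM2r (_ : 0 < `|h|)) ?normr_gt0// distrC -normrM in H1.
move: H1; rewrite /shift /= [h%:A](_ : _ = h); last by rewrite /GRing.scale /= mulr1.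
rewrite /GRing.scale /=.
have -> : (h^-1 * (f (h + x) - f x) - l') * h = f (x + h) - f x - l' * h.
  by rewrite [h + x]addrC; field.
by [].
Qed.

Definition cexp (z : C) : C :=
  ((expR (complex.Re z) * cos (complex.Im z))%R +i*
   (expR (complex.Re z) * sin (complex.Im z))%R)%C.

Lemma cexpD z w : cexp (z + w) = cexp z * cexp w.
Proof.
case: z => a b; case: w => c d; rewrite /cexp /= expRD cosD sinD.
by apply/eqP; rewrite eq_complex /=; apply/andP; split; apply/eqP; ring.
Qed.

Lemma cabs_cexp z : cabs (cexp z) = expR (complex.Re z).
Proof.
by rewrite cabs_def /cexp /= !exprMn -mulrDr cos2Dsin2 mulr1 sqrtr_sqr ger0_norm.
Qed.

Lemma cexp0 : cexp 0 = 1.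
Proof. by rewrite /cexp /= expR0 cos0 sin0 mulr0 mulr1. Qed.

Lemma has_cderiv_cexp0 : has_cderiv cexp 0 1.
Proof.
move=> e e0.
(* The errors below add up to 6 e1 |s|. *)
pose e1 := Num.min (e / 8) 1.
have e10 : 0 < e1 by rewrite /e1 lt_min ltr01 andbT divr_gt0.
have e1e : e1 <= e / 8 by rewrite /e1 ge_min lexx.
have e11 : e1 <= 1 by rewrite /e1 ge_min lexx orbT.
have [d1 d10 H1] := is_derive_eps (is_derive_expR 0) e10.
have [d2 d20 H2] := is_derive_eps (is_derive_cos 0) e10.
have [d3 d30 H3] := is_derive_eps (is_derive_sin 0) e10.
exists (Num.min (Num.min d1 (e1 / 2)) (Num.min d2 d3)).
  by rewrite !lt_min d10 d20 d30 divr_gt0.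
move=> [x y]; rewrite !lt_min => /andP[/andP[s1 se] /andP[s2 s3]].
have := Re_le_cabs (x +i* y)%C; have := Im_le_cabs (x +i* y)%C.
set r := cabs _ in s1 se s2 s3 * => /= yr xr.
have := H1 x (le_lt_trans xr s1); have := H2 y (le_lt_trans yr s2).
have := H3 y (le_lt_trans yr s3).
rewrite !add0r expR0 cos0 sin0 !mul1r subr0 oppr0 mul0r subr0 => h3 h2 h1.
rewrite cexp0 (le_trans (cabs_le_ReIm _))//.
rewrite /cexp /=.
have -> : expR x * cos y - 1 - x = (expR x - 1 - x) * cos y + (1 + x) * (cos y - 1) by ring.
have -> : expR x * sin y - 0 - y = (expR x - 1) * sin y + (sin y - y) by ring.
have n1 : `|(expR x - 1 - x) * cos y| <= e1 * r.
  rewrite normrM (le_trans (ler_pM _ _ h1 (_ : _ <= 1)))// ?mulr1 ?ler_pM2l//.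
  by rewrite ler_norml cos_geN1 cos_le1.
have r0 : 0 <= r by exact: cabs_ge0.
have r1 : r <= e1 / 2 by exact: ltW.
have n2 : `|(1 + x) * (cos y - 1)| <= 2 * (e1 * r).
  rewrite normrM (ler_pM _ _ _ (le_trans h2 _))//; last by rewrite ler_pM2l.
  by move: xr; rewrite !ler_norml; lra.
have n4 : `|sin y - y| <= e1 * r by rewrite (le_trans h3)// ler_pM2l.
have n3 : `|(expR x - 1) * sin y| <= e1 * (2 * r).
  rewrite normrM ler_pM//.
    have : e1 * `|x| <= `|x| by rewrite ler_piMl.
    by have := xr; move: h1 (xr); rewrite !(ler_norml (_ - _)) (ler_norml x); lra.
  have : e1 * `|y| <= `|y| by rewrite ler_piMl.
  by have := yr; move: h3 (yr); rewrite !(ler_norml (_ - _)) (ler_norml y) (ler_norml (sin y)); lra.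
have t1 := ler_normD ((expR x - 1 - x) * cos y) ((1 + x) * (cos y - 1)).
have t2 := ler_normD ((expR x - 1) * sin y) (sin y - y).
have : e1 * r <= e / 8 * r by rewrite ler_wpM2r.
have : 0 <= e * r by rewrite mulr_ge0// ltW.
lra.
Qed.

Lemma differentiable_cexp z : differentiable cexp z.
Proof.
apply: (@has_cderiv_differentiable _ _ (cexp z)) => e e0.
have e'0 : 0 < e / cabs (cexp z) by rewrite divr_gt0// cabs_cexp expR_gt0.
have [r r0 H] := has_cderiv_cexp0 e'0; exists r => // s /H.
rewrite add0r cexp0 mul1r cexpD => {}H.
rewrite (_ : _ - _ = cexp z * (cexp s - 1 - s)); last by ring.
rewrite cabsM -ler_pdivlMl ?cabs_cexp ?expR_gt0//.
by move: H; rewrite cabs_cexp; rewrite mulrA [_^-1 * e]mulrC.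
Qed.

End ComplexDerivative.

(** * The maximum principle and the Schwarz lemma *)

Section Schwarz.
Variable R : realType.
Local Notation C := R[i].

(** The Cauchy-Riemann equations, as closedness of the imaginary part of G dz. *)
Lemma has_cderiv_form_closed (G : C -> C) (x y : R) (d : C) : has_cderiv G (x +i* y)%C d ->
  form_closed_at (fun x y => complex.Im (G (x +i* y)%C))
    (fun x y => complex.Re (G (x +i* y)%C)) x y.
Proof.
move=> H; exists (complex.Im d), (complex.Re d), (- complex.Im d) => e e0.
have [r r0 Hr] := H e e0; exists (r / 2); first by rewrite divr_gt0.
move=> h k hr kr.
have sr : cabs (h +i* k)%C < r.
  by rewrite (le_lt_trans (cabs_le_ReIm _))//=; lra.
have {}Hr := Hr _ sr.
have Es : cabs (h +i* k)%C <= `|h| + `|k| by exact: cabs_le_ReIm.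
have {}Hr : cabs (G ((x + h)%R +i* (y + k)%R)%C - G (x +i* y)%C - d * (h +i* k)%C)
     <= e * (`|h| + `|k|).
  by rewrite (le_trans Hr)// ler_pM2l.
set u := G _ in Hr *; set v := G _ in Hr *.
split.
- apply: le_trans Hr; apply: le_trans (Im_le_cabs _).
  rewrite cImD cImN cImD cImN cImM /= (_ : _ - _ - _ = complex.Im u - complex.Im v -
    (complex.Re d * k + complex.Im d * h))//; ring.
- apply: le_trans Hr; apply: le_trans (Re_le_cabs _).
  rewrite cReD cReN cReD cReN cReM /= (_ : _ - _ - _ = complex.Re u - complex.Re v -
    (complex.Re d * h - complex.Im d * k))//; ring.
Qed.

Lemma cexp_periodic (x : R) : cexp (x +i* (pi *+ 2))%C = cexp (x +i* 0)%C.
Proof. by rewrite /cexp /= cos2pi sin2pi cos0 sin0. Qed.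

(** In the coordinate zeta = log (t - a) the circles about a become vertical segments
and the punctured disc a half strip. Horizontal sides cancel by periodicity, so
Goursat's theorem says that the mean of F over a circle about a does not depend
on the radius; letting the radius tend to 0, this mean is F(a). The centre may
be singular, F being merely continuous there. *)
Lemma no_strict_local_max (F : C -> C) (a : C) (r0 r eta : R) :
  0 < r < r0 -> 0 < eta ->
  (forall t, 0 < cabs (t - a) < r0 -> differentiable F t) ->
  {for a, continuous F} ->
  ~ (forall t, cabs (t - a) = r -> complex.Re (F t) <= complex.Re (F a) - eta).
Proof.
move=> /andP[r_gt0 rr0] eta0 dF cF Hr.
pose G z := F (a + cexp z).
pose P x y := complex.Im (G (x +i* y)%C); pose Q x y := complex.Re (G (x +i* y)%C).
have cl (x y : R) : x <= ln r -> form_closed_at P Q x y.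
  move=> xr; have dG : differentiable G (x +i* y)%C.
    apply: (@differentiable_comp _ _ _ _ (fun z => a + cexp z) F).
      exact: (differentiableD (differentiable_cst a _) (differentiable_cexp _)).
    apply: dF; rewrite addrC addKr cabs_cexp expR_gt0 /=.
    by rewrite (le_lt_trans _ rr0)// -[leRHS](lnK r_gt0) ler_expR.
  have [d Hd] := differentiable_has_cderiv dG.
  exact: has_cderiv_form_closed Hd.
have /continuousC_eps/(_ (eta / 2))[|d d0 Hd] := cF; first by rewrite divr_gt0.
(* A radius exp(u) at which F is eta / 2 close to its value at the centre. *)
pose u := Num.min (ln r) (ln (d / 2)).
have ur : u <= ln r by rewrite /u ge_min lexx.
have ud : expR u < d.
  have d20 : 0 < d / 2 by rewrite divr_gt0.
  have : expR u <= d / 2 by rewrite -[leRHS](lnK d20) ler_expR ge_min lexx orbT.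
  lra.
have pi0 : 0 < pi *+ 2 :> R by rewrite pmulrn_rgt0// pi_gt0.
have C0 : form_closed_on P Q u (ln r) 0 (pi *+ 2).
  by move=> x y /andP[_ hx] _; exact: cl.
have := goursat_rect ur (ltW pi0) C0; rewrite /rect_itg.
have -> : P^~ (pi *+ 2) = P^~ 0.
  by apply/funext => x; rewrite /P /G cexp_periodic.
move=> I0.
have cQ x : u <= x <= ln r -> cont_on (Q x) 0 (pi *+ 2).
  by move=> hx; exact: form_closed_cont_vert hx C0.
have M1 : segint (Q (ln r)) 0 (pi *+ 2) <= (complex.Re (F a) - eta) * (pi *+ 2).
  rewrite -[leRHS](_ : segint (fun=> complex.Re (F a) - eta) 0 (pi *+ 2) = _);
    last by rewrite segint_cst ?subr0// ltW.
  apply: segint_le; [by apply: cQ; rewrite lexx ur | exact: cont_on_cst|].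
  move=> y _; apply: Hr; rewrite addrC addKr cabs_cexp /= lnK//.
have M2 : (complex.Re (F a) - eta / 2) * (pi *+ 2) <= segint (Q u) 0 (pi *+ 2).
  rewrite -[leLHS](_ : segint (fun=> complex.Re (F a) - eta / 2) 0 (pi *+ 2) = _);
    last by rewrite segint_cst ?subr0// ltW.
  apply: segint_le; [exact: cont_on_cst | by apply: cQ; rewrite lexx ur |].
  move=> y _; have := Hd (cexp (u +i* y)%C); rewrite cabs_cexp => /(_ ud).
  move=> /(le_trans (Re_le_cabs _)).
  rewrite cReD cReN ler_norml => /andP[+ _].
  rewrite -/(G (u +i* y)%C) -/(Q u y).
  by rewrite lerBrDr addrC.
have : 0 < eta * (pi *+ 2) by rewrite mulr_gt0.
move: I0 M1 M2; set A := segint _ _ _; set B := segint _ _ _; set D := segint _ _ _.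
set w := pi *+ 2; nra.
Qed.

Lemma cabs_continuous (F : C -> C) (z : C) : {for z, continuous F} ->
  forall e : R, 0 < e -> exists2 r : R, 0 < r & forall s, cabs s < r ->
    `|cabs (F (z + s)) - cabs (F z)| <= e.
Proof.
move=> /continuousC_eps H e e0; have [r r0 Hr] := H e e0; exists r => // s /Hr.
have T1 := cabsD (F (z + s) - F z) (F z); have T2 := cabsD (F z - F (z + s)) (F (z + s)).
move: T1 T2; rewrite !subrK [cabs (F z - _)]cabsBC ler_norml; lra.
Qed.

(** Weierstrass on the closed disc, which is parametrized by a closed part of a real
square. *)
Lemma disc_max (f : C -> R) (r : R) : 0 <= r ->
  (forall z, cabs z <= r -> forall e : R, 0 < e -> exists2 d : R, 0 < d &
     forall s, cabs s < d -> `|f (z + s) - f z| <= e) ->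
  exists2 z, cabs z <= r & forall t, cabs t <= r -> f t <= f z.
Proof.
move=> r0 cf.
pose j (p : R * R) : C := (p.1 +i* p.2)%C.
pose A : set (R * R) := [set p | cabs (j p) <= r].
have jl (p q : R * R) (d : R) : ball p (d / 2) q -> cabs (j q - j p) < d.
  move=> [/= b1 b2]; rewrite (le_lt_trans (cabs_le_ReIm _))//=.
  by move: b1 b2; rewrite /ball /= distrC => b1; rewrite distrC => b2; lra.
have clA : closed A.
  rewrite -[A]setCK; apply: open_closedC; rewrite openE => p /= /negP; rewrite -ltNge => rp.
  apply/nbhs_ballP; exists ((cabs (j p) - r) / 2).
    by rewrite /= divr_gt0// subr_gt0.
  move=> q /jl Hq /=; apply/negP; rewrite -ltNge.
  have := cabsD (j p - j q) (j q); rewrite subrK; move: Hq; rewrite cabsBC; lra.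
have cA : compact A.
  apply: (@subclosed_compact _ _ (`[-r, r] `*` `[-r, r])) => //.
    by apply: compact_setX; exact: segment_compact.
  move=> p Ap; have := Re_le_cabs (j p); have := Im_le_cabs (j p).
  move=> /= h1 h2; rewrite !in_itv /=; move: Ap; rewrite /A /= => h3.
  by have := le_trans h1 h3; have := le_trans h2 h3; rewrite !ler_norml.
have A0 : A !=set0.
  by exists (0, 0); rewrite /A /j /= (_ : (0 +i* 0)%C = 0)// cabs0.
have [|p pA pmax] := compact_EVT_max (f := f \o j) A0 cA.
  apply: continuous_in_subspaceT => p /set_mem pA.
  apply/(@cvgrPdist_le _ _ _ (nbhs p) (nbhs_filter p)) => e e0.
  have [d d0 Hd] := cf (j p) pA e e0.
  apply/nbhs_ballP; exists (d / 2); first by rewrite /= divr_gt0.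
  move=> q /jl /Hd /=; rewrite distrC (_ : j p + (j q - j p) = j q)//; by ring.
exists (j p); first exact: set_mem pA.
move=> t tr; have := pmax (complex.Re t, complex.Im t).
rewrite /= (_ : j (_, _) = t); last by case: t {tr}.
by apply; apply/mem_set; rewrite /A /= (_ : j (_, _) = t)//; case: t {tr}.
Qed.

Lemma unimodular (z : C) : exists2 w, cabs w = 1 & w * z = (cabs z)%:C%C.
Proof.
have [->|z0] := eqVneq z 0; first by exists 1; rewrite ?cabs1// mulr0 cabs0.
exists ((cabs z)%:C%C / z); last by rewrite mulfVK.
by rewrite cabsM cabsV cabsR ger0_norm ?cabs_ge0// divff// cabs_eq0.
Qed.

Lemma cabs_sqrD (a s : C) : cabs (a + s) ^+ 2 =
  cabs a ^+ 2 + 2 * complex.Re (a^*%C * s) + cabs s ^+ 2.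
Proof. by rewrite !cabs2 !cReD !cImD cReM; case: a; case: s => /= *; ring. Qed.

(** Adding e |t|^2 to |K| makes the maximum strict in the mean: if it is attained at
z0 inside the disc, then w K(t) + 2 e conj(z0) (t - z0), with w K(z0) = |K(z0)|,
contradicts [no_strict_local_max] at z0. Singular points are allowed as long as
they are isolated, so that the principle applies to difference quotients. *)
Lemma max_principle (K : C -> C) (r B : R) : 0 < r ->
  (forall z, cabs z <= r -> {for z, continuous K}) ->
  (forall z, cabs z < r -> exists2 d, 0 < d & forall t, 0 < cabs (t - z) < d ->
      differentiable K t) ->
  (forall z, cabs z = r -> cabs (K z) <= B) ->
  forall z, cabs z <= r -> cabs (K z) <= B.
Proof.
move=> r0 cK dK KB z zr.
(* With this e, the added term e |t|^2 is at most e' on the disc. *)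
apply/ler_addgt0Pl => e' e'0; pose e := e' / (r ^+ 2 + 1).
have r20 : 0 < r ^+ 2 + 1 by rewrite ltr_wpDl ?sqr_ge0.
have e0 : 0 < e by rewrite divr_gt0.
pose psi t := cabs (K t) + e * cabs t ^+ 2.
have [|z0 z0r z0max] := @disc_max psi r (ltW r0).
  move=> t tr f f0.
  have f20 : 0 < f / 2 by rewrite divr_gt0.
  have [d1 d10 H1] := cabs_continuous (cK t tr) f20.
  have idc : {for t, continuous (fun z : C => (e%:C%C : C) * (z ^+ 2))}.
    by apply: differentiable_continuous; apply: differentiableM => //; exact: differentiableX.
  have [d2 d20 H2] := cabs_continuous idc f20.
  exists (Num.min d1 d2); first by rewrite lt_min d10.
  move=> s; rewrite lt_min => /andP[/H1 h1 /H2].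
  rewrite !(cabsM e%:C%C) !cabsX cabsR (gtr0_norm e0) /psi.
  by move: h1; rewrite !ler_norml; lra.
have : psi z <= B + e * r ^+ 2.
  have [rz0|z0r'] := eqVneq (cabs z0) r.
    by rewrite (le_trans (z0max z zr))// /psi rz0 lerD2r KB.
  have {z0r'}z0r' : cabs z0 < r by rewrite lt_neqAle z0r' z0r.
  have [d d0 dKz] := dK z0 z0r'.
  have [w w1 wK] := unimodular (K z0).
  pose s := Num.min d (r - cabs z0) / 2.
  have m0 : 0 < Num.min d (r - cabs z0) by rewrite lt_min d0 subr_gt0.
  have s0 : 0 < s by rewrite divr_gt0.
  have sd : s < d.
    have : Num.min d (r - cabs z0) <= d by rewrite ge_min lexx.
    by rewrite /s; lra.
  have sr : cabs z0 + s <= r.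
    have : Num.min d (r - cabs z0) <= r - cabs z0 by rewrite ge_min lexx orbT.
    by rewrite /s; lra.
  pose F t : C := w * K t + (2 * e)%:C%C * z0^*%C * (t - z0).
  exfalso; apply: (@no_strict_local_max F z0 d s (e * s ^+ 2)).
  - by rewrite s0.
  - by rewrite mulr_gt0 ?exprn_gt0.
  - by move=> t /dKz dt; apply: differentiableD; apply: differentiableM.
  - have c2 : {for z0, continuous (fun t : C => (2 * e)%:C%C * z0^*%C * (t - z0))}.
      by apply: differentiable_continuous; apply: differentiableM => //; apply: differentiableB.
    apply: (continuousD _ c2).
    by apply: continuousM; [exact: cst_continuous | exact: cK].
  move=> t ts.
  have tr : cabs t <= r.
    by have := cabsD (t - z0) z0; rewrite subrK ts; lra.
  have := z0max t tr; rewrite /psi.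
  have -> : cabs t ^+ 2 = cabs z0 ^+ 2 + 2 * complex.Re (z0^*%C * (t - z0)) + s ^+ 2.
    by rewrite -ts -cabs_sqrD; congr (cabs _ ^+ _); ring.
  rewrite /F subrr mulr0 addr0 wK cReD.
  have : complex.Re (w * K t) <= cabs (K t).
    by rewrite (le_trans (ler_norm _))// (le_trans (Re_le_cabs _))// cabsM w1 mul1r.
  rewrite -mulrA [complex.Re ((2 * e)%:C%C * _)]cReM [complex.Im _%:C%C]/= mul0r subr0.
  have reR (x : R) : complex.Re x%:C%C = x by [].
  rewrite !reR; clear; move: (complex.Re (w * K t)) (complex.Re _) => X Y.
  by move: (s ^+ 2) (cabs z0 ^+ 2) (cabs (K z0)) (cabs (K t)) => *; lra.
rewrite /psi => H.
have : 0 <= e * cabs z ^+ 2 by rewrite mulr_ge0 ?sqr_ge0// ltW.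
have : e * r ^+ 2 <= e'.
  by rewrite /e mulrAC ler_pdivrMr// ler_pM2l// lerDl.
lra.
Qed.

(** The maximum principle for H(t) / t, completed by H'(0) at the origin. *)
Lemma schwarz (H : C -> C) (r r1 B : R) : 1 <= r < r1 ->
  (forall t, cabs t < r1 -> differentiable H t) -> H 0 = 0 ->
  (forall t, cabs t = r -> cabs (H t) <= B) -> r * cabs (H 1) <= B.
Proof.
move=> /andP[r_ge1 rr1] dH H0 HB.
have r0 : 0 < r by lra.
have [d Hd] := differentiable_has_cderiv (dH 0 ltac:(rewrite cabs0; lra)).
pose K t : C := if t == 0 then d else H t / t.
have dK t : t != 0 -> cabs t < r1 -> differentiable K t.
  move=> t0 tr.
  have dq : differentiable (fun t => H t / t) t.
    by apply: differentiableM; [exact: dH|apply: differentiableV].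
  have [l Hl] := differentiable_has_cderiv dq.
  apply: (@has_cderiv_differentiable _ _ _ l) => e e0; have [u u0 Hu] := Hl e e0.
  exists (Num.min u (cabs t)); first by rewrite lt_min u0 cabs_gt0.
  move=> s; rewrite lt_min => /andP[su st].
  rewrite /K (negPf t0) ifN; first exact: Hu.
  apply/eqP => ts0; move: st; rewrite -cabsN (_ : - s = t) ?ltxx//.
  by rewrite -[LHS]addr0 -ts0; ring.
have cK0 : {for 0, continuous K}.
  apply/continuousC_eps => e e0; have [u u0 Hu] := Hd e e0; exists u => // s /Hu.
  rewrite add0r H0 subr0 {2}/K eqxx /K; case: eqVneq => [_ _|s0].
    by rewrite subrr cabs0 ltW.
  move=> h; rewrite -(ler_pM2r (_ : 0 < cabs s)) ?cabs_gt0// -cabsM.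
  by rewrite mulrBl mulfVK.
have K1 : K 1 = H 1 by rewrite /K oner_eq0 divr1.
rewrite mulrC -ler_pdivlMr// -K1; apply: (max_principle r0); last by rewrite cabs1.
- move=> z zr; have [->//|z0] := eqVneq z 0.
  by apply: differentiable_continuous; apply: dK => //; lra.
- move=> z zr; have [z0|z0] := eqVneq z 0.
    exists r; first exact: r0.
    move=> t; rewrite z0 subr0 cabs_gt0.
    move=> /andP[t0 tr].
    by apply: dK; [exact: t0 | exact: lt_trans rr1].
  exists (Num.min (cabs z) (r - cabs z)).
    by rewrite lt_min cabs_gt0 z0 subr_gt0.
  move=> t; rewrite lt_min => /andP[_ /andP[tz tr]]; apply: dK.
    by apply/eqP => t0; move: tz; rewrite t0 sub0r cabsN ltxx.
  by have := cabsD (t - z) z; rewrite subrK; lra.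
- move=> z zr; have z0 : z != 0 by rewrite -cabs_gt0 zr.
  by rewrite /K (negPf z0) cabsM cabsV zr ler_pM2r ?invr_gt0// HB.
Qed.

End Schwarz.

(** * The Schwarz lemma with a weight *)

Section WeightedSchwarz.
Variable R : realType.
Local Notation C := R[i].

(** When psi is, up to E, the real part of a polynomial q plus lam |t|^2, the function
h exp(- q / 2) turns the bound by A exp(psi) into one by A exp(lam |t|^2 + E).
Apply [schwarz] to it: A exp(lam - E) r^2 <= A exp(lam r^2 + E). *)
Lemma weighted_schwarz (h : C -> C) (psi : C -> R) (r r1 A E lam L : R)
    (al be ga : C) : 1 <= r < r1 ->
  (forall t, cabs t < r1 -> differentiable h t) -> h 0 = 0 ->
  (forall t, cabs t <= r -> `|psi t -
     (complex.Re (al + be * t + ga * t ^+ 2) + lam * cabs t ^+ 2)| <= E) ->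
  (forall t, cabs t <= r -> cabs (h t) ^+ 2 <= A * expR (psi t)) ->
  A * expR (psi 1) <= cabs (h 1) ^+ 2 ->
  lam * (r ^+ 2 - 1) <= L -> expR (2 * E + L) < r ^+ 2 -> A <= 0.
Proof.
move=> /andP[r_ge1 rr1] dh h0 psiE hA Ah lamL Lr; rewrite leNgt; apply/negP => A0.
pose q t : C := al + be * t + ga * t ^+ 2.
pose H t : C := h t * cexp (- (2^-1 * q t)).
have dH t : cabs t < r1 -> differentiable H t.
  move=> tr; apply: differentiableM; first exact: dh.
  apply: (@differentiable_comp _ _ _ _ (fun t => - (2^-1 * q t)) (@cexp R));
    last exact: differentiable_cexp.
  have dq : differentiable (fun t : C => al + be * t + ga * t ^+ 2) t.
    apply: differentiableD; last by apply: differentiableM => //; exact: differentiableX.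
    by apply: differentiableD => //; exact: differentiableM.
  by apply: differentiableN; exact: differentiableM.
have H2 t : cabs (H t) ^+ 2 = cabs (h t) ^+ 2 * expR (- complex.Re (q t)).
  rewrite /H cabsM exprMn cabs_cexp -expRM_natl; congr (_ * expR _).
  have -> : (2^-1 : C) = (2^-1 : R)%:C%C by rewrite fmorphV /= rmorph_nat.
  by rewrite cReN cReM /=; field.
have r0 : 0 < r by lra.
pose B := Num.sqrt (A * expR (lam * r ^+ 2 + E)).
have B2 : B ^+ 2 = A * expR (lam * r ^+ 2 + E).
  by rewrite sqr_sqrtr// mulr_ge0 ?expR_ge0// ltW.
have HB t : cabs t = r -> cabs (H t) <= B.
  move=> tr; rewrite -(ler_pXn2r (n:=2)) ?nnegrE ?cabs_ge0 ?sqrtr_ge0// B2 H2.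
  have tr' : cabs t <= r by rewrite tr.
  apply: (@le_trans _ _ (A * expR (psi t) * expR (- complex.Re (q t)))).
    by rewrite ler_wpM2r ?expR_ge0// hA.
  rewrite -mulrA -expRD ler_pM2l// ler_expR.
  by have := psiE t tr'; rewrite ler_norml tr -/(q t); lra.
have H0 : H 0 = 0 by rewrite /H h0 mul0r.
have r1r : 1 <= r < r1 by rewrite r_ge1.
have := schwarz r1r dH H0 HB.
rewrite -(ler_pXn2r (n:=2)) ?nnegrE ?cabs_ge0 ?sqrtr_ge0//; last first.
  by rewrite mulr_ge0 ?cabs_ge0// ltW.
rewrite B2 exprMn H2; apply/negP; rewrite -ltNge.
have r20 : 0 < r ^+ 2 by rewrite exprn_gt0.
have e0 : 0 < expR (- complex.Re (q 1)) by exact: expR_gt0.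
have h1 : A * (expR (psi 1) * expR (- complex.Re (q 1))) <=
    cabs (h 1) ^+ 2 * expR (- complex.Re (q 1)).
  by rewrite mulrA ler_pM2r.
apply: (@lt_le_trans _ _ (r ^+ 2 * (A * (expR (psi 1) * expR (- complex.Re (q 1))))));
  last by rewrite ler_pM2l.
have := psiE 1; rewrite cabs1 => /(_ r_ge1); rewrite -/(q 1) ler_norml => h2.
rewrite -expRD [ltRHS]mulrCA ltr_pM2l//.
apply: (@lt_le_trans _ _ (r ^+ 2 * expR (lam - E))); last first.
  by rewrite ler_pM2l// ler_expR; lra.
rewrite -ltr_pdivrMr ?expR_gt0// -expRN -expRD.
by apply: le_lt_trans Lr; rewrite ler_expR; lra.
Qed.

End WeightedSchwarz.

(** * The real-valued norm of a complex vector *)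

Section VectorNorm.
Variables (R : realType) (n : nat).
Local Notation C := R[i].
Local Notation Cn := 'rV[C]_n.

(** As for [cabs]; this is the maximum of the moduli of the coordinates. *)
Definition vnorm (v : Cn) : R := complex.Re `|v|.

Lemma vnormE v : `|v| = (vnorm v)%:C%C.
Proof. by rewrite /vnorm RRe_real// normr_real. Qed.

Lemma vnorm_ge0 v : 0 <= vnorm v.
Proof. by rewrite -lecR -vnormE normr_ge0. Qed.

Lemma vnormD v w : vnorm (v + w) <= vnorm v + vnorm w.
Proof. by rewrite -lecR rmorphD /= -!vnormE ler_normD. Qed.

Lemma vnormN v : vnorm (- v) = vnorm v.
Proof. by rewrite /vnorm normrN. Qed.

Lemma vnormBC v w : vnorm (v - w) = vnorm (w - v).
Proof. by rewrite /vnorm distrC. Qed.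

Lemma vnorm0 : vnorm 0 = 0.
Proof. by rewrite /vnorm normr0. Qed.

Lemma vnormZ (a : C) v : vnorm (a *: v) = cabs a * vnorm v.
Proof. by apply: complexI; rewrite rmorphM /= -vnormE -cabsE -vnormE normrZ. Qed.

Lemma le_vnorm (v : Cn) (j : 'I_n) : cabs (v ord0 j) <= vnorm v.
Proof.
rewrite -lecR -cabsE -vnormE.
rewrite [leRHS]/Num.norm /= mx_normE -[leLHS]nngE num_le.
by apply/bigmax_geP; right => /=; exists (ord0, j).
Qed.

Lemma vnorm_le (v : Cn) (c : R) : 0 <= c -> (forall j : 'I_n, cabs (v ord0 j) <= c) -> vnorm v <= c.
Proof.
move=> c0 H; rewrite -lecR -vnormE.
have [/eqP|/mx_norm_neq0[[i j]]] := eqVneq (mx_norm v) 0.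
  by rewrite /Num.norm /= => /eqP ->; rewrite lecR.
by rewrite /Num.norm /= => -> /=; rewrite ord1 [leLHS]cabsE lecR.
Qed.

Lemma nbhs_vnorm (z : Cn) (A : set Cn) : nbhs z A <->
  exists2 d : R, 0 < d & forall w, vnorm w < d -> A (z + w).
Proof.
split=> [/nbhs_ballP[e /= /posC_real[d d0 ->]] H|[d d0 H]].
  exists d => // w wd; apply: H; rewrite -ball_normE /= opprD addNKr normrN vnormE.
  by rewrite ltcR.
apply/nbhs_ballP; exists d%:C%C => /=; first by rewrite ltcR.
move=> w; rewrite -ball_normE /= vnormE ltcR vnormBC => /H.
by rewrite (_ : z + (w - z) = w)//; rewrite addrCA subrr addr0.
Qed.

End VectorNorm.

(** * Real functions of class C^k *)

Section RealClass.
Variables (R : realType) (n : nat).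
Local Notation C := R[i].
Local Notation Cn := 'rV[C]_n.
Implicit Types (U : set Cn) (f g : Cn -> R) (v w z : Cn) (k : nat).

Definition line f z v (t : R) : R := f (z + t%:C%C *: v).

Definition dderiv v f z : R := derive1 (line f z v) 0.

(** The real counterpart of [class_C]; working with real functions avoids carrying
real and imaginary parts through the calculus. *)
Fixpoint rclassC (k : nat) U f : Prop :=
  (forall z, U z -> {for z, continuous f}) /\
  if k is k'.+1 then
    forall v, (forall z, U z -> derivable (line f z v) 0 1) /\ rclassC k' U (dderiv v f)
  else True.

Lemma rclassC_continuous k U f z : rclassC k U f -> U z -> {for z, continuous f}.
Proof. by case: k => [|k] [H _]; exact: H. Qed.

Lemma rclassC_dderiv k U f v : rclassC k.+1 U f -> rclassC k U (dderiv v f).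
Proof. by case=> _ /(_ v)[]. Qed.

Lemma rclassC_S k U f : rclassC k.+1 U f -> rclassC k U f.
Proof.
elim: k f => [f [cf _]|k IH f [cf H]]; split => // v.
by have [h1 /IH h2] := H v.
Qed.

Lemma rclassC_is_derive k U f v z : rclassC k.+1 U f -> U z ->
  is_derive (0 : R) 1 (line f z v) (dderiv v f z).
Proof.
move=> [_ /(_ v)[H _]] Uz; apply: DeriveDef; first exact: H.
by rewrite /dderiv derive1E.
Qed.

Lemma dderiv_eq f v z (l : R) : is_derive (0 : R) 1 (line f z v) l -> dderiv v f z = l.
Proof. by move=> [_ <-]; rewrite /dderiv derive1E. Qed.

Lemma open_line U z v : open U -> U z -> \forall t \near (0 : R), U (z + t%:C%C *: v).
Proof.
move=> oU Uz; have /nbhs_vnorm[d d0 H] : nbhs z U by exact: open_nbhs_nbhs.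
exists (d / (vnorm v + 1)); first by rewrite /= divr_gt0// ltr_wpDl// vnorm_ge0.
move=> t /=; rewrite sub0r normrN => td; apply: H; rewrite vnormZ cabsR.
have v0 := vnorm_ge0 v; have v10 : 0 < vnorm v + 1 by lra.
by apply: le_lt_trans (_ : `|t| * (vnorm v + 1) < d);
  [rewrite ler_wpM2l ?lerDl | rewrite -ltr_pdivlMr].
Qed.

Lemma dderiv_ext U f g v z : open U -> (forall z, U z -> f z = g z) -> U z ->
  (derivable (line f z v) 0 1 -> derivable (line g z v) 0 1) /\ dderiv v f z = dderiv v g z.
Proof.
move=> oU fg Uz; have H := open_line v oU Uz.
have fg' : {near (0 : R), line f z v =1 line g z v}.
  by apply: filterS H => t /fg.
split; last by rewrite /dderiv !derive1E; exact: near_eq_derive.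
exact: near_eq_derivable fg'.
Qed.

Lemma continuous_ext U f g z : open U -> (forall z, U z -> f z = g z) -> U z ->
  {for z, continuous f} -> {for z, continuous g}.
Proof.
move=> oU fg Uz cf; suff : g @ z --> g z by [].
rewrite -(fg z Uz).
have zU : \forall t \near z, U t by exact: open_nbhs_nbhs.
have fgz : \forall t \near z, f t = g t by apply: filterS zU => t /fg.
exact: cvg_trans (near_eq_cvg fgz) cf.
Qed.

Lemma rclassC_ext k U f g : open U -> (forall z, U z -> f z = g z) -> rclassC k U f ->
  rclassC k U g.
Proof.
move=> oU; elim: k f g => [|k IH] f g fg [cf H]; split.
- by move=> z Uz; exact: continuous_ext oU fg Uz (cf z Uz).
- by [].
- by move=> z Uz; exact: continuous_ext oU fg Uz (cf z Uz).
- move=> v; have [h1 h2] := H v; split.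
    by move=> z Uz; have [+ _] := dderiv_ext v oU fg Uz; apply; exact: h1.
  by apply: IH h2 => z Uz; have [_ ->] := dderiv_ext v oU fg Uz.
Qed.

(** It suffices to exhibit the directional derivatives, for instance by the Leibniz
rule; this is how closure under each operation is proved, by induction on k. *)
Lemma rclassC_build k U f : (forall z, U z -> {for z, continuous f}) ->
  (forall v, exists2 g, rclassC k U g &
     forall z, U z -> is_derive (0 : R) 1 (line f z v) (g z)) ->
  open U -> rclassC k.+1 U f.
Proof.
move=> cf H oU; split=> // v; have [g gC gd] := H v; split.
  by move=> z /gd[].
by apply: rclassC_ext gC => // z /gd /dderiv_eq ->.
Qed.

Lemma rclassC_cst k U (c : R) : open U -> rclassC k U (fun=> c).
Proof.
move=> oU; elim: k c => [|k IH] c.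
  by split => // z _; exact: cst_continuous.
apply: rclassC_build => // [z _|v]; first exact: cst_continuous.
by exists (fun=> 0) => // z Uz; exact: is_derive_cst.
Qed.

Lemma rclassC_add k U f g : open U -> rclassC k U f -> rclassC k U g -> rclassC k U (fun z =>
  f z + g z).
Proof.
move=> oU; elim: k f g => [|k IH] f g fC gC.
  split=> // z Uz; apply: continuousD; [exact: rclassC_continuous fC Uz|exact:
    rclassC_continuous gC Uz].
apply: rclassC_build => // [z Uz|v].
  apply: continuousD; [exact: rclassC_continuous fC Uz|exact: rclassC_continuous gC Uz].
exists (fun z => dderiv v f z + dderiv v g z); first by apply: IH; exact: rclassC_dderiv.
move=> z Uz; exact: is_deriveD (rclassC_is_derive v fC Uz) (rclassC_is_derive v gC Uz).
Qed.

Lemma rclassC_mul k U f g : open U -> rclassC k U f -> rclassC k U g -> rclassC k U (fun z =>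
  f z * g z).
Proof.
move=> oU; elim: k f g => [|k IH] f g fC gC.
  split=> // z Uz; apply: continuousM; [exact: rclassC_continuous fC Uz|exact:
    rclassC_continuous gC Uz].
apply: rclassC_build => // [z Uz|v].
  apply: continuousM; [exact: rclassC_continuous fC Uz|exact: rclassC_continuous gC Uz].
exists (fun z => f z * dderiv v g z + g z * dderiv v f z).
  by apply: rclassC_add => //; apply: IH; (exact: rclassC_dderiv || exact: rclassC_S).
move=> z Uz.
have := is_deriveM (rclassC_is_derive v fC Uz) (rclassC_is_derive v gC Uz).
by rewrite /line scale0r addr0.
Qed.

Lemma rclassC_inv k U f : open U -> (forall z, U z -> f z != 0) -> rclassC k U f ->
  rclassC k U (fun z => (f z)^-1).
Proof.
move=> oU f0; elim: k f f0 => [|k IH] f f0 fC.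
  by split=> // z Uz; apply: continuousV; [exact: f0|exact: rclassC_continuous fC Uz].
apply: rclassC_build => // [z Uz|v].
  by apply: continuousV; [exact: f0|exact: rclassC_continuous fC Uz].
exists (fun z => (-1) * ((f z)^-1 * (f z)^-1) * dderiv v f z).
  apply: rclassC_mul => //; last exact: rclassC_dderiv.
  apply: rclassC_mul => //; first exact: rclassC_cst.
  by apply: rclassC_mul => //; apply: IH => //; exact: rclassC_S.
move=> z Uz.
have Hf := rclassC_is_derive v fC Uz.
have f00 : line f z v 0 != 0 by rewrite /line scale0r addr0 f0.
have := is_deriveV f00 Hf.
rewrite /line scale0r addr0 /GRing.scale /= => /is_derive_eq; apply.
by rewrite -exprVn expr2 mulN1r.
Qed.

Lemma rclassC_ln k U f : open U -> (forall z, U z -> 0 < f z) -> rclassC k U f ->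
  rclassC k U (fun z => ln (f z)).
Proof.
move=> oU f0 fC.
have cl j : rclassC j U f -> forall z, U z -> {for z, continuous (fun z => ln (f z))}.
  move=> fC' z Uz; apply: (@continuous_comp _ _ _ f (@ln R)).
    exact: rclassC_continuous fC' Uz.
  exact: continuous_ln (f0 z Uz).
case: k fC => [|k] fC; first by split => //; exact: cl fC.
apply: rclassC_build => //; first exact: cl fC.
move=> v; exists (fun z => (f z)^-1 * dderiv v f z).
  apply: rclassC_mul => //; last exact: rclassC_dderiv.
  by apply: rclassC_inv => // [z /f0 /gt_eqF ->//|]; exact: rclassC_S.
move=> z Uz.
have Hf := rclassC_is_derive v fC Uz.
have f00 : 0 < line f z v 0 by rewrite /line scale0r addr0 f0.
have := is_derive1_comp (is_derive1_ln f00) Hf.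
by rewrite {2}/line scale0r addr0.
Qed.

End RealClass.

(** * Mean value and Taylor inequalities in one variable *)

Section OneVariable.
Variable R : realType.
Implicit Types (F dF : R -> R) (x t M : R).

Lemma eps_is_derive F x (l : R) :
  (forall e, 0 < e -> exists2 d, 0 < d &
     forall h, `|h| < d -> `|F (x + h) - F x - l * h| <= e * `|h|) ->
  is_derive x 1 F l.
Proof.
move=> H.
have Hl : (fun h => h^-1 *: ((F \o shift x) (h *: 1) - F x)) @ 0^' --> l.
  apply/cvgrPdist_le => e e0; have [d d0 Hd] := H e e0.
  exists d => //= h /=; rewrite sub0r normrN => hd h0.
  rewrite -(ler_pM2r (_ : 0 < `|h|)) ?normr_gt0// distrC -normrM.
  have -> : (h^-1 *: (F (h *: 1 + x) - F x) - l) * h = F (x + h) - F x - l * h.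
    rewrite /GRing.scale /= mulr1 [h + x]addrC; by field.
  exact: Hd.
apply: DeriveDef; first by apply/cvg_ex; exists l.
exact: cvg_lim.
Qed.

Lemma mvt F dF (t : R) : 0 <= t ->
  (forall x, 0 <= x <= t -> is_derive x 1 F (dF x)) ->
  exists2 x, 0 <= x <= t & F t - F 0 = dF x * t.
Proof.
move=> t0 H; have [x||x xt E] := @MVT_segment R F dF 0 t t0.
- by rewrite in_itv /= => /andP[/ltW x0 /ltW xt]; apply: H; rewrite x0.
- apply: continuous_in_subspaceT => x; rewrite inE /= in_itv /= => /H [dx _].
  by apply: differentiable_continuous; apply/derivable1_diffP.
by move: xt E; rewrite in_itv /= subr0 => xt ->; exists x.
Qed.

Lemma mvt_le F dF (t M : R) : 0 <= t ->
  (forall x, 0 <= x <= t -> is_derive x 1 F (dF x)) ->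
  (forall x, 0 <= x <= t -> `|dF x| <= M) -> `|F t - F 0| <= M * t.
Proof.
move=> t0 H B; have [x xt ->] := mvt t0 H.
by rewrite normrM (ger0_norm t0) ler_wpM2r// B.
Qed.

Lemma mvt_sym F dF (t : R) :
  (forall x, `|x| <= `|t| -> is_derive x 1 F (dF x)) ->
  exists2 x, `|x| <= `|t| & F t - F 0 = dF x * t.
Proof.
move=> H; have [t0|/ltW t0] := leP 0 t.
  have [|x /andP[x0 xt] E] := @mvt F dF t t0.
    by move=> x /andP[x0 xt]; apply: H; rewrite !ger0_norm.
  by exists x => //; rewrite !ger0_norm.
have nt0 : 0 <= - t by rewrite oppr_ge0.
have [|x /andP[x0 xt]] := @mvt (fun x => F (- x)) (fun x => - dF (- x)) (- t) nt0.
  move=> x /andP[x0 xt]; have Hx : is_derive (- x) 1 F (dF (- x)).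
    by apply: H; rewrite normrN ger0_norm// ler0_norm.
  by have := is_derive1_comp Hx (is_deriveNid x 1); rewrite mulrN1.
rewrite opprK oppr0 mulrNN => E; exists (- x) => //.
by rewrite normrN ger0_norm// ler0_norm.
Qed.

(** The constant 1, instead of 1/6, comes from iterating the mean value inequality
rather than integrating. *)
Lemma taylor2 F F1 F2 F3 (M : R) :
  (forall x, 0 <= x <= 1 -> is_derive x 1 F (F1 x)) ->
  (forall x, 0 <= x <= 1 -> is_derive x 1 F1 (F2 x)) ->
  (forall x, 0 <= x <= 1 -> is_derive x 1 F2 (F3 x)) ->
  (forall x, 0 <= x <= 1 -> `|F3 x| <= M) ->
  `|F 1 - F 0 - F1 0 - F2 0 / 2| <= M.
Proof.
move=> d1 d2 d3 B.
have M0 : 0 <= M by apply: le_trans (B 0 _); rewrite ?normr_ge0// lexx ler01.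
have MM x : 0 <= x <= 1 -> M * x <= M by move=> /andP[_ x1]; rewrite ler_piMr.
have B2 x : 0 <= x <= 1 -> `|F2 x - F2 0| <= M.
  move=> /[dup] hx /andP[x0 x1]; apply: le_trans (MM x hx).
  by apply: (mvt_le x0 (dF := F3)) => y /andP[y0 yx]; [apply: d3|apply: B]; lra.
have dl (c x : R) : is_derive x 1 (fun x => c * x) c.
  have := is_deriveZ c (is_derive_id x 1); rewrite /GRing.scale /= mulr1; exact.
have B1 x : 0 <= x <= 1 -> `|F1 x - F1 0 - F2 0 * x| <= M.
  move=> /[dup] hx /andP[x0 x1]; apply: le_trans (MM x hx).
  have := mvt_le x0 (F := fun y => F1 y - F2 0 * y) (dF := fun y => F2 y - F2 0) (M := M).
  rewrite mulr0 subr0 => h; rewrite addrAC; apply: h => y /andP[y0 yx].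
    have hy : 0 <= y <= 1 by lra.
    exact: is_deriveB (d2 y hy) (dl _ y).
  by apply: B2; lra.
have dq (x : R) : is_derive x 1 (fun x => F2 0 / 2 * (x * x)) (F2 0 * x).
  have := is_deriveZ (F2 0 / 2) (is_deriveM (is_derive_id x 1) (is_derive_id x 1)).
  move=> /is_derive_eq; apply; rewrite /GRing.scale /= mulr1; by field.
have := mvt_le ler01 (F := fun y => F y - F1 0 * y - F2 0 / 2 * (y * y))
  (dF := fun y => F1 y - F1 0 - F2 0 * y) (M := M).
rewrite !mulr0 !mulr1 !subr0 => h.
have -> : F 1 - F 0 - F1 0 - F2 0 / 2 = F 1 - F1 0 - F2 0 / 2 - F 0 by ring.
apply: h => // y hy.
exact: is_deriveB (is_deriveB (d1 y hy) (dl _ y)) (dq y).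
Qed.

End OneVariable.

(** * Linearity and symmetry of directional derivatives *)

Section SeveralVariables.
Variables (R : realType) (n : nat).
Local Notation C := R[i].
Local Notation Cn := 'rV[C]_n.
Implicit Types (U : set Cn) (f g : Cn -> R) (v w z : Cn) (k : nat).

Lemma line_is_derive k U f z v (t : R) : rclassC k.+1 U f -> U (z + t%:C%C *: v) ->
  is_derive t 1 (line f z v) (dderiv v f (z + t%:C%C *: v)).
Proof.
move=> fC Ut.
have H := rclassC_is_derive v fC Ut.
have d1 : is_derive t 1 (fun s : R => s - t) 1.
  by have := is_deriveB (is_derive_id t 1) (is_derive_cst t t 1); rewrite subr0.
have H' : is_derive ((fun s : R => s - t) t) 1 (line f (z + t%:C%C *: v) v)
   (dderiv v f (z + t%:C%C *: v)) by rewrite subrr.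
have E : line f (z + t%:C%C *: v) v \o (fun s : R => s - t) = line f z v.
  apply/funext => s; rewrite /line /=; congr f.
  by rewrite -addrA -scalerDl -rmorphD /= [t + _]addrC subrK.
by have := @is_derive1_comp _ _ (fun s : R => s - t) _ _ _ H' d1; rewrite mulr1 E.
Qed.

Lemma continuous_vnorm f z : {for z, continuous f} ->
  forall e : R, 0 < e -> exists2 d : R, 0 < d &
    forall w, vnorm w < d -> `|f (z + w) - f z| <= e.
Proof.
move=> /cvgrPdist_le H e e0; have /nbhs_vnorm[d d0 Hd] := H e e0.
by exists d => // w /Hd; rewrite /= distrC.
Qed.

Lemma open_vnorm U z : open U -> U z ->
  exists2 d : R, 0 < d & forall w, vnorm w < d -> U (z + w).
Proof. by move=> oU Uz; apply/nbhs_vnorm; exact: open_nbhs_nbhs. Qed.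

(** Continuity of the derivative along w lets one move first along v and then along
w. *)
Lemma dderiv_add U f v w z : open U -> rclassC 1 U f -> U z ->
  dderiv (v + w) f z = dderiv v f z + dderiv w f z.
Proof.
move=> oU fC Uz; apply: dderiv_eq; apply: eps_is_derive => e e0.
have e20 : 0 < e / 2 by rewrite divr_gt0.
have [d1 d10 HU] := open_vnorm oU Uz.
have cw := rclassC_continuous (rclassC_dderiv w fC) Uz.
have [d2 d20 H2] := continuous_vnorm cw e20.
have [d3 d30 H3] := is_derive_eps (rclassC_is_derive v fC Uz) e20.
pose s := vnorm v + vnorm w + 1.
have s0 : 0 < s by rewrite ltr_wpDl// addr_ge0 ?vnorm_ge0.
exists (Num.min (Num.min d1 d2 / s) d3).
  by rewrite !lt_min d30 divr_gt0// lt_min d10.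
move=> h; rewrite lt_min ltr_pdivlMr// lt_min => /andP[/andP[h1 h2] h3].
have small x : `|x| <= `|h| -> vnorm (h%:C%C *: v + x%:C%C *: w) <= `|h| * s.
  move=> xh; rewrite (le_trans (vnormD _ _))// !vnormZ !cabsR /s.
  have : `|x| * vnorm w <= `|h| * vnorm w by rewrite ler_wpM2r ?vnorm_ge0.
  have := normr_ge0 h; lra.
have [|x xh Ex] := @mvt_sym R (line f (z + h%:C%C *: v) w)
    (fun x => dderiv w f (z + h%:C%C *: v + x%:C%C *: w)) h.
  move=> x xh; apply: line_is_derive fC _; rewrite -addrA; apply: HU.
  exact: le_lt_trans (small x xh) h1.
have := H3 h h3; have := H2 _ (le_lt_trans (small x xh) h2).
rewrite !add0r.
have -> : line f z (v + w) h = line f (z + h%:C%C *: v) w h.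
  by rewrite /line scalerDr addrA.
rewrite [line f z (v + w) 0]/line [line f z v 0]/line !scale0r addr0.
move: Ex; rewrite {2}/line scale0r addr0 -/(line f z v h) addrA.
set a := line f _ _ h; set b := line f _ _ h; set c := f z.
set A := dderiv v f z; set B := dderiv w f z; set B' := dderiv w f _ => E E1 E2.
have -> : a - c - (A + B) * h = (b - c - A * h) + (B' - B) * h.
  by rewrite mulrBl -E; ring.
have : `|(B' - B) * h| <= e / 2 * `|h| by rewrite normrM ler_wpM2r.
by have := ler_normD (b - c - A * h) ((B' - B) * h); lra.
Qed.

Lemma dderiv_scale U f v z (a : R) : open U -> rclassC 1 U f -> U z ->
  dderiv (a%:C%C *: v) f z = a * dderiv v f z.
Proof.
move=> oU fC Uz; apply: dderiv_eq.
have d1 : is_derive (0 : R) 1 (fun s : R => a * s) a.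
  have := is_deriveZ a (is_derive_id (0 : R) 1); rewrite /GRing.scale /= mulr1; exact.
have H' : is_derive ((fun s : R => a * s) 0) 1 (line f z v) (dderiv v f z).
  by rewrite mulr0; exact: rclassC_is_derive fC Uz.
have E : line f z v \o (fun s : R => a * s) = line f z (a%:C%C *: v).
  by apply/funext => s; rewrite /line /= scalerA -rmorphM /= mulrC.
by have := @is_derive1_comp _ _ (fun s : R => a * s) _ _ _ H' d1; rewrite mulrC E.
Qed.

Lemma dderiv_0 f z : dderiv 0 f z = 0.
Proof.
apply: dderiv_eq; rewrite (_ : line f z 0 = cst (f z)); first exact: is_derive_cst.
by apply/funext => t; rewrite /line scaler0 addr0.
Qed.

Lemma dderiv_comb U f z (I : Type) (r : seq I) (a : I -> R) (d : I -> Cn) :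
  open U -> rclassC 1 U f -> U z ->
  dderiv (\sum_(i <- r) (a i)%:C%C *: d i) f z = \sum_(i <- r) a i * dderiv (d i) f z.
Proof.
move=> oU fC Uz; elim: r => [|i r IH]; first by rewrite !big_nil dderiv_0.
by rewrite !big_cons (dderiv_add _ _ oU fC Uz) (dderiv_scale _ _ oU fC Uz) IH.
Qed.

Lemma dderiv_fun_comb U z v (I : Type) (r : seq I) (a : I -> R) (F : I -> Cn -> R) :
  (forall i, rclassC 1 U (F i)) -> U z ->
  dderiv v (fun z => \sum_(i <- r) a i * F i z) z = \sum_(i <- r) a i * dderiv v (F i) z.
Proof.
move=> FC Uz; apply: dderiv_eq; elim: r => [|i r IH].
  rewrite big_nil (_ : line _ _ _ = cst 0); first exact: is_derive_cst.
  by apply/funext => t; rewrite /line big_nil.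
have := is_deriveD (is_deriveZ (a i) (rclassC_is_derive v (FC i) Uz)) IH.
rewrite big_cons; congr is_derive.
by apply/funext => t; rewrite /line /= big_cons.
Qed.

(** The mean value theorem along v, then along w. *)
Lemma mixed_difference U f z v w (s : R) : open U -> rclassC 2 U f -> 0 <= s ->
  (forall x y, 0 <= x <= s -> 0 <= y <= s -> U (z + x%:C%C *: v + y%:C%C *: w)) ->
  exists x y, [/\ 0 <= x <= s, 0 <= y <= s &
    f (z + s%:C%C *: v + s%:C%C *: w) - f (z + s%:C%C *: v)
      - (f (z + s%:C%C *: w) - f z) =
    dderiv w (dderiv v f) (z + x%:C%C *: v + y%:C%C *: w) * s * s].
Proof.
move=> oU fC s0 HU.
have ss : 0 <= s <= s by lra.
have zs : 0 <= (0 : R) <= s by apply/andP.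
have [|x xs] := @mvt R (fun x => line f (z + s%:C%C *: w) v x - line f z v x)
   (fun x => dderiv v f (z + s%:C%C *: w + x%:C%C *: v) - dderiv v f (z + x%:C%C *: v)) s s0.
  move=> x xs; apply: is_deriveB; apply: line_is_derive fC _.
    by rewrite addrAC; exact: HU.
  by have := HU x 0 xs zs; rewrite scale0r addr0.
have [|y ys] := @mvt R (line (dderiv v f) (z + x%:C%C *: v) w)
   (fun y => dderiv w (dderiv v f) (z + x%:C%C *: v + y%:C%C *: w)) s s0.
  by move=> y ys; apply: line_is_derive (rclassC_dderiv v fC) _; exact: HU.
rewrite /line !scale0r !addr0 => E2 E1; exists x, y; split; [exact: xs|exact: ys|].
by rewrite -E2 (addrAC _ _ (s%:C%C *: w)) E1 (addrAC _ _ (x%:C%C *: v)).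
Qed.

(** The left-hand side of [mixed_difference] is symmetric in v and w; both mixed
derivatives are its limit after division by s^2. *)
Lemma dderiv_sym U f z v w : open U -> rclassC 2 U f -> U z ->
  dderiv w (dderiv v f) z = dderiv v (dderiv w f) z.
Proof.
move=> oU fC Uz; apply/eqP; rewrite -subr_eq0 -normr_le0; apply/ler_addgt0Pl => e e0.
rewrite addr0; have e20 : 0 < e / 2 by rewrite divr_gt0.
have [d1 d10 HU] := open_vnorm oU Uz.
have [d2 d20 H2] := continuous_vnorm (rclassC_continuous (rclassC_dderiv w (rclassC_dderiv v
  fC)) Uz) e20.
have [d3 d30 H3] := continuous_vnorm (rclassC_continuous (rclassC_dderiv v (rclassC_dderiv w
  fC)) Uz) e20.
pose m := vnorm v + vnorm w + 1.
have m0 : 0 < m by rewrite ltr_wpDl// addr_ge0 ?vnorm_ge0.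
pose d := Num.min d1 (Num.min d2 d3).
have d0 : 0 < d by rewrite /d !lt_min d10 d20.
pose s := d / m / 2.
have s0 : 0 < s by rewrite !divr_gt0.
have small x y : 0 <= x <= s -> 0 <= y <= s -> vnorm (x%:C%C *: v + y%:C%C *: w) < d.
  move=> /andP[x0 xs] /andP[y0 ys]; rewrite (le_lt_trans (vnormD _ _))//.
  rewrite !vnormZ !cabsR !ger0_norm//.
  have : x * vnorm v <= s * vnorm v by rewrite ler_wpM2r ?vnorm_ge0.
  have : y * vnorm w <= s * vnorm w by rewrite ler_wpM2r ?vnorm_ge0.
  have : s * m < d by rewrite /s mulrAC divfK ?gt_eqF//; lra.
  by rewrite /m; lra.
have [x [y [xs ys E1]]] := @mixed_difference U f z v w s oU fC (ltW s0)
  ltac:(by move=> x y hx hy; rewrite -addrA; apply: HU; apply: lt_le_trans (small x y hx hy)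
    _; rewrite ge_min lexx).
have [x' [y' [xs' ys' E2]]] := @mixed_difference U f z w v s oU fC (ltW s0)
  ltac:(by move=> a b ha hb; rewrite -addrA [_ *: w + _]addrC; apply: HU;
  apply: lt_le_trans (small b a hb ha) _; rewrite ge_min lexx).
have E : dderiv w (dderiv v f) (z + x%:C%C *: v + y%:C%C *: w) =
         dderiv v (dderiv w f) (z + x'%:C%C *: w + y'%:C%C *: v).
  have s00 : s != 0 by rewrite gt_eqF.
  apply: (mulIf s00); apply: (mulIf s00).
  have swap (a b c q : R) : a - b - (c - q) = a - c - (b - q) by ring.
  rewrite (addrAC z (s%:C%C *: v)) swap in E1.
  by apply: etrans (etrans (esym E1) _) E2.
have dd2 : d <= d2 by rewrite /d !ge_min lexx !orbT.
have dd3 : d <= d3 by rewrite /d !ge_min lexx !orbT.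
have A1 := H2 _ (lt_le_trans (small x y xs ys) dd2).
have A2 := H3 _ (lt_le_trans (small y' x' ys' xs') dd3).
rewrite addrA in A1; rewrite [_ *: v + _]addrC addrA in A2.
move: A1 A2; rewrite {}E; move: (dderiv v (dderiv w f) _) => S.
move: (dderiv w (dderiv v f) z) (dderiv v (dderiv w f) z) => P Q; clear -e.
by rewrite !ler_norml; lra.
Qed.

End SeveralVariables.

(** * Taylor expansion in real coordinates and the Levi form *)

Section RealCoordinates.
Variables (R : realType) (n : nat).
Local Notation C := R[i].
Local Notation Cn := 'rV[C]_n.
Local Notation I := ('I_n * bool)%type.
Implicit Types (U : set Cn) (f g : Cn -> R) (u v w z c : Cn) (k : nat).

(** The real basis of C^n made of the vectors e_j and i e_j, indexed by (j, false) and
(j, true). *)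
Definition rbasis (i : I) : Cn :=
  if i.2 then 'i *: delta_mx 0 i.1 else delta_mx 0 i.1.

Definition rcoord w (i : I) : R :=
  if i.2 then complex.Im (w ord0 i.1) else complex.Re (w ord0 i.1).

Lemma ImC_i : ('i : R[i]) = 'i%C.
Proof. by rewrite complexiE. Qed.

Lemma rbasis_decomp w : w = \sum_i (rcoord w i)%:C%C *: rbasis i.
Proof.
rewrite -(pair_big xpredT xpredT (fun j b => (rcoord w (j, b))%:C%C *: rbasis (j, b))) /=.
rewrite {1}[w]row_sum_delta; apply: eq_bigr => j _.
rewrite big_bool /rcoord /rbasis /= scalerA -scalerDl; congr (_ *: _).
by rewrite addrC mulrC ImC_i -complexE.
Qed.

Lemma rcoordD v w i : rcoord (v + w) i = rcoord v i + rcoord w i.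
Proof. by rewrite /rcoord mxE; case: ifP; rewrite ?cReD ?cImD. Qed.

Lemma rcoordZ (a : R) v i : rcoord (a%:C%C *: v) i = a * rcoord v i.
Proof.
rewrite /rcoord mxE; case: ifP => _; rewrite ?cReM ?cImM /= mul0r ?addr0 ?subr0//.
Qed.

Lemma rcoord_le v i : `|rcoord v i| <= vnorm v.
Proof.
apply: le_trans (le_vnorm v i.1).
by rewrite /rcoord; case: ifP => _; rewrite ?Re_le_cabs ?Im_le_cabs.
Qed.

Definition diff1 f c w : R := \sum_i rcoord w i * dderiv (rbasis i) f c.

Definition hess f c v w : R :=
  \sum_i \sum_j rcoord v i * rcoord w j * dderiv (rbasis i) (dderiv (rbasis j) f) c.

Lemma diff1D f c v w : diff1 f c (v + w) = diff1 f c v + diff1 f c w.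
Proof. by rewrite /diff1 -big_split; apply: eq_bigr => i _; rewrite rcoordD mulrDl. Qed.

Lemma diff1Z f c (a : R) w : diff1 f c (a%:C%C *: w) = a * diff1 f c w.
Proof. by rewrite /diff1 mulr_sumr; apply: eq_bigr => i _; rewrite rcoordZ mulrA. Qed.

Lemma hessDl f c u v w : hess f c (u + v) w = hess f c u w + hess f c v w.
Proof.
rewrite /hess -big_split; apply: eq_bigr => i _ /=.
by rewrite -big_split; apply: eq_bigr => j _; rewrite rcoordD !mulrDl.
Qed.

Lemma hessZl f c (a : R) v w : hess f c (a%:C%C *: v) w = a * hess f c v w.
Proof.
rewrite /hess mulr_sumr; apply: eq_bigr => i _ /=.
by rewrite mulr_sumr; apply: eq_bigr => j _; rewrite rcoordZ !mulrA.
Qed.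

Lemma hess_sym U f c v w : open U -> rclassC 2 U f -> U c ->
  hess f c v w = hess f c w v.
Proof.
move=> oU fC Uc; rewrite /hess exchange_big; apply: eq_bigr => i _; apply: eq_bigr => j _.
by rewrite (dderiv_sym _ _ oU fC Uc) [rcoord v j * _]mulrC.
Qed.

Lemma dderiv_diff1 U f z w : open U -> rclassC 1 U f -> U z -> dderiv w f z = diff1 f z w.
Proof. by move=> oU fC Uz; rewrite {1}[w]rbasis_decomp (dderiv_comb _ _ _ oU fC Uz). Qed.

Lemma rclassC_sum k U (J : Type) (r : seq J) (a : J -> R) (F : J -> Cn -> R) :
  open U -> (forall j, rclassC k U (F j)) ->
  rclassC k U (fun z => \sum_(j <- r) a j * F j z).
Proof.
move=> oU FC; elim: r => [|j r IH].
  by apply: rclassC_ext (rclassC_cst k 0 oU) => // z _; rewrite big_nil.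
apply: (rclassC_ext oU (f := fun z => a j * F j z + \sum_(j <- r) a j * F j z)).
  by move=> z _; rewrite big_cons.
by apply: rclassC_add => //; apply: rclassC_mul => //; exact: rclassC_cst.
Qed.

Lemma dderiv2_hess U f z v w : open U -> rclassC 2 U f -> U z ->
  dderiv v (dderiv w f) z = hess f z v w.
Proof.
move=> oU fC Uz.
have fC1 := rclassC_S fC.
have E : dderiv v (dderiv w f) z = dderiv v (fun z => \sum_i rcoord w i * dderiv (rbasis i) f z) z.
  have [_ //] := dderiv_ext v oU (fun z Uz => dderiv_diff1 w oU fC1 Uz) Uz.
rewrite E (dderiv_fun_comb _ _ _ (fun i => rclassC_dderiv (rbasis i) fC) Uz).
rewrite /hess exchange_big; apply: eq_bigr => j _ /=.
rewrite (dderiv_diff1 v oU (rclassC_dderiv (rbasis j) fC) Uz) /diff1 mulr_sumr; apply: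
  eq_bigr => i _.
by rewrite [rcoord v i * rcoord w j]mulrC mulrA.
Qed.

Lemma sum_bound (J : finType) (F : J -> R) (M : R) :
  (forall j, `|F j| <= M) -> `|\sum_j F j| <= #|J|%:R * M.
Proof.
move=> H; rewrite (le_trans (ler_norm_sum _ _ _))//.
by rewrite (le_trans (ler_sum _ (fun j _ => H j)))// sumr_const mulr_natl.
Qed.

(** Expanding w in the real basis reduces the third derivatives along arbitrary
directions to finitely many functions, which are locally bounded. *)
Lemma dderiv3_bound U f z w (M : R) : open U -> rclassC 3 U f -> U z -> 0 <= M ->
  (forall i j l, `|dderiv (rbasis i) (dderiv (rbasis j) (dderiv (rbasis l) f)) z| <= M) ->
  `|dderiv w (dderiv w (dderiv w f)) z| <= #|{: I}|%:R ^+ 3 * M * vnorm w ^+ 3.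
Proof.
move=> oU fC Uz M0 B; have fC1 := rclassC_S (rclassC_S fC).
have E : dderiv w (dderiv w (dderiv w f)) z =
    dderiv w (dderiv w (fun z => \sum_i rcoord w i * dderiv (rbasis i) f z)) z.
  have [_ ] := dderiv_ext w oU (fun z Uz => (dderiv_ext w oU (fun z Uz => dderiv_diff1 w oU
    fC1 Uz) Uz).2) Uz.
  exact.
have SC : rclassC 2 U (fun z => \sum_i rcoord w i * dderiv (rbasis i) f z).
  exact: (rclassC_sum (index_enum I) (rcoord w) oU (fun i => rclassC_dderiv (rbasis i) fC)).
have V0 := vnorm_ge0 w.
have step (F : I -> R) (N : R) : 0 <= N -> (forall i, `|F i| <= N) ->
    `|\sum_i rcoord w i * F i| <= #|{: I}|%:R * (vnorm w * N).
  move=> N0 FN; apply: sum_bound => i; rewrite normrM.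
  by apply: ler_pM; [exact: normr_ge0 | exact: normr_ge0 | exact: rcoord_le | exact: FN].
rewrite E (dderiv2_hess _ _ oU SC Uz).
have -> : hess (fun z => \sum_i rcoord w i * dderiv (rbasis i) f z) z w w =
  \sum_i rcoord w i * (\sum_j rcoord w j * (\sum_l rcoord w l *
     dderiv (rbasis i) (dderiv (rbasis j) (dderiv (rbasis l) f)) z)).
  rewrite /hess; apply: eq_bigr => i _; rewrite mulr_sumr; apply: eq_bigr => j _.
  rewrite -mulrA; congr (_ * (_ * _)).
  have [_ ->] := dderiv_ext (rbasis i) oU (fun z Uz => dderiv_fun_comb (rbasis j) (index_enum
    I) (rcoord w)
     (fun l => rclassC_S (rclassC_dderiv (rbasis l) fC)) Uz) Uz.
  by rewrite (dderiv_fun_comb _ _ _ (fun l => rclassC_dderiv (rbasis j) (rclassC_dderiv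
    (rbasis l) fC)) Uz).
set N := #|_|%:R; have N0 : 0 <= N by rewrite /N ler0n.
have -> : N ^+ 3 * M * vnorm w ^+ 3 = N * (vnorm w * (N * (vnorm w * (N * (vnorm w * M))))).
  by ring.
have N1 : 0 <= N * (vnorm w * M) by rewrite !mulr_ge0.
have N2 : 0 <= N * (vnorm w * (N * (vnorm w * M))) by rewrite !mulr_ge0.
apply: (step _ _ N2) => i; apply: (step _ _ N1) => j; apply: (step _ _ M0) => l.
exact: B.
Qed.

Lemma local_bound (J : finType) (F : J -> Cn -> R) z :
  (forall j, {for z, continuous (F j)}) ->
  exists2 M, 0 <= M & exists2 d : R, 0 < d &
    forall w, vnorm w < d -> forall j, `|F j (z + w)| <= M.
Proof.
move=> cF; pose M := \sum_j (`|F j z| + 1).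
have M0 : 0 <= M by apply: sumr_ge0 => j _; rewrite addr_ge0.
exists M => //; apply/(nbhs_vnorm z (fun y => forall j, `|F j y| <= M)).
have H j : nbhs z (fun y => `|F j y| <= M).
  apply/(nbhs_vnorm z (fun y => `|F j y| <= M)).
  have [d d0 Hd] := continuous_vnorm (cF j) ltr01.
  exists d => // w /Hd H; have Mj : `|F j z| + 1 <= M.
    by rewrite /M (bigD1 j)//= lerDl sumr_ge0// => i _; rewrite addr_ge0.
  by have := ler_normD (F j (z + w) - F j z) (F j z); rewrite subrK; lra.
exact: (@filter_forall _ _ (fun j y => `|F j y| <= M) _ (nbhs_filter z) H).
Qed.

(** The constants are uniform in the centre c, which is what compactness arguments
need. *)
Lemma taylor_local U f z : open U -> rclassC 3 U f -> U z ->
  exists2 d, 0 < d & exists2 M, 0 <= M & forall c w,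
    vnorm (c - z) <= d -> vnorm w <= d ->
    [/\ U (c + w), (forall i j, `|dderiv (rbasis i) (dderiv (rbasis j) f) c| <= M) &
    `|f (c + w) - f c - diff1 f c w - hess f c w w / 2| <= M * vnorm w ^+ 3].
Proof.
move=> oU fC Uz.
have [d1 d10 HU] := open_vnorm oU Uz.
have [M2 M20 [d2 d20 H2]] := @local_bound _
  (fun ij : I * I => dderiv (rbasis ij.1) (dderiv (rbasis ij.2) f)) z
  (fun ij => rclassC_continuous (rclassC_dderiv _ (rclassC_dderiv _ fC)) Uz).
have [M3 M30 [d3 d30 H3]] := @local_bound _
  (fun ij : I * I * I => dderiv (rbasis ij.1.1) (dderiv (rbasis ij.1.2) (dderiv (rbasis ij.2) f))) z
  (fun ij => rclassC_continuous (rclassC_dderiv _ (rclassC_dderiv _ (rclassC_dderiv _ fC))) Uz).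
pose d := Num.min d1 (Num.min d2 d3) / 3.
have m0 : 0 < Num.min d1 (Num.min d2 d3) by rewrite !lt_min d10 d20.
have m1 : Num.min d1 (Num.min d2 d3) <= d1 by rewrite ge_min lexx.
have m2 : Num.min d1 (Num.min d2 d3) <= d2 by rewrite !ge_min lexx orbT.
have m3 : Num.min d1 (Num.min d2 d3) <= d3 by rewrite !ge_min lexx !orbT.
exists d; first by rewrite divr_gt0.
set M := #|{: I}|%:R ^+ 3 * M3.
have M0 : 0 <= M by rewrite mulr_ge0// exprn_ge0.
exists (M2 + M); first by rewrite addr_ge0.
move=> c w cz wd.
have near (t : R) : 0 <= t <= 1 -> vnorm (c + t%:C%C *: w - z) < Num.min d1 (Num.min d2 d3).
  move=> /andP[t0 t1]; rewrite addrAC (le_lt_trans (vnormD _ _))// vnormZ cabsR ger0_norm//.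
  have : t * vnorm w <= vnorm w by rewrite ler_piMl ?vnorm_ge0.
  by move: cz wd; rewrite /d; lra.
have zE y : y = z + (y - z) by rewrite addrC subrK.
have Uc t : 0 <= t <= 1 -> U (c + t%:C%C *: w).
  by move=> /near ht; rewrite [_ + _]zE; apply: HU; exact: lt_le_trans m1.
have c0 : vnorm (c - z) < Num.min d1 (Num.min d2 d3).
  by move: cz; rewrite /d; lra.
split.
- by have := Uc 1; rewrite scale1r; apply; rewrite lexx ler01.
- move=> i j; rewrite [c]zE; have := H2 _ (lt_le_trans c0 m2) (i, j) => /le_trans; apply.
  by rewrite lerDl.
have M3w : 0 <= M2 * vnorm w ^+ 3 by rewrite mulr_ge0// exprn_ge0// vnorm_ge0.
rewrite mulrDl; suff : `|f (c + w) - f c - diff1 f c w - hess f c w w / 2| <= M * vnorm w ^+ 3.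
  by lra.
have Uc0 : U c by have := Uc 0; rewrite scale0r addr0; apply; rewrite lexx ler01.
rewrite -(dderiv_diff1 _ oU (rclassC_S (rclassC_S fC)) Uc0) -(dderiv2_hess _ _ oU (rclassC_S
  fC) Uc0).
have := @taylor2 R (line f c w) (fun t => dderiv w f (c + t%:C%C *: w))
  (fun t => dderiv w (dderiv w f) (c + t%:C%C *: w))
  (fun t => dderiv w (dderiv w (dderiv w f)) (c + t%:C%C *: w)) (M * vnorm w ^+ 3).
rewrite /line !scale0r !scale1r !addr0; apply.
- by move=> t /Uc; exact: line_is_derive fC.
- by move=> t /Uc; exact: line_is_derive (rclassC_dderiv w fC).
- by move=> t /Uc; exact: line_is_derive (rclassC_dderiv w (rclassC_dderiv w fC)).
move=> t ht; apply: dderiv3_bound (Uc t ht) _ _ => // i j k.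
by rewrite [c + _]zE; exact: H3 _ (lt_le_trans (near t ht) m3) (i, j, k).
Qed.

(** One fourth of the Laplacian of f along the complex line spanned by v, that is to
say the derivative in t and tbar of f(c + t v) at t = 0. *)
Definition levi f c v : R := (hess f c v v + hess f c ('i *: v) ('i *: v)) / 4.

(** On the real plane t = a + i b the second order Taylor polynomial is a quadratic
polynomial in (a, b). The quadratic form of a^2, b^2 and a b is a trace part,
proportional to |t|^2, plus the real part of a multiple of t^2. *)
Lemma line_expansion U f c u v : open U -> rclassC 2 U f -> U c ->
  exists al be ga : C, forall t : C,
  f c + diff1 f c (u + t *: v) + hess f c (u + t *: v) (u + t *: v) / 2 =
  complex.Re (al + be * t + ga * t ^+ 2) + levi f c v * cabs t ^+ 2.
Proof.
move=> oU fC Uc; set iv := 'i *: v.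
exists (f c + diff1 f c u + hess f c u u / 2)%:C%C,
  ((diff1 f c v + hess f c u v) +i* - (diff1 f c iv + hess f c u iv))%C,
  (((hess f c v v - hess f c iv iv) / 4) +i* - (hess f c v iv / 2))%C.
move=> t.
have -> : t *: v = (complex.Re t)%:C%C *: v + (complex.Im t)%:C%C *: iv.
  by rewrite /iv scalerA -scalerDl ImC_i [_ * 'i%C]mulrC -complexE.
have sym := hess_sym _ _ oU fC Uc.
have hDr a b d : hess f c a (b + d) = hess f c a b + hess f c a d.
  by rewrite sym hessDl !(sym _ a).
have hZr x a b : hess f c a (x%:C%C *: b) = x * hess f c a b.
  by rewrite sym hessZl sym.
rewrite cabs2 !diff1D !diff1Z !hessDl !hDr !hessZl !hZr.
rewrite (sym v u) (sym iv u) (sym iv v) /levi -/iv.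
by case: t => a b /=; field.
Qed.

Lemma levi_bound f c v (M : R) : 0 <= M ->
  (forall i j, `|dderiv (rbasis i) (dderiv (rbasis j) f) c| <= M) ->
  `|levi f c v| <= #|{: I}|%:R ^+ 2 * M * vnorm v ^+ 2.
Proof.
move=> M0 B.
have hb w : `|hess f c w w| <= #|{: I}|%:R ^+ 2 * M * vnorm w ^+ 2.
  set N := #|_|%:R.
  have -> : N ^+ 2 * M * vnorm w ^+ 2 = N * (N * (vnorm w * vnorm w * M)) by ring.
  apply: sum_bound => i; apply: sum_bound => j; rewrite !normrM.
  by rewrite ler_pM ?mulr_ge0//; rewrite ler_pM ?rcoord_le.
have := hb v; have := hb ('i *: v).
rewrite vnormZ (_ : cabs 'i = 1) ?mul1r; last first.
  by rewrite ImC_i cabs_def /= expr0n expr1n add0r sqrtr1.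
rewrite /levi !ler_norml; lra.
Qed.

End RealCoordinates.

(** * The Levi matrix *)

Section LeviMatrix.
Local Open Scope sesquilinear_scope.
Variables (R : realType) (n : nat).
Local Notation C := R[i].
Local Notation Cn := 'rV[C]_n.
Local Notation rbasis := (@rbasis R n).
Implicit Types (U : set Cn) (v w z c : Cn).

Lemma conjCE (x : C) : x^* = (x^*)%C.
Proof. by []. Qed.

Lemma class_C_rclassC k U (f : Cn -> C) : class_C k U f ->
  rclassC k U (fun z => complex.Re (f z)) /\ rclassC k U (fun z => complex.Im (f z)).
Proof.
have cReIm (h : Cn -> C) z : {for z, continuous h} ->
    {for z, continuous (fun z => complex.Re (h z))} /\
    {for z, continuous (fun z => complex.Im (h z))}.
  move=> /cvgrPdist_le ch; split; apply/(@cvgrPdist_le _ _ _ (nbhs z) (nbhs_filter z)) => e e0.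
    have /ch : 0 < e%:C%C :> C by rewrite ltcR.
    apply: filterS => w; rewrite cabsE lecR; apply: le_trans.
    by rewrite -cReN -cReD Re_le_cabs.
  have /ch : 0 < e%:C%C :> C by rewrite ltcR.
  apply: filterS => w; rewrite cabsE lecR; apply: le_trans.
  by rewrite -cImN -cImD Im_le_cabs.
elim: k f => [|k IH] f [cf H].
  by split; split => // z Uz; have [] := cReIm _ _ (cf z Uz).
split; split.
- by move=> z Uz; have [] := cReIm _ _ (cf z Uz).
- move=> v; have [h1 /IH[h2 _]] := H v; split; last exact: h2.
  by move=> z /h1[+ _]; exact.
- by move=> z Uz; have [] := cReIm _ _ (cf z Uz).
- move=> v; have [h1 /IH[_ h2]] := H v; split; last exact: h2.
  by move=> z /h1[_ +]; exact.
Qed.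

Definition cclassC k U (f : Cn -> C) :=
  rclassC k U (fun z => complex.Re (f z)) /\ rclassC k U (fun z => complex.Im (f z)).

Lemma cclassC_cst k U (a : C) : open U -> cclassC k U (fun=> a).
Proof. by move=> oU; split; exact: rclassC_cst. Qed.

Lemma cclassC_add k U f g : open U -> cclassC k U f -> cclassC k U g -> cclassC k U (fun z =>
  f z + g z).
Proof.
move=> oU [f1 f2] [g1 g2]; split.
  by apply: (rclassC_ext oU _ (rclassC_add oU f1 g1)) => z _; rewrite cReD.
by apply: (rclassC_ext oU _ (rclassC_add oU f2 g2)) => z _; rewrite cImD.
Qed.

Lemma cclassC_mul k U f g : open U -> cclassC k U f -> cclassC k U g -> cclassC k U (fun z =>
  f z * g z).
Proof.
move=> oU [f1 f2] [g1 g2]; split.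
  apply: (rclassC_ext oU _ (rclassC_add oU (rclassC_mul oU f1 g1)
    (rclassC_mul oU (rclassC_cst k (-1) oU) (rclassC_mul oU f2 g2)))) => z _.
  by rewrite cReM mulN1r.
by apply: (rclassC_ext oU _ (rclassC_add oU (rclassC_mul oU f1 g2) (rclassC_mul oU f2 g1)))
  => z _; rewrite cImM.
Qed.

Lemma cclassC_sum k U (J : Type) (r : seq J) (F : J -> Cn -> C) : open U ->
  (forall j, cclassC k U (F j)) -> cclassC k U (fun z => \sum_(j <- r) F j z).
Proof.
move=> oU FC; elim: r => [|j r IH].
  have -> : (fun z => \sum_(j <- [::]) F j z) = (fun=> 0 : C).
    by apply/funext => z; rewrite big_nil.
  exact: cclassC_cst.
have -> : (fun z => \sum_(i <- j :: r) F i z) = (fun z => F j z + \sum_(i <- r) F i z).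
  by apply/funext => z; rewrite big_cons.
exact: cclassC_add oU (FC j) IH.
Qed.

Lemma cclassC_prod k U (J : Type) (r : seq J) (F : J -> Cn -> C) : open U ->
  (forall j, cclassC k U (F j)) -> cclassC k U (fun z => \prod_(j <- r) F j z).
Proof.
move=> oU FC; elim: r => [|j r IH].
  have -> : (fun z => \prod_(j <- [::]) F j z) = (fun=> 1 : C).
    by apply/funext => z; rewrite big_nil.
  exact: cclassC_cst.
have -> : (fun z => \prod_(i <- j :: r) F i z) = (fun z => F j z * \prod_(i <- r) F i z).
  by apply/funext => z; rewrite big_cons.
exact: cclassC_mul oU (FC j) IH.
Qed.

Lemma cclassC_det k U (G : Cn -> 'M[C]_n) : open U ->
  (forall i j, cclassC k U (fun z => G z i j)) -> cclassC k U (fun z => \det (G z)).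
Proof.
move=> oU GC; rewrite /determinant; apply: cclassC_sum => // s.
by apply: cclassC_mul => //; [exact: cclassC_cst | apply: cclassC_prod => // i; exact: GC].
Qed.

Lemma divc2 (a b : R) : (a +i* b)%C / 2 = ((a / 2) +i* (b / 2))%C :> C.
Proof.
have -> : (2 : C)^-1 = (2^-1 : R)%:C%C by rewrite fmorphV /= rmorph_nat.
by apply/eqP; rewrite eq_complex /= !mulr0 subr0 add0r !eqxx.
Qed.

Lemma muli (a b : R) : 'i * (a +i* b)%C = (- b +i* a)%C :> C.
Proof.
by rewrite ImC_i; apply/eqP; rewrite eq_complex /= !mul0r !mul1r sub0r add0r !eqxx.
Qed.

Lemma addcE (a b c d : R) : (a +i* b)%C + (c +i* d)%C = ((a + c)%R +i* (b + d)%R)%C :> C.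
Proof. by []. Qed.

Lemma subcE (a b c d : R) : (a +i* b)%C - (c +i* d)%C = ((a - c)%R +i* (b - d)%R)%C :> C.
Proof. by []. Qed.

Lemma rderive_real v (f : Cn -> R) z :
  rderive v (fun z => (f z)%:C%C) z = (dderiv v f z +i* 0)%C.
Proof.
rewrite /rderive; congr (_ +i* _)%C.
by rewrite (_ : (fun t : R => _) = cst 0) ?derive1_cst.
Qed.

Lemma dzbar_real k (f : Cn -> R) z : dzbar k (fun z => (f z)%:C%C) z =
  ((dderiv (rbasis (k, false)) f z / 2) +i* (dderiv (rbasis (k, true)) f z / 2))%C.
Proof. by rewrite /dzbar !rderive_real muli addcE divc2 oppr0 addr0 add0r. Qed.

Lemma dz_dzbar_alg (a b c d : R) :
  (((a / 2 - - (d / 2)) / 2) +i* ((b / 2 - c / 2) / 2))%C =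
  (((a + d) / 4) +i* ((b - c) / 4))%C :> C.
Proof. by congr (_ +i* _)%C; field. Qed.

Lemma dz_dzbar U (f : Cn -> R) z (j k : 'I_n) : rclassC 2 U f -> U z ->
  let D i i' := dderiv (rbasis i) (dderiv (rbasis i') f) z in
  dz j (dzbar k (fun z => (f z)%:C%C)) z =
  (((D (j, false) (k, false) + D (j, true) (k, true)) / 4) +i*
   ((D (j, false) (k, true) - D (j, true) (k, false)) / 4))%C.
Proof.
move=> fC Uz D.
have dhalf v i : dderiv v (fun y => dderiv (rbasis i) f y / 2) z = dderiv v (dderiv (rbasis
  i) f) z / 2.
  apply: dderiv_eq.
  have H := is_deriveZ 2^-1 (rclassC_is_derive v (rclassC_dderiv (rbasis i) fC) Uz).
  have E1 : 2^-1 \*: line (dderiv (rbasis i) f) z v = line (fun y => dderiv (rbasis i) f y / 2) z v.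
    by apply/funext => t; exact: mulrC.
  have E2 : 2^-1 *: dderiv v (dderiv (rbasis i) f) z = dderiv v (dderiv (rbasis i) f) z / 2
    by exact: mulrC.
  by move: H; rewrite E1 E2.
have E v : rderive v (dzbar k (fun z => (f z)%:C%C)) z =
    ((dderiv v (dderiv (rbasis (k, false)) f) z / 2) +i* (dderiv v (dderiv (rbasis (k, true))
      f) z / 2))%C.
  rewrite /rderive; congr (_ +i* _)%C.
    rewrite -(dhalf v (k, false)) /dderiv; congr (derive1 _ 0).
    by apply/funext => t; rewrite dzbar_real.
  rewrite -(dhalf v (k, true)) /dderiv; congr (derive1 _ 0).
  by apply/funext => t; rewrite dzbar_real.
rewrite /dz -[delta_mx 0 j]/(rbasis (j, false)) -['i *: rbasis (j, false)]/(rbasis (j, true)).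
rewrite !E muli subcE divc2 /D.
exact: dz_dzbar_alg.
Qed.

(** The matrix of the second derivatives in z_j and zbar_k, from the matrix D of
second derivatives in the real basis. Keeping D abstract makes the algebra below
independent of derivatives. *)
Definition levi_mx_of (D : 'I_n * bool -> 'I_n * bool -> R) : 'M[C]_n :=
  \matrix_(j, k) (((D (j, false) (k, false) + D (j, true) (k, true)) / 4) +i*
   ((D (j, false) (k, true) - D (j, true) (k, false)) / 4))%C.

(** This is where symmetry of second derivatives is needed. *)
Lemma levi_mx_of_hermitian D : (forall a b, D a b = D b a) -> levi_mx_of D \is hermsymmx.
Proof.
move=> S; apply/is_hermitianmxP; rewrite expr0 scale1r.
apply/matrixP => j k; rewrite !mxE conjCE /=.
rewrite (S (j, false) (k, false)) (S (j, true) (k, true)) (S (j, true) (k, false))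
  (S (j, false) (k, true)).
by congr (_ +i* _)%C; ring.
Qed.

Lemma sum_rcoord (F : 'I_n * bool -> R) :
  \sum_i F i = \sum_(j < n) (F (j, true) + F (j, false)).
Proof.
transitivity (\sum_(p : 'I_n * bool) F (p.1, p.2)); first by apply: eq_bigr => -[].
rewrite -(pair_big xpredT xpredT (fun j b => F (j, b))) /=.
by apply: eq_bigr => j _; rewrite big_bool.
Qed.

Lemma ReE_sum (J : Type) (r : seq J) (F : J -> C) :
  complex.Re (\sum_(j <- r) F j) = \sum_(j <- r) complex.Re (F j).
Proof. by elim: r => [|j r IH]; rewrite ?big_nil// !big_cons cReD IH. Qed.

(** With v = sum v_j e_j, the operator D_v - i D_(iv) is 2 sum v_j d/dz_j; the product
of this operator with its conjugate has real part D_v^2 + D_(iv)^2. *)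
Lemma levi_mx_ofE D v :
  ((\sum_i \sum_j rcoord v i * rcoord v j * D i j) +
   (\sum_i \sum_j rcoord ('i *: v) i * rcoord ('i *: v) j * D i j)) / 4 =
  complex.Re ((v *m levi_mx_of D *m v^t*) 0 0).
Proof.
rewrite !mxE ReE_sum !sum_rcoord -big_split /= mulr_suml.
have -> : \sum_j complex.Re ((v *m levi_mx_of D) 0 j * (v^t* ) j 0) =
   \sum_j \sum_k complex.Re (v 0 j * levi_mx_of D j k * (v 0 k)^*).
  rewrite exchange_big; apply: eq_bigr => k _ /=.
  by rewrite !mxE mulr_suml ReE_sum; apply: eq_bigr => j _; rewrite !mxE.
apply: eq_bigr => j _; rewrite !sum_rcoord -!big_split /= mulr_suml.
apply: eq_bigr => k _; rewrite mxE conjCE /rcoord /= !mxE ImC_i.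
move: (D _ _) (D _ _) (D _ _) (D _ _) => p q r s.
case: (v 0 j) => a b; case: (v 0 k) => c d /=.
by field.
Qed.

Definition levi_mx (f : Cn -> R) z : 'M[C]_n :=
  levi_mx_of (fun a b => dderiv (rbasis a) (dderiv (rbasis b) f) z).

Lemma levi_mx_hermitian U (f : Cn -> R) z : open U -> rclassC 2 U f -> U z ->
  levi_mx f z \is hermsymmx.
Proof.
by move=> oU fC Uz; apply: levi_mx_of_hermitian => a b; exact: dderiv_sym oU fC Uz.
Qed.

Lemma leviE (f : Cn -> R) z v :
  levi f z v = complex.Re ((v *m levi_mx f z *m v^t*) 0 0).
Proof. exact: levi_mx_ofE. Qed.

Lemma levi_mx_dz U (f : Cn -> R) z (j k : 'I_n) : rclassC 2 U f -> U z ->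
  dz j (dzbar k (fun z => (f z)%:C%C)) z = levi_mx f z j k.
Proof. by move=> fC Uz; rewrite mxE; exact: dz_dzbar fC Uz. Qed.

End LeviMatrix.

(** * Hermitian forms relative to a metric *)

Section LinearAlgebra.
Local Open Scope sesquilinear_scope.
Variables (R : realType) (n : nat).
Local Notation C := R[i].
Implicit Types (A G L S T : 'M[C]_n) (v : 'rV[C]_n).

Lemma conjtM m p q (A : 'M[C]_(m, p)) (B : 'M[C]_(p, q)) :
  (A *m B)^t* = B^t* *m A^t*.
Proof. by rewrite trmx_mul map_mxM. Qed.

Lemma hermP A : reflect (A^t* = A) (A \is hermsymmx).
Proof.
by apply: (iffP (is_hermitianmxP _ _ _)); rewrite expr0 scale1r => /esym.
Qed.

Lemma diag_conjt (d : 'rV[C]_n) : (diag_mx d)^t* = diag_mx (map_mx Num.conj d).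
Proof. by rewrite tr_diag_mx map_diag_mx. Qed.

(** The diagonal matrix of the spectral theorem inherits the symmetry of A, hence it
is real. *)
Lemma hermitian_spectral A : A \is hermsymmx ->
  exists2 Q, Q *m Q^t* = 1%:M /\ Q^t* *m Q = 1%:M &
  exists d : 'I_n -> R, A = Q^t* *m diag_mx (\row_i (d i)%:C%C) *m Q.
Proof.
move=> Ah.
have [Q [sp [Qu E]]] : exists (Q : 'M[C]_n) (sp : 'rV[C]_n),
    Q \is unitarymx /\ A = invmx Q *m diag_mx sp *m Q.
  exists (spectralmx A), (spectral_diag A); split; first exact: spectral_unitarymx.
  by apply/orthomx_spectralP; exact: hermitian_normalmx.
have Q1 : Q *m Q^t* = 1%:M by exact/unitarymxP.
have Q2 : Q^t* *m Q = 1%:M by rewrite -invmx_unitary// mulVmx// unitarymx_unit.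
rewrite invmx_unitary// in E.
exists Q => //; exists (fun i => complex.Re (sp 0 i)).
suff spE : sp = \row_i (complex.Re (sp 0 i))%:C%C by rewrite -spE.
have D : diag_mx sp = Q *m A *m Q^t*.
  by rewrite {1}E !mulmxA Q1 mul1mx -!mulmxA Q1 mulmx1.
have /matrixP Dh : (diag_mx sp)^t* = diag_mx sp.
  by rewrite D !conjtM trmxCK (hermP _ Ah) mulmxA.
apply/rowP => i; rewrite mxE; have := Dh i i; rewrite !mxE eqxx !mulr1n.
by case: (sp 0 i) => a b [] /esym/eqP; rewrite -addr_eq0 -mulr2n mulrn_eq0 /= => /eqP ->.
Qed.

Lemma quad_diag (d : 'I_n -> R) v :
  (v *m diag_mx (\row_i (d i)%:C%C) *m v^t*) 0 0 =
  (\sum_i d i * cabs (v 0 i) ^+ 2)%:C%C.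
Proof.
rewrite mxE rmorph_sum; apply: eq_bigr => i _ /=.
have X : v 0 i * (v 0 i)^*%C = (cabs (v 0 i) ^+ 2)%:C%C.
  by rewrite -sqr_normc cabsE rmorphXn.
by rewrite mul_mx_diag !mxE conjCE mulrAC X mulrC -rmorphM.
Qed.

(** S has the square roots of the eigenvalues, in an orthonormal basis of
eigenvectors. *)
Lemma posdef_factor G : G \is hermsymmx ->
  (forall v, v != 0 -> 0 < (v *m G *m v^t*) 0 0) ->
  exists2 S, S \in unitmx & G = S *m S^t*.
Proof.
move=> Gh Gp; have [Q [Q1 Q2] [d E]] := hermitian_spectral Gh.
have d0 i : 0 < d i.
  have e0 : delta_mx 0 i *m Q != 0 :> 'rV[C]_n.
    apply/eqP => /(congr1 (fun B => B *m Q^t*)); rewrite mul0mx -mulmxA Q1 mulmx1.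
    by move=> /matrixP/(_ 0 i); rewrite !mxE !eqxx => /eqP; rewrite oner_eq0.
  have := Gp _ e0; rewrite E conjtM.
  rewrite -!mulmxA (mulmxA Q) Q1 mul1mx (mulmxA Q) Q1 mul1mx mulmxA quad_diag ltcR.
  rewrite (bigD1 i)//= mxE !eqxx cabs1 expr1n mulr1 big1 ?addr0// => j ji.
  by rewrite mxE (negPf ji) andbF cabs0 expr0n mulr0.
pose D := diag_mx (\row_i (Num.sqrt (d i))%:C%C) : 'M[C]_n.
have DD : D *m D^t* = diag_mx (\row_i (d i)%:C%C).
  rewrite /D diag_conjt mulmx_diag; congr diag_mx; apply/rowP => i.
  by rewrite !mxE conjCE conjc_real -rmorphM /= -expr2 sqr_sqrtr// ltW.
exists (Q^t* *m D).
  rewrite unitmx_mul; apply/andP; split.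
    by case/mulmx1_unit: Q2.
  rewrite unitmxE det_diag unitfE; apply/prodf_neq0 => i _; rewrite mxE.
  by rewrite (inj_eq (@complexI _) _ 0) gt_eqF// sqrtr_gt0.
by rewrite E conjtM trmxCK -!mulmxA (mulmxA D) DD.
Qed.

(** With G = S S^*, apply the spectral theorem to the Hermitian form that L becomes in
the frame S. *)
Lemma simultaneous_diag G L : G \is hermsymmx -> L \is hermsymmx ->
  (forall v, v != 0 -> 0 < (v *m G *m v^t*) 0 0) ->
  exists2 T, T \in unitmx & exists d : 'I_n -> R,
    G = T *m T^t* /\ L = T *m diag_mx (\row_i (d i)%:C%C) *m T^t*.
Proof.
move=> Gh Lh Gp; have [S Su GE] := posdef_factor Gh Gp.
pose N := invmx S *m L *m (invmx S)^t*.
have Nh : N \is hermsymmx.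
  by apply/hermP; rewrite /N !conjtM trmxCK (hermP _ Lh) mulmxA.
have [Q [Q1 Q2] [d E]] := hermitian_spectral Nh.
have SV : (invmx S)^t* *m S^t* = 1%:M by rewrite -conjtM mulmxV// trmx1 map_mx1.
exists (S *m Q^t*).
  by rewrite unitmx_mul Su; case/mulmx1_unit: Q2.
exists d; rewrite conjtM trmxCK; split.
  by rewrite -mulmxA (mulmxA (Q^t* )) Q2 mul1mx.
transitivity (S *m N *m S^t*); last by rewrite E !mulmxA.
by rewrite /N !mulmxA mulmxV// mul1mx -mulmxA SV mulmx1.
Qed.

Lemma char_poly_conj A T : T \in unitmx ->
  char_poly (invmx T *m A *m T) = char_poly A.
Proof.
move=> Tu; rewrite /char_poly.
have -> : char_poly_mx (invmx T *m A *m T) =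
    map_mx polyC (invmx T) *m char_poly_mx A *m map_mx polyC T.
  rewrite /char_poly_mx mulmxBr mulmxBl !map_mxM; congr (_ - _).
  by rewrite -scalemx1 -scalemxAr -scalemxAl mulmx1 -map_mxM mulVmx// map_mx1.
by rewrite !det_mulmx mulrAC -det_mulmx -map_mxM mulVmx// map_mx1 det1 mul1r.
Qed.

Lemma prod_XsubC_perm (r s : seq C) :
  \prod_(z <- r) ('X - z%:P) = \prod_(z <- s) ('X - z%:P) -> perm_eq r s.
Proof.
elim: r s => [|a r IH] s E.
  case: s E => // b s /(congr1 (fun p => p.[b])).
  by rewrite big_nil hornerC big_cons hornerM !hornerE subrr mul0r => /eqP; rewrite oner_eq0.
have as_ : a \in s.
  have /(congr1 (fun p => root p a)) := E.
  by rewrite !root_prod_XsubC inE eqxx => /esym.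
have Es := perm_to_rem as_.
rewrite perm_sym (perm_trans Es)// perm_cons perm_sym; apply: IH.
move: E; rewrite (perm_big _ Es) !big_cons; apply: mulfI.
by rewrite polyXsubC_eq0.
Qed.

Lemma eigenvalues_diag (d : 'rV[C]_n) T : T \in unitmx ->
  perm_eq (eigenvalues (invmx T *m diag_mx d *m T)) [seq d 0 i | i : 'I_n].
Proof.
move=> Tu; apply: prod_XsubC_perm.
rewrite /eigenvalues; case: closed_field_poly_normal => r /= Er.
have := char_poly_monic (invmx T *m diag_mx d *m T); move: Er.
move=> + /monicP lc; rewrite lc scale1r => <-.
rewrite char_poly_conj// char_poly_trig ?diag_mx_is_trig//.
rewrite big_map big_enum /=; apply: eq_bigr => i _.
by rewrite mxE eqxx.
Qed.

(** T is a frame that is orthonormal for G and diagonalizes L, and J the set of its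
vectors with positive eigenvalue; the other ones only decrease L. As G^(-1) (- L)
is similar to the diagonal matrix of the opposite eigenvalues, J is counted by
the negative eigenvalues of G^(-1) (- L). *)
Lemma positive_part G L (Lam : R) : G \is hermsymmx -> L \is hermsymmx ->
  (forall v, v != 0 -> 0 < (v *m G *m v^t*) 0 0) ->
  (forall v, complex.Re ((v *m L *m v^t*) 0 0) <=
     Lam * complex.Re ((v *m G *m v^t*) 0 0)) ->
  exists T, exists2 J : {set 'I_n},
    #|J| = num_neg_eigenvalues (invmx G *m - L) & forall v,
    (forall i, cabs ((v *m T) 0 i) ^+ 2 <= complex.Re ((v *m G *m v^t*) 0 0)) /\
    complex.Re ((v *m L *m v^t*) 0 0) <=
      Lam * \sum_(i in J) cabs ((v *m T) 0 i) ^+ 2.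
Proof.
move=> Gh Lh Gp GL; have [T Tu [d [GE LE]]] := simultaneous_diag Gh Lh Gp.
pose J : {set 'I_n} := finset (fun i => 0 < d i).
have LT v : complex.Re ((v *m L *m v^t*) 0 0) = \sum_i d i * cabs ((v *m T) 0 i) ^+ 2.
  by rewrite LE -!mulmxA -conjtM !mulmxA quad_diag.
have GT v : complex.Re ((v *m G *m v^t*) 0 0) = \sum_i cabs ((v *m T) 0 i) ^+ 2.
  rewrite GE -!mulmxA -conjtM mulmxA; have := quad_diag (fun=> 1) (v *m T).
  rewrite (_ : diag_mx _ = 1%:M) ?mulmx1 => [-> /=|].
    by apply: eq_bigr => i _; rewrite mul1r.
  by rewrite -diag_const_mx; congr diag_mx; apply/rowP => i; rewrite !mxE.
exists T, J.
  rewrite /num_neg_eigenvalues.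
  have TTu : T^t* \in unitmx by rewrite map_unitmx unitmx_tr.
  have -> : invmx G *m - L = invmx (T^t* ) *m diag_mx (\row_i (- d i)%:C%C) *m T^t*.
    have Gu : G \in unitmx by rewrite GE unitmx_mul Tu.
    set X := (RHS); suff -> : - L = G *m X by rewrite mulKmx.
    rewrite GE LE /X -!mulmxA (mulmxA (T^t* )) mulmxV// mul1mx.
    rewrite -mulmxN -mulNmx; congr (_ *m (_ *m _)).
    by rewrite -linearN /=; congr diag_mx; apply/rowP => i; rewrite !mxE rmorphN.
  rewrite (permP (eigenvalues_diag _ TTu)) count_map -sum1_card -sum1_count.
  rewrite big_enum_cond /=; apply: eq_bigl => i.
  by rewrite !inE mxE /= ltcR oppr_lt0.
move=> v; split=> [i|].
  by rewrite GT (bigD1 i)//= lerDl sumr_ge0// => j _; rewrite exprn_ge0// cabs_ge0.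
have dLam i : d i <= Lam.
  have := GL (delta_mx 0 i *m invmx T); rewrite LT GT mulmxKV//.
  have X (a : 'I_n -> R) : \sum_j a j * cabs ((delta_mx 0 i : 'rV[C]_n) 0 j) ^+ 2 = a i.
    rewrite (bigD1 i)//= mxE !eqxx cabs1 expr1n mulr1 big1 ?addr0// => j ji.
    by rewrite mxE (negPf ji) andbF cabs0 expr0n mulr0.
  rewrite X; have := X (fun=> 1); under eq_bigr do rewrite mul1r.
  by move=> ->; rewrite mulr1.
rewrite LT mulr_sumr [leRHS]big_mkcond; apply: ler_sum => i _.
have c0 : 0 <= cabs ((v *m T) 0 i) ^+ 2 by rewrite exprn_ge0// cabs_ge0.
rewrite inE; case: ltP => di; first by rewrite ler_wpM2r.
by rewrite mulr_le0_ge0.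
Qed.

Lemma posdef_det G : G \is hermsymmx ->
  (forall v, v != 0 -> 0 < (v *m G *m v^t*) 0 0) -> 0 < \det G.
Proof.
move=> Gh Gp; have [S Su ->] := posdef_factor Gh Gp.
rewrite det_mulmx det_map_mx det_tr.
rewrite (_ : _ * _ = `|\det S| ^+ 2); last by rewrite sqr_normc.
rewrite exprn_gt0// normr_gt0.
by rewrite -unitfE -unitmxE.
Qed.

End LinearAlgebra.

(** * Finite nets *)

Section Grid.
Variable R : realType.

(** Choose one element of D in each nonempty fibre of key. *)
Lemma finite_net (X : Type) (F : finType) (key : X -> F) (D : X -> Prop) :
  exists2 s : seq X, (size s <= #|F|)%N &
    forall z, D z -> exists2 p, List.In p s & D p /\ key p = key z.
Proof.
have /choice[rep repP] : forall a : F, exists o : option X,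
    (forall p, o = Some p -> D p /\ key p = a) /\
    ((exists2 z, D z & key z = a) -> exists p, o = Some p).
  move=> a; have [[z Dz za]|no] := pselect (exists2 z, D z & key z = a).
    by exists (Some z); split => [p [<-]|_]//; exists z.
  by exists None; split.
exists (pmap rep (enum F)).
  by rewrite size_pmap (leq_trans (count_size _ _))// -cardE.
move=> z Dz; have [H1 H2] := repP (key z).
have [p E] := H2 (ex_intro2 _ _ z Dz erefl).
exists p; last exact: H1.
have : key z \in enum F by rewrite mem_enum.
elim: (enum F) => // a s IH; rewrite inE => /orP[/eqP <-|/IH H] /=.
  by rewrite /oapp E; left.
by case: (rep a) => [b|] //=; right.
Qed.

(** Elements with the same integer parts of (a_k + B) / s, for all k, are s-close. *)
Lemma grid_net (X : Type) (K : finType) (a : K -> X -> R) (D : X -> Prop)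
    (B s : R) (N : nat) : 0 < s -> 2 * B <= N%:R * s ->
  (forall z k, D z -> `|a k z| <= B) ->
  exists2 pts : seq X, (size pts <= N.+1 ^ #|K|)%N &
    forall z, D z -> exists2 p, List.In p pts & D p /\ forall k, `|a k z - a k p| <= s.
Proof.
move=> s0 BN aB.
pose key z : {ffun K -> 'I_N.+1} := [ffun k => inord (Num.truncn ((a k z + B) / s))].
have [pts sz H] := finite_net key D.
exists pts; first by rewrite card_ffun card_ord in sz.
move=> z Dz; have [p pin [Dp kE]] := H z Dz; exists p => //; split => // k.
have bd y : D y -> [/\ 0 <= (a k y + B) / s, (a k y + B) / s <= N%:R &
     (Num.truncn ((a k y + B) / s) <= N)%N].
  move=> Dy; have := aB y k Dy; rewrite ler_norml => /andP[l u].
  have n0 : 0 <= (a k y + B) / s by apply: divr_ge0; [lra | exact: ltW].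
  have nN : (a k y + B) / s <= N%:R by rewrite ler_pdivrMr//; lra.
  split => //; rewrite -(ler_nat R).
  by apply: le_trans nN; have /andP[] := truncn_itv n0.
have [z0 zN zt] := bd z Dz; have [p0 pN pt] := bd p Dp.
have /(congr1 val) := congr1 (fun f : {ffun K -> 'I_N.+1} => f k) kE.
rewrite /= !ffunE !inordK ?ltnS// => E.
have /andP[z1 z2] := truncn_itv z0; have /andP[p1 p2] := truncn_itv p0.
rewrite E in p1 p2.
have : `|(a k z + B) / s - (a k p + B) / s| <= 1.
  by move: p2 z2; rewrite -!natr1 ler_norml; lra.
rewrite -mulrBl normrM normfV (gtr0_norm s0) ler_pdivrMr// mul1r.
by rewrite (_ : a k z + B - (a k p + B) = a k z - a k p)//; ring.
Qed.

Lemma size_flatten_le (X Y : Type) (s : seq X) (f : X -> seq Y) (B : nat) :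
  (forall x, size (f x) <= B)%N -> (size (flatten [seq f x | x <- s]) <= size s * B)%N.
Proof.
by move=> H; elim: s => //= x s IH; rewrite size_cat mulSn leq_add.
Qed.

Lemma In_flatten (X Y : Type) (s : seq X) (f : X -> seq Y) x y :
  List.In x s -> List.In y (f x) -> List.In y (flatten [seq f x | x <- s]).
Proof.
elim: s => //= a s IH [->|xs] yf; apply: (List.in_or_app _ _ _).
  by left.
by right; exact: IH.
Qed.

End Grid.

(** * Bounds for quadratic forms *)

Section QuadraticBounds.
Local Open Scope sesquilinear_scope.
Variables (R : realType) (n : nat).
Local Notation C := R[i].
Implicit Types (G B : 'M[C]_n) (v : 'rV[C]_n).

Lemma cabs_sum (J : Type) (s : seq J) (F : J -> C) :
  cabs (\sum_(j <- s) F j) <= \sum_(j <- s) cabs (F j).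
Proof.
elim: s => [|j s IH]; first by rewrite !big_nil cabs0.
by rewrite !big_cons (le_trans (cabsD _ _))// lerD2l.
Qed.

Lemma cabs_conj (z : C) : cabs z^* = cabs z.
Proof. by rewrite /cabs conjCE normcJ. Qed.

Lemma sum_le (F : 'I_n -> R) (b : R) : (forall j, F j <= b) -> \sum_j F j <= n%:R * b.
Proof.
by move=> H; rewrite (le_trans (ler_sum _ (fun j _ => H j)))// sumr_const card_ord mulr_natl.
Qed.

Lemma mulmx_bound v B (eta : R) : 0 <= eta -> (forall i j, cabs (B i j) <= eta) ->
  forall j, cabs ((v *m B) 0 j) <= n%:R * (vnorm v * eta).
Proof.
move=> e0 H j; rewrite mxE (le_trans (cabs_sum _ _))//; apply: sum_le => k.
by rewrite cabsM ler_pM ?cabs_ge0// le_vnorm.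
Qed.

Lemma quad_bound v B (eta : R) : 0 <= eta -> (forall i j, cabs (B i j) <= eta) ->
  cabs ((v *m B *m v^t*) 0 0) <= n%:R ^+ 2 * eta * vnorm v ^+ 2.
Proof.
move=> e0 H; rewrite mxE (le_trans (cabs_sum _ _))//.
have -> : n%:R ^+ 2 * eta * vnorm v ^+ 2 = n%:R * (n%:R * (vnorm v * eta) * vnorm v) by ring.
apply: sum_le => k.
have -> : (v^t* ) k 0 = (v 0 k)^* by rewrite !mxE.
rewrite cabsM cabs_conj.
rewrite ler_pM ?cabs_ge0//; [exact: mulmx_bound | exact: le_vnorm].
Qed.

(** With G = S S^*, the value at v is the squared Euclidean norm of v S, and v is the
image of v S under the inverse of S. *)
Lemma posdef_lower G : G \is hermsymmx ->
  (forall v, v != 0 -> 0 < (v *m G *m v^t*) 0 0) ->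
  exists2 c : R, 0 < c & forall v, c * vnorm v ^+ 2 <= complex.Re ((v *m G *m v^t*) 0 0).
Proof.
move=> Gh Gp; have [S Su GE] := posdef_factor Gh Gp.
pose k := \sum_i \sum_j cabs (invmx S i j).
have k0 : 0 <= k by apply: sumr_ge0 => i _; apply: sumr_ge0 => j _; exact: cabs_ge0.
have Sk i j : cabs (invmx S i j) <= k.
  rewrite /k (bigD1 i)//= (bigD1 j)//= -addrA lerDl addr_ge0//; apply: sumr_ge0 => a _.
    exact: cabs_ge0.
  by apply: sumr_ge0 => b _; exact: cabs_ge0.
pose K := n%:R * k + 1.
have K0 : 0 < K by rewrite ltr_wpDl// mulr_ge0.
exists (K ^- 2); first by rewrite invr_gt0 exprn_gt0.
move=> v; set w := v *m S.
have vw : vnorm v <= K * vnorm w.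
  apply: vnorm_le => [|j]; first by rewrite mulr_ge0 ?vnorm_ge0// ltW.
  have -> : v = w *m invmx S by rewrite /w mulmxK.
  rewrite (le_trans (mulmx_bound w k0 Sk j))// /K mulrDl mul1r.
  by have := vnorm_ge0 w; rewrite mulrA [n%:R * _]mulrC; lra.
have GT : complex.Re ((v *m G *m v^t*) 0 0) = \sum_i cabs (w 0 i) ^+ 2.
  rewrite GE -!mulmxA -conjtM mulmxA -/w; have := quad_diag (fun=> 1) w.
  rewrite (_ : diag_mx _ = 1%:M) ?mulmx1 => [-> /=|].
    by apply: eq_bigr => i _; rewrite mul1r.
  by rewrite -diag_const_mx; congr diag_mx; apply/rowP => i; rewrite !mxE.
rewrite GT mulrC ler_pdivrMr ?exprn_gt0//.
have s0 : 0 <= \sum_i cabs (w 0 i) ^+ 2.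
  by apply: sumr_ge0 => i _; rewrite exprn_ge0// cabs_ge0.
have ws : vnorm w <= Num.sqrt (\sum_i cabs (w 0 i) ^+ 2).
  apply: vnorm_le => [|j]; first exact: sqrtr_ge0.
  rewrite -(ger0_norm (cabs_ge0 (w 0 j))) -sqrtr_sqr ler_sqrt//.
  by rewrite (bigD1 j)//= lerDl sumr_ge0// => i _; rewrite exprn_ge0// cabs_ge0.
have : vnorm v ^+ 2 <= (K * Num.sqrt (\sum_i cabs (w 0 i) ^+ 2)) ^+ 2.
  rewrite ler_pXn2r ?nnegrE ?vnorm_ge0// ?mulr_ge0 ?sqrtr_ge0 ?(ltW K0)//.
  by rewrite (le_trans vw)// ler_wpM2l// ltW.
by rewrite exprMn sqr_sqrtr// mulrC.
Qed.

(** Positivity at z0 survives nearby with half the constant. *)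
Lemma metric_compare (G : 'rV[C]_n -> 'M[C]_n) z0 :
  G z0 \is hermsymmx -> (forall v, v != 0 -> 0 < (v *m G z0 *m v^t*) 0 0) ->
  (forall i j, {for z0, continuous (fun z => G z i j)}) ->
  exists2 d : R, 0 < d & exists2 c : R, 0 < c & exists Gam : R,
    forall z v, vnorm (z - z0) < d ->
    c * vnorm v ^+ 2 <= complex.Re ((v *m G z *m v^t*) 0 0) <= Gam * vnorm v ^+ 2.
Proof.
move=> Gh Gp Gc; have [c c0 Hc] := posdef_lower Gh Gp.
pose eta : R := c / 2 / (n%:R ^+ 2 + 1).
have n0 : 0 < n%:R ^+ 2 + 1 :> R by rewrite ltr_wpDl// exprn_ge0.
have eta0 : 0 < eta by rewrite !divr_gt0.
have [d d0 Hd] : exists2 d : R, 0 < d & forall w, vnorm w < d -> forall i j,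
    cabs (G (z0 + w) i j - G z0 i j) <= eta.
  apply/(nbhs_vnorm z0 (fun y => forall i j, cabs (G y i j - G z0 i j) <= eta)).
  have H (ij : 'I_n * 'I_n) : nbhs z0 (fun y => cabs (G y ij.1 ij.2 - G z0 ij.1 ij.2) <= eta).
    have /cvgrPdist_le/(_ eta%:C%C) := Gc ij.1 ij.2; rewrite ltcR => /(_ eta0).
    by apply: filterS => y; rewrite cabsE lecR cabsBC.
  have := @filter_forall _ _ (fun ij y => cabs (G y ij.1 ij.2 - G z0 ij.1 ij.2) <= eta)
    _ (nbhs_filter z0) H.
  by apply: filterS => y Hy i j; exact: Hy (i, j).
pose b := \sum_i \sum_j cabs (G z0 i j).
have b0 : 0 <= b by apply: sumr_ge0 => i _; apply: sumr_ge0 => j _; exact: cabs_ge0.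
have Gb i j : cabs (G z0 i j) <= b.
  rewrite /b (bigD1 i)//= (bigD1 j)//= -addrA lerDl addr_ge0//; apply: sumr_ge0 => a _.
    exact: cabs_ge0.
  by apply: sumr_ge0 => k _; exact: cabs_ge0.
exists d => //; exists (c / 2); first by rewrite divr_gt0.
exists (n%:R ^+ 2 * b + c / 2) => z v zd.
have Dz i j : cabs ((G z - G z0) i j) <= eta.
  by rewrite !mxE; have := Hd (z - z0) zd i j; rewrite [z0 + _]addrC subrK.
have E : (v *m G z *m v^t*) 0 0 = (v *m G z0 *m v^t*) 0 0 + (v *m (G z - G z0) *m v^t*) 0 0.
  rewrite mulmxBr mulmxBl; move: (v *m G z *m _) (v *m G z0 *m _) => p q.
  by rewrite [(p - q) 0 0]mxE [(- q) 0 0]mxE; ring.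
have := quad_bound v (ltW eta0) Dz; have := quad_bound v b0 Gb; have := Hc v.
have /(le_trans (ler_norm _)) := Re_le_cabs ((v *m G z0 *m v^t*) 0 0).
have := Re_le_cabs ((v *m (G z - G z0) *m v^t*) 0 0).
have eta_le : n%:R ^+ 2 * eta <= c / 2.
  have <- : eta * (n%:R ^+ 2 + 1) = c / 2 by rewrite /eta divfK ?gt_eqF.
  by rewrite mulrDr mulr1 mulrC lerDl ltW.
have v0 : 0 <= vnorm v ^+ 2 by rewrite exprn_ge0// vnorm_ge0.
have := ler_wpM2r v0 eta_le.
rewrite E cReD ler_norml.
move: (complex.Re _) (complex.Re _) (cabs _) (cabs _) => p q r s.
move: (n%:R ^+ 2 * eta * _) => x; move: (n%:R ^+ 2 * b) (vnorm v ^+ 2) => y V; clear.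
by rewrite !mulrDl; lra.
Qed.

End QuadraticBounds.

(** * Nets in a chart *)

Section LocalNet.
Local Open Scope sesquilinear_scope.
Variables (R : realType) (n : nat).
Local Notation C := R[i].
Local Notation Cn := 'rV[C]_n.
Implicit Types (U : set Cn) (z c p v w : Cn).

Lemma vnorm_rcoord v (s : R) : 0 <= s -> (forall k, `|rcoord v k| <= s / 2) -> vnorm v <= s.
Proof.
move=> s0 H; apply: vnorm_le => // j; rewrite (le_trans (cabs_le_ReIm _))//.
by have := H (j, false); have := H (j, true); rewrite /rcoord /=; lra.
Qed.

Lemma rcoordB v w k : rcoord (v - w) k = rcoord v k - rcoord w k.
Proof.
have -> : - w = (-1)%:C%C *: w by rewrite rmorphN1 scaleN1r.
by rewrite rcoordD rcoordZ mulN1r.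
Qed.

Lemma line_differentiable (h : Cn -> C) p v (t : C) :
  differentiable h (p + t *: v) -> differentiable (fun t : C => h (p + t *: v)) t.
Proof.
move=> dh; apply: (@differentiable_comp _ _ _ _ (fun t : C => p + t *: v) h); last exact: dh.
by apply: differentiableD; [exact: differentiable_cst | exact: differentiableZl].
Qed.

(** [weighted_schwarz] for h on the line through p and z, with p at t = 0 and z at
t = 1. The weight is expanded at a third point c, the centre of a cell, where
the positive directions have been chosen. *)
Lemma line_vanish U (phi : Cn -> R) (h : Cn -> C) (m : nat) (A E L M rho : R) c p z :
  open U -> rclassC 2 U phi -> U c -> holomorphic U h -> 1 <= rho -> h p = 0 ->
  (forall z, U z -> cabs (h z) ^+ 2 <= A * expR (m%:R * phi z)) ->
  A * expR (m%:R * phi z) <= cabs (h z) ^+ 2 ->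
  (forall t : C, cabs t < 2 * rho -> U (p + t *: (z - p))) ->
  (forall t : C, cabs t <= rho -> let w := p - c + t *: (z - p) in
    `|phi (c + w) - phi c - diff1 phi c w - hess phi c w w / 2| <= M) ->
  m%:R * M <= E -> m%:R * levi phi c (z - p) * (rho ^+ 2 - 1) <= L ->
  expR (2 * E + L) < rho ^+ 2 -> A <= 0.
Proof.
move=> oU phiC Uc hh rho1 hp0 hA Ah HU HM ME lamL Lr.
set v := z - p in HU HM lamL *; set u := p - c in HM.
have [al [be [ga Hq]]] := line_expansion u v oU phiC Uc.
have pv1 : p + 1 *: v = z by rewrite scale1r /v addrC subrK.
have cw (t : C) : c + (u + t *: v) = p + t *: v.
  by rewrite addrA; congr (_ + _); rewrite /u addrC subrK.
have r12 : 1 <= rho < 2 * rho by lra.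
have rho0 : 0 <= rho by lra.
have cU (t : C) : cabs t <= rho -> U (p + t *: v).
  by move=> tr; apply: HU; lra.
apply: (@weighted_schwarz R (fun t => h (p + t *: v)) (fun t => m%:R * phi (p + t *: v))
  rho (2 * rho) A E (m%:R * levi phi c v) L (m%:R * al) (m%:R * be) (m%:R * ga)) => //.
- by move=> t /HU Ut; apply: line_differentiable; exact: hh.
- by rewrite scale0r addr0.
- move=> t tr; have := HM t tr; rewrite /= cw.
  have X : complex.Re (m%:R * al + m%:R * be * t + m%:R * ga * t ^+ 2) =
      m%:R * complex.Re (al + be * t + ga * t ^+ 2).
    have -> : m%:R * al + m%:R * be * t + m%:R * ga * t ^+ 2 =
        (m%:R : R)%:C%C * (al + be * t + ga * t ^+ 2) by rewrite rmorph_nat; ring.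
    by rewrite cReM /= mul0r subr0.
  rewrite X -mulrA -mulrDr -mulrBr normrM (ger0_norm (ler0n _ m)) => H.
  apply: le_trans ME; rewrite ler_wpM2l ?ler0n// -Hq.
  have alg (a b d e : R) : a - (b + d + e) = a - b - d - e by ring.
  by rewrite alg.
- by move=> t tr; apply: hA; exact: cU.
- by rewrite pv1.
Qed.

Lemma expn_mono (a b e : nat) : (a <= b)%N -> (a ^ e <= b ^ e)%N.
Proof. by case: e => // e; rewrite leq_exp2r. Qed.

(** The points c of a first grid, with mesh proportional to 1 / q^2 in all directions,
are the centres of expansion; around each of them a second grid, of points p, has
mesh proportional to 1 / q^3 in the directions where the Levi form at c is
positive. *)
Lemma local_net U (phi : Cn -> R) (G : Cn -> 'M[C]_n) (r : nat) z0 :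
  open U -> U z0 -> rclassC 3 U phi ->
  (forall i j, {for z0, continuous (fun z => G z i j)}) ->
  (forall z, U z -> G z \is hermsymmx) ->
  (forall z, U z -> forall v, v != 0 -> 0 < (v *m G z *m v^t*) 0 0) ->
  (forall z, U z -> (num_neg_eigenvalues (invmx (G z) *m - levi_mx phi z) <= r)%N) ->
  exists2 delta : R, 0 < delta & exists K : nat, forall q m : nat, (0 < q)%N ->
    (m <= q ^ 6)%N -> exists2 pts : seq Cn,
      (size pts <= K * q ^ (4 * n + 2 * r))%N &
      forall (h : Cn -> C) (A : R), holomorphic U h ->
      (forall z, U z -> cabs (h z) ^+ 2 <= A * expR (m%:R * phi z)) ->
      (forall p, List.In p pts -> h p = 0) ->
      forall z, vnorm (z - z0) < delta ->
        A * expR (m%:R * phi z) <= cabs (h z) ^+ 2 -> A <= 0.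
Proof.
move=> oU Uz0 phiC Gc Gh Gp Gr.
have phiC2 := rclassC_S phiC.
have [d1 d10 [M1 M10 HT]] := taylor_local oU phiC Uz0.
have [d2 d20 [c0 c00 [Gam HG]]] := metric_compare (Gh _ Uz0) (Gp _ Uz0) Gc.
(* Vectors up to 8 kap are within reach of the local estimates: the points
   c + (p - c) + t (z - p) with |t| < 2 rho are at distance at most 6 kap from c. *)
pose kap := Num.min d1 d2 / 8.
have m0 : 0 < Num.min d1 d2 by rewrite lt_min d10.
have md1 : Num.min d1 d2 <= d1 by rewrite ge_min lexx.
have md2 : Num.min d1 d2 <= d2 by rewrite ge_min lexx orbT.
have kap0 : 0 < kap by rewrite divr_gt0.
have kd1 : 8 * kap <= d1 by rewrite /kap; lra.
have kd2 : 8 * kap <= d2 by rewrite /kap; lra.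
(* Lam bounds the Levi form relative to the metric. *)
pose Lam := #|{: 'I_n * bool}|%:R ^+ 2 * M1 / c0.
have Lam0 : 0 <= Lam by rewrite divr_ge0 ?(ltW c00)// mulr_ge0// exprn_ge0.
(* E bounds m times the cubic remainder for |t| <= rho, and L bounds m (rho^2 - 1)
   times the Levi form. They are fixed before rho: enlarging rho refines the
   grids, so that rho times their meshes remain kap / q^2 and kap / q^3. *)
pose E := 27 * M1 * kap ^+ 3.
pose L := Lam * n%:R * kap ^+ 2.
have L0 : 0 <= L.
  apply: mulr_ge0; last exact/exprn_ge0/ltW.
  by apply: mulr_ge0; [exact: Lam0 | exact: ler0n].
have [rho rhoN rhoE] : exists2 rho : nat, (0 < rho)%N & expR (2 * E + L) < rho%:R ^+ 2.
  exists (Num.bound (expR (2 * E + L))).+1 => //.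
  have /archi_boundP h : 0 <= expR (2 * E + L) by exact: expR_ge0.
  apply: (lt_le_trans h); rewrite -natrX ler_nat (leq_trans (leqnSn _))//.
  by rewrite -{1}(expn1 (Num.bound _).+1) leq_pexp2l.
have rho1 : 1 <= rho%:R :> R by rewrite ler1n.
have rho0 : 0 < rho%:R :> R by lra.
have [gam gamN gamG] : exists2 gam : nat, (0 < gam)%N & Gam <= gam%:R ^+ 2.
  exists (Num.bound Gam).+1 => //.
  have h : Gam <= (Num.bound Gam)%:R.
    have [G0|/ltW G0] := leP 0 Gam; first by rewrite ltW// archi_boundP.
    by rewrite (le_trans G0).
  rewrite (le_trans h)// -natrX ler_nat (leq_trans (leqnSn _))//.
  by rewrite -{1}(expn1 (Num.bound Gam).+1) leq_pexp2l.
have gam1 : 1 <= gam%:R :> R by rewrite ler1n.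
exists kap => //; exists ((5 * rho) ^ (2 * n) * (5 * gam) ^ (2 * r))%N => q m q0 mq.
have q1 : 1 <= q%:R :> R by rewrite ler1n.
have qr0 : 0 < q%:R :> R by lra.
pose eta1 : R := kap / rho%:R / q%:R ^+ 2.
pose eta2 : R := kap / rho%:R / q%:R ^+ 3.
have eta10 : 0 < eta1 by rewrite !divr_gt0// exprn_gt0.
have eta20 : 0 < eta2 by rewrite !divr_gt0// exprn_gt0.
have e12 : eta1 = q%:R * eta2 by rewrite /eta1 /eta2; field; rewrite !gt_eqF.
have rhoeta : rho%:R * eta1 <= kap.
  have -> : rho%:R * eta1 = kap / q%:R ^+ 2 by rewrite /eta1; field; rewrite !gt_eqF.
  by rewrite ler_pdivrMr ?exprn_gt0// ler_peMr ?(ltW kap0)// exprn_ege1.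
have eta1k : eta1 <= kap by apply: le_trans rhoeta; rewrite ler_peMl// ltW.
have I2 : #|{: 'I_n * bool}| = (2 * n)%N by rewrite card_prod card_ord card_bool mulnC.
have NB1 : 2 * kap <= (4 * rho * q ^ 2)%:R * (eta1 / 2).
  rewrite natrM natrX natrM /eta1 le_eqVlt; apply/orP; left; apply/eqP.
  by field; rewrite !gt_eqF.
have NB2 : 2 * (gam%:R * eta1) <= (4 * gam * q)%:R * (eta2 / 2).
  rewrite natrM natrM e12 le_eqVlt; apply/orP; left; apply/eqP.
  by field.
(* The first grid, on the real coordinates of z - z0. *)
have [pts1 sz1 H1] := @grid_net R Cn _ (fun k z => rcoord (z - z0) k)
  (fun z => vnorm (z - z0) < kap) kap (eta1 / 2) (4 * rho * q ^ 2)
  ltac:(by rewrite divr_gt0)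
  NB1
  ltac:(by move=> z k zk; rewrite (le_trans (rcoord_le _ _))// ltW).
(* The second grid, on the coordinates of (z - c) T with index in J: these are of
   size gam eta1 since T is orthonormal for G c, and gam^2 bounds the metric. *)
pose D c z := [/\ vnorm (z - z0) < kap, vnorm (c - z0) < kap & vnorm (z - c) <= eta1].
have step2 c : exists2 pts2 : seq Cn, (size pts2 <= (5 * gam * q) ^ (2 * r))%N &
    forall z, D c z -> exists2 p, List.In p pts2 &
      D c p /\ m%:R * levi phi c (z - p) * (rho%:R ^+ 2 - 1) <= L.
  have [cz0|cz0] := ltP (vnorm (c - z0)) kap; last first.
    by exists [::] => // z [_ + _]; rewrite ltNge cz0.
  have cd1 : vnorm (c - z0) <= d1 by lra.
  have cd2 : vnorm (c - z0) < d2 by lra.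
  have [Uc HB _] := HT c 0 cd1 ltac:(by rewrite vnorm0 ltW).
  rewrite addr0 in Uc.
  have lv v : levi phi c v <= Lam * complex.Re ((v *m G c *m v^t*) 0 0).
    have /andP[l _] := HG c v cd2.
    apply: (le_trans (ler_norm _)); apply: (le_trans (levi_bound v M10 HB)).
    have a0 : 0 <= #|{: 'I_n * bool}|%:R ^+ 2 * M1 by rewrite mulr_ge0// exprn_ge0.
    rewrite /Lam; move: (_ * M1) a0 => a a0; rewrite [leRHS]mulrAC ler_pdivlMr//.
    by rewrite -mulrA ler_wpM2l// mulrC.
  have [T [J JE HJ]] := positive_part (Gh c Uc) (levi_mx_hermitian oU phiC2 Uc) (Gp c Uc)
    (fun v => ltac:(by rewrite -leviE; exact: lv)).
  have Jr : (#|J| <= r)%N by rewrite JE; exact: Gr.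
  pose a (k : 'I_#|J| * bool) z : R :=
    let x := ((z - c) *m T) 0 (enum_val k.1) in if k.2 then complex.Im x else complex.Re x.
  have aB z k : D c z -> `|a k z| <= gam%:R * eta1.
    move=> [_ _ zc].
    have h1 : `|a k z| <= cabs (((z - c) *m T) 0 (enum_val k.1)).
      by rewrite /a; case: ifP => _; [exact: Im_le_cabs | exact: Re_le_cabs].
    apply: (le_trans h1).
    have ge0 : 0 <= gam%:R * eta1 by rewrite mulr_ge0// ltW.
    rewrite -(ler_pXn2r (n:=2)) ?nnegrE ?cabs_ge0//.
    have [+ _] := HJ (z - c); move=> /(_ (enum_val k.1))/le_trans; apply.
    have /andP[_ l] := HG c (z - c) cd2; apply: (le_trans l).
    rewrite exprMn; apply: (@le_trans _ _ (gam%:R ^+ 2 * vnorm (z - c) ^+ 2)).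
      by rewrite ler_wpM2r// exprn_ge0// vnorm_ge0.
    rewrite ler_wpM2l ?exprn_ge0//.
    by rewrite ler_pXn2r ?nnegrE ?vnorm_ge0// ltW.
  have [pts2 sz2 H2] := @grid_net R Cn _ a (D c) (gam%:R * eta1) (eta2 / 2) (4 * gam * q)
    ltac:(by rewrite divr_gt0)
    NB2 aB.
  exists pts2.
    apply: (leq_trans sz2); rewrite card_prod card_ord card_bool.
    apply: (@leq_trans ((5 * gam * q) ^ (#|J| * 2))%N).
      apply: expn_mono; have : (0 < gam * q)%N by rewrite muln_gt0 gamN.
      by rewrite -!mulnA; move: (gam * q)%N => x; clear; lia.
    by rewrite leq_pexp2l ?muln_gt0 ?gamN ?q0// mulnC leq_mul2l Jr orbT.
  move=> z Dz; have [p pin [Dp close]] := H2 z Dz; exists p => //; split => //.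
  have rest : 0 <= rho%:R ^+ 2 - 1 :> R by rewrite subr_ge0 exprn_ege1.
  have Tk i : i \in J -> cabs (((z - p) *m T) 0 i) ^+ 2 <= eta2 ^+ 2.
    move=> iJ; rewrite ler_pXn2r ?nnegrE ?cabs_ge0 ?(ltW eta20)//.
    have -> : (z - p) *m T = (z - c) *m T - (p - c) *m T.
      by rewrite -mulmxBl; congr (_ *m T); rewrite opprB addrA subrK.
    rewrite (le_trans (cabs_le_ReIm _))//.
    have := close (enum_rank_in iJ i, true); have := close (enum_rank_in iJ i, false).
    rewrite /a /= enum_rankK_in//.
    move: ((z - c) *m T) ((p - c) *m T) => P Q.
    by rewrite [(P - Q) 0 i]mxE [(- Q) 0 i]mxE cReD cReN cImD cImN; lra.
  have l1 : levi phi c (z - p) <= Lam * (n%:R * eta2 ^+ 2).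
    have [_ +] := HJ (z - p); rewrite -leviE => /le_trans; apply.
    rewrite ler_wpM2l//.
    apply: (@le_trans _ _ (\sum_(i in J) eta2 ^+ 2)); first exact: ler_sum.
    rewrite sumr_const -[leLHS]mulr_natl; apply: ler_wpM2r.
      exact/exprn_ge0/ltW.
    by rewrite ler_nat -[leqRHS](card_ord n) max_card.
  apply: (@le_trans _ _ (q%:R ^+ 6 * (Lam * (n%:R * eta2 ^+ 2)) * rho%:R ^+ 2)).
    have n0 : 0 <= Lam * (n%:R * eta2 ^+ 2).
      apply: mulr_ge0; first exact: Lam0.
      by apply: mulr_ge0; [exact: ler0n | exact/exprn_ge0/ltW].
    have mq' : m%:R <= q%:R ^+ 6 :> R by rewrite -natrX ler_nat.
    apply: (@le_trans _ _ (m%:R * (Lam * (n%:R * eta2 ^+ 2)) * (rho%:R ^+ 2 - 1))).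
      by rewrite ler_wpM2r// ler_wpM2l.
    apply: ler_pM; [exact: mulr_ge0 (ler0n _ _) n0 | exact: rest | | by rewrite gerBl].
    exact: ler_wpM2r.
  rewrite le_eqVlt; apply/orP; left; apply/eqP; rewrite /L /eta2.
  by field; rewrite !gt_eqF.
have /choice[pts2 pts2P] : forall c, exists pts2 : seq Cn,
    (size pts2 <= (5 * gam * q) ^ (2 * r))%N /\
    forall z, D c z -> exists2 p, List.In p pts2 &
      D c p /\ m%:R * levi phi c (z - p) * (rho%:R ^+ 2 - 1) <= L.
  by move=> c; have [s s1 s2] := step2 c; exists s.
exists (flatten [seq pts2 c | c <- pts1]).
  have s2 c : (size (pts2 c) <= (5 * gam * q) ^ (2 * r))%N by have [] := pts2P c.
  apply: (leq_trans (size_flatten_le _ s2)).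
  have s1 : (size pts1 <= (5 * rho * q ^ 2) ^ (2 * n))%N.
    apply: (leq_trans sz1); rewrite I2; apply: expn_mono.
    have : (0 < rho * q ^ 2)%N by rewrite muln_gt0 expn_gt0 q0 rhoN.
    by rewrite -!mulnA; move: (rho * _)%N => x; clear; lia.
  apply: (leq_trans (leq_mul s1 (leqnn _))); apply: eq_leq.
  rewrite (expnMn (5 * rho) (q ^ 2)) (expnMn (5 * gam) q) -expnM expnD (mulnA 2 2).
  by rewrite -!mulnA; congr (_ * _)%N; rewrite mulnCA.
move=> h A hh hA hp z zk Az.
have [c cin [czk cz]] := H1 z zk.
have zc : vnorm (z - c) <= eta1.
  apply: vnorm_rcoord => [|k]; first exact: ltW.
  have := cz k; rewrite -rcoordB; congr (`|rcoord _ _| <= _).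
  by rewrite opprB addrA subrK.
have Dcz : D c z by split.
have [_ /(_ z Dcz)[p pin [[pk _ pc] lev]]] := pts2P c.
have cd1 : vnorm (c - z0) <= d1 by lra.
have [Uc _ _] := HT c 0 cd1 ltac:(by rewrite vnorm0 ltW).
rewrite addr0 in Uc.
have zp : vnorm (z - p) <= 2 * eta1.
  have -> : z - p = (z - c) - (p - c) by rewrite opprB addrA subrK.
  by rewrite (le_trans (vnormD _ _))// vnormN; lra.
have wb (t : C) (x : R) : cabs t <= x -> 1 <= x -> vnorm (p - c + t *: (z - p)) <= 3 * x * eta1.
  move=> tx x1; rewrite (le_trans (vnormD _ _))// vnormZ.
  have a1 : cabs t * vnorm (z - p) <= x * (2 * eta1) by rewrite ler_pM ?cabs_ge0 ?vnorm_ge0.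
  have a2 : eta1 <= x * eta1 by rewrite ler_peMl// ltW.
  by lra.
have cw (t : C) : c + (p - c + t *: (z - p)) = p + t *: (z - p).
  by rewrite addrA [c + _]addrC subrK.
apply: (@line_vanish U phi h m A E L (M1 * (3 * rho%:R * eta1) ^+ 3) rho%:R c p z) => //.
- by apply: hp; exact: In_flatten cin pin.
- move=> t tr; rewrite -cw; have w1 := wb t (2 * rho%:R) (ltW tr) ltac:(lra).
  have wd : vnorm (p - c + t *: (z - p)) <= d1 by lra.
  by have [] := HT c _ cd1 wd.
- move=> t tr /=; have w1 := wb t rho%:R tr rho1.
  have wd : vnorm (p - c + t *: (z - p)) <= d1 by lra.
  have [_ _ /le_trans] := HT c _ cd1 wd; apply.
  rewrite ler_wpM2l// ler_pXn2r ?nnegrE ?vnorm_ge0// !mulr_ge0// ltW//.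
- have mq' : m%:R <= q%:R ^+ 6 :> R by rewrite -natrX ler_nat.
  apply: (@le_trans _ _ (q%:R ^+ 6 * (M1 * (3 * rho%:R * eta1) ^+ 3))).
    by rewrite ler_wpM2r// mulr_ge0// exprn_ge0// !mulr_ge0// ltW.
  rewrite le_eqVlt; apply/orP; left; apply/eqP; rewrite /E /eta1.
  by field; rewrite !gt_eqF.
Qed.

End LocalNet.

(** * The norm of a pluricanonical section *)

Section Weights.
Variables (R : realType) (n : nat) (M : complexManifold R n) (g : hermitianMetric M).
Local Notation C := R[i].
Local Notation Cn := 'rV[C]_n.
Implicit Types (i j : chart_index M) (x : M) (z : Cn) (m : nat).

(** By the change of charts, exp(- weight) is a metric on the canonical bundle. *)
Definition weight i z : R := ln (complex.Re (\det (g i z))).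

Lemma cimage_chart i x : cdom i x -> cimage i (chart i x).
Proof. by move=> xi; exists x. Qed.

Lemma cimage_is_open i : open (@cimage R n M i).
Proof. exact: cimage_open. Qed.

Lemma metric_det_pos i z : cimage i z -> 0 < \det (g i z).
Proof.
by move=> zi; exact: posdef_det (metric_hermitian g zi) (metric_positive g zi).
Qed.

Lemma metric_Redet_pos i z : cimage i z -> 0 < complex.Re (\det (g i z)).
Proof. by move=> /metric_det_pos /posC_real[e e0 ->]. Qed.

Lemma weight_rclassC k i : rclassC k (@cimage R n M i) (weight i).
Proof.
apply: rclassC_ln; [exact: cimage_is_open | exact: metric_Redet_pos |].
have [] // := @cclassC_det R n k (cimage i) (fun z => g i z) (@cimage_is_open i).
move=> a b; split; have [h1 h2] := class_C_rclassC (metric_smooth g i a b k).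
  exact: h1.
exact: h2.
Qed.

Lemma metric_continuous i z a b : cimage i z -> {for z, continuous (fun z => g i z a b)}.
Proof. by move=> zi; have [H _] := metric_smooth g i a b 0%N; exact: H. Qed.

Lemma chern_ricci_levi i z : cimage i z -> chern_ricci g i z = - levi_mx (weight i) z.
Proof.
move=> zi; apply/matrixP => a b; rewrite [LHS]mxE [RHS]mxE.
by rewrite -(levi_mx_dz a b (weight_rclassC 2 i) zi).
Qed.

Lemma num_neg_le (A : 'M[C]_n) : (num_neg_eigenvalues A <= n)%N.
Proof.
rewrite /num_neg_eigenvalues (leq_trans (count_size _ _))// /eigenvalues.
case: closed_field_poly_normal => r /= Er.
have := size_char_poly A; rewrite Er (monicP (char_poly_monic A)) scale1r.
by rewrite size_prod_XsubC => -[->].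
Qed.

(** An n x n matrix has n eigenvalues, so that the range of the maximum in the
definition of the Ricci rank contains all the values that occur. *)
Lemma ricci_rank_ge i z : cimage i z ->
  (num_neg_eigenvalues (invmx (g i z) *m - levi_mx (weight i) z) <= ricci_rank g)%N.
Proof.
move=> zi; rewrite -chern_ricci_levi//; case: zi => x xi <-.
set k := num_neg_eigenvalues _.
have kn : (k < n.+1)%N by rewrite ltnS num_neg_le.
rewrite /ricci_rank (bigD1 (Ordinal kn))/= ?leq_maxl//.
by apply/asboolP; exists i, x.
Qed.

Lemma expR_weight m i z : cimage i z ->
  expR (m%:R * weight i z) = complex.Re (\det (g i z)) ^+ m.
Proof. by move=> zi; rewrite expRM_natl lnK// posrE metric_Redet_pos. Qed.

Definition section_norm m (f : chart_index M -> Cn -> C) i x : R :=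
  cabs (f i (chart i x)) ^+ 2 / expR (m%:R * weight i (chart i x)).

(** |f|^2 and (det g)^m are multiplied by the same power of the modulus of the Jacobian
determinant. *)
Lemma section_norm_chart m f i j x : pluricanonical_sections m f -> cdom i x -> cdom j x ->
  section_norm m f i x = section_norm m f j x.
Proof.
move=> [_ Hf _] xi xj; rewrite /section_norm !expR_weight; [|exact: cimage_chart..].
rewrite (Hf i j x xi xj) cabsM cabsX exprMn.
have zi := cimage_chart xi; have zj := cimage_chart xj.
set J := \det (transition_jacobian i j x).
have E : complex.Re (\det (g i (chart i x))) =
    cabs J ^+ 2 * complex.Re (\det (g j (chart j x))).
  rewrite (metric_compatible g xi xj) !det_mulmx det_map_mx det_tr -/J.
  rewrite mulrAC (_ : J * _ = (cabs J ^+ 2)%:C%C).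
    by rewrite cReM /= mul0r subr0.
  have -> : (cabs J ^+ 2)%:C%C = `|J| ^+ 2 :> C by rewrite cabsE rmorphXn.
  exact: esym (sqr_normc J).
have J0 : cabs J ^+ 2 != 0.
  apply/eqP => J0; have := metric_Redet_pos zi; rewrite E J0 mul0r ltxx//.
have JJ : cabs J ^+ m ^+ 2 = (cabs J ^+ 2) ^+ m by rewrite -exprM mulnC exprM.
rewrite E JJ; move: (cabs J ^+ 2) J0 => a a0; rewrite [(a * _) ^+ m]exprMn.
have d0 : complex.Re (\det (g j (chart j x))) ^+ m != 0.
  by rewrite expf_neq0// gt_eqF// metric_Redet_pos.
by rewrite -mulf_div divff ?mul1r// expf_neq0.
Qed.

Lemma section_norm_continuous m f i x : pluricanonical_sections m f -> cdom i x ->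
  {for x, continuous (section_norm m f i)}.
Proof.
move=> [hf _ _] xi; have zi := cimage_chart xi.
have cf : {for chart i x, continuous (f i)} by apply: differentiable_continuous; exact: hf.
have cc := @chart_continuous _ _ M i x xi.
have c1 : {for chart i x, continuous (fun z => cabs (f i z) ^+ 2)}.
  have c0 : {for chart i x, continuous (fun z => cabs (f i z))}.
    apply/(@cvgrPdist_le _ _ _ (nbhs (chart i x)) (nbhs_filter _)) => e e0.
    move/cvgrPdist_le : cf => /(_ e%:C%C); rewrite ltcR => /(_ e0).
    apply: filterS => z; rewrite cabsE lecR; apply: le_trans.
    have T1 := cabsD (f i (chart i x) - f i z) (f i z).
    have T2 := cabsD (f i z - f i (chart i x)) (f i (chart i x)).
    by move: T1 T2; rewrite !subrK [cabs (f i z - _)]cabsBC ler_norml; lra.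
  exact: (continuousM c0 c0).
have c2 : {for chart i x, continuous (fun z => expR (m%:R * weight i z))}.
  apply: (@continuous_comp _ _ _ (fun z => m%:R * weight i z) (@expR R)).
    apply: (@continuousM _ _ (cst m%:R)); first exact: cst_continuous.
    exact: rclassC_continuous (weight_rclassC 0 i) zi.
  exact: continuous_expR.
have c3 : {for chart i x, continuous (fun z => cabs (f i z) ^+ 2 / expR (m%:R * weight i z))}.
  apply: (continuousM c1); apply: continuousV; last exact: c2.
  by rewrite gt_eqF// expR_gt0.
exact: (@continuous_comp _ _ _ (chart i) _ x cc c3).
Qed.

Lemma cdom_nbhs i x : cdom i x -> nbhs x (cdom i).
Proof. by move=> xi; apply: open_nbhs_nbhs; split => //; exact: cdom_open. Qed.

Lemma section_norm_max m f x0 i0 : compact [set: M] -> pluricanonical_sections m f ->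
  cdom i0 x0 -> exists y, forall i j x, cdom i x -> cdom j y ->
    section_norm m f i x <= section_norm m f j y.
Proof.
move=> cM fs x0i; have /choice[ci ciP] := @cdom_cover _ _ M.
pose N x := section_norm m f (ci x) x.
have NE i x : cdom i x -> N x = section_norm m f i x.
  by move=> xi; apply: section_norm_chart.
have [||y _ ymax] := @compact_EVT_max M R N [set: M] _ cM.
- by exists x0.
- apply: continuous_in_subspaceT => x _.
  have H := section_norm_continuous fs (ciP x).
  have near_eq : \forall t \near x, section_norm m f (ci x) t = N t.
    by apply: filterS (cdom_nbhs (ciP x)) => t ti; exact: esym (NE _ _ ti).
  by apply: cvg_trans (near_eq_cvg near_eq) H.
exists y => i j x xi yj; rewrite -(NE i x xi) -(NE j y yj); apply: ymax.
exact: in_setT.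
Qed.

End Weights.

(** * Nets on a compact manifold *)

Section GlobalNet.
Variables (R : realType) (n : nat) (M : complexManifold R n) (g : hermitianMetric M).
Local Notation C := R[i].
Local Notation Cn := 'rV[C]_n.

Lemma chart_ball_open i (z : Cn) (d : R) :
  open [set x : M | cdom i x /\ vnorm (chart i x - z) < d].
Proof.
rewrite openE => x [xi xd].
have : \forall y \near x, vnorm (chart i y - chart i x) < d - vnorm (chart i x - z).
  have /cvgrPdist_lt/(_ (d - vnorm (chart i x - z))%:C%C) := @chart_continuous _ _ M i x xi.
  rewrite ltcR subr_gt0 => /(_ xd); apply: filterS => y.
  by rewrite vnormE ltcR vnormBC.
apply: filterS2 (cdom_nbhs xi) => y yi yd; split => //.
have := vnormD (chart i y - chart i x) (chart i x - z).
by rewrite addrA subrK; lra.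
Qed.

(** Uniformity over the filter of finite sets of points, ordered by inclusion. *)
Lemma compact_finite_cover (V : M -> set M) : compact [set: M] ->
  (forall y, open (V y)) -> (forall y, V y y) ->
  exists ys : seq M, forall x, exists2 y, y \in ys & V y x.
Proof.
move=> /compact_near_coveringP cM oV Vy.
(* The sets that contain all the finite families beyond some s0. *)
pose F : set (set (seq M)) :=
  fun A => exists s0 : seq M, forall s : seq M, {subset s0 <= s} -> A s.
have FF : Filter F.
  split; first by exists [::].
  - move=> A B [s1 h1] [s2 h2]; exists (s1 ++ s2) => s s12; split.
      by apply: h1 => y ys; apply: s12; rewrite mem_cat ys.
    by apply: h2 => y ys; apply: s12; rewrite mem_cat ys orbT.
  - by move=> A B AB [s1 h1]; exists s1 => s /h1 /AB.
have [|s0 H] := cM (seq M) F (fun s x => exists2 y, y \in s & V y x) FF.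
  move=> x _; exists (V x, fun s : seq M => is_true (x \in s)).
    split; first by apply: open_nbhs_nbhs; split; [exact: oV | exact: Vy].
    by exists [:: x] => s; apply; rewrite inE.
  by move=> [x' s] [/= Vx xs]; exists x.
by exists s0 => x; exact: (H s0 (fun y ys => ys) x I).
Qed.

(** Where the norm of a section is maximal, with value A, some local net applies: A
is at most 0. *)
Lemma global_net : compact [set: M] ->
  exists K : nat, forall q m : nat, (0 < q)%N -> (m <= q ^ 6)%N ->
  exists2 pts : seq (chart_index M * Cn),
    (size pts <= K * q ^ (4 * n + 2 * ricci_rank g))%N &
    forall f, pluricanonical_sections m f ->
      (forall ip, List.In ip pts -> f ip.1 ip.2 = 0) -> forall i z, f i z = 0.
Proof.
move=> cM; have /choice[ci ciP] := @cdom_cover _ _ M.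
set r := ricci_rank g; set d := (4 * n + 2 * r)%N.
have loc y := @local_net R n (cimage (ci y)) (weight g (ci y)) (fun z => g (ci y) z) r
  (chart (ci y) y) (@cimage_is_open _ _ M (ci y)) (cimage_chart (ciP y))
  (@weight_rclassC _ _ _ g 3 (ci y)) (fun a b => @metric_continuous _ _ _ g _ _ a b
    (cimage_chart (ciP y)))
  (fun z zi => @metric_hermitian _ _ _ g _ z zi)
  (fun z zi => @metric_positive _ _ _ g _ z zi)
  (fun z zi => @ricci_rank_ge _ _ _ g _ z zi).
pose prop y (dK : R * nat) := 0 < dK.1 /\ forall q m : nat, (0 < q)%N ->
    (m <= q ^ 6)%N -> exists2 pts : seq Cn, (size pts <= dK.2 * q ^ d)%N &
      forall (h : Cn -> C) (A : R), holomorphic (cimage (ci y)) h ->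
      (forall z, cimage (ci y) z -> cabs (h z) ^+ 2 <= A * expR (m%:R * weight g (ci y) z)) ->
      (forall p, List.In p pts -> h p = 0) ->
      forall z, vnorm (z - chart (ci y) y) < dK.1 ->
        A * expR (m%:R * weight g (ci y) z) <= cabs (h z) ^+ 2 -> A <= 0.
have /choice[dK dKP] : forall y, exists dK, prop y dK.
  by move=> y; have [de de0 [K HK]] := loc y; exists (de, K); split.
pose V y := [set x : M | cdom (ci y) x /\ vnorm (chart (ci y) x - chart (ci y) y) < (dK y).1].
have [ys ysP] : exists ys : seq M, forall x, exists2 y, y \in ys & V y x.
  apply: compact_finite_cover cM _ _ => y; first exact: chart_ball_open.
  by split; [exact: ciP | rewrite subrr vnorm0; have [] := dKP y].
exists (\sum_(y <- ys) (dK y).2)%N => q m q0 mq.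
have /choice[pts ptsP] y : exists pts : seq Cn, (size pts <= (dK y).2 * q ^ d)%N /\
      forall (h : Cn -> C) (A : R), holomorphic (cimage (ci y)) h ->
      (forall z, cimage (ci y) z -> cabs (h z) ^+ 2 <= A * expR (m%:R * weight g (ci y) z)) ->
      (forall p, List.In p pts -> h p = 0) ->
      forall z, vnorm (z - chart (ci y) y) < (dK y).1 ->
        A * expR (m%:R * weight g (ci y) z) <= cabs (h z) ^+ 2 -> A <= 0.
  by have [_ /(_ q m q0 mq)[p p1 p2]] := dKP y; exists p.
pose all_pts ys := flatten [seq [seq (ci y, p) | p <- pts y] | y <- ys].
exists (all_pts ys).
  rewrite /all_pts; elim: (ys : seq M) => [|y s IH]; first by rewrite big_nil.
  rewrite /= size_cat size_map big_cons mulnDl leq_add//.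
  by have [] := ptsP y.
move=> f fs f0 i z; have [[x xi <-]|] := pselect (cimage i z); last first.
  by case: fs => _ _; exact.
have [y ymax] := @section_norm_max _ _ _ g _ _ _ _ cM fs xi.
have [w win [ywd wd]] := ysP y.
set j := ci w in ywd wd; set A := section_norm g m f j y.
have bnd k u : cdom k u -> cabs (f k (chart k u)) ^+ 2 <= A * expR (m%:R * weight g k (chart k u)).
  move=> uk; have H := ymax k j u uk ywd.
  by rewrite -ler_pdivrMr; [exact: H | exact: expR_gt0].
have A0 : A <= 0.
  have [_ H] := ptsP w; have [hf _ _] := fs.
  apply: (H (f j) A (hf j) _ _ (chart j y) wd).
  - by move=> _ [u uj <-]; exact: bnd.
  - move=> p pin; have := f0 (j, p); apply.
    apply: (@In_flatten _ _ _ (fun y => [seq (ci y, p) | p <- pts y]) w).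
      elim: (ys : seq M) win => //= a s IH; rewrite inE => /orP[/eqP->|/IH ?]; by [left|right].
    by elim: (pts w) pin => //= a s IH [->|/IH ?]; [left|right].
  by rewrite /A /section_norm mulfVK// gt_eqF// expR_gt0.
have := bnd i x xi => /le_trans/(_ (mulr_le0_ge0 A0 (expR_ge0 _))) h.
have : cabs (f i (chart i x)) ^+ 2 == 0 by rewrite eq_le h exprn_ge0// cabs_ge0.
by rewrite expf_eq0 /= cabs_eq0 => /eqP.
Qed.

End GlobalNet.

(** * From nets to plurigenera *)

Section Plurigenera.
Variables (R : realType) (n : nat) (M : complexManifold R n).
Local Notation C := R[i].
Local Notation Cn := 'rV[C]_n.

(** More unknowns than equations. *)
Lemma wide_kernel (k N : nat) (E : 'M[C]_(k, N)) : (N < k)%N ->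
  exists2 c : 'rV[C]_k, c != 0 & c *m E = 0.
Proof.
move=> Nk; exists (nz_row (kermx E)).
  rewrite nz_row_eq0 -mxrank_eq0 mxrank_ker subn_eq0 -ltnNge.
  exact: leq_ltn_trans (rank_leq_col E) Nk.
by apply/sub_kermxP; exact: nz_row_sub.
Qed.

Lemma In_tnth (T : Type) (s : seq T) x : List.In x s ->
  exists l : 'I_(size s), tnth (in_tuple s) l = x.
Proof.
move=> H; have [i Hi E] : exists2 i, (i < size s)%N & nth x s i = x.
  elim: s H => //= a s IH [->|/IH[i Hi E]]; first by exists 0%N.
  by exists i.+1.
by exists (Ordinal Hi); rewrite (tnth_nth x).
Qed.

Lemma sum_sectionE (k : nat) (c : 'I_k -> C) (s : 'I_k -> chart_index M -> Cn -> C) i z :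
  (\sum_a c a *: s a) i z = \sum_a c a * s a i z.
Proof. by rewrite !fct_sumE. Qed.

Lemma pluricanonical_comb m (k : nat) (c : 'I_k -> C) (s : 'I_k -> chart_index M -> Cn -> C) :
  (forall a, pluricanonical_sections m (s a)) ->
  pluricanonical_sections m (\sum_a c a *: s a).
Proof.
move=> sP; split.
- move=> i z zi.
  have -> : (\sum_a c a *: s a) i = \sum_a (c a *: s a i).
    by apply/funext => w; rewrite sum_sectionE fct_sumE.
  apply: differentiable_sum => a; apply: differentiableZ.
  by have [H _ _] := sP a; exact: H.
- move=> i j x xi xj; rewrite !sum_sectionE mulr_sumr; apply: eq_bigr => a _.
  by have [_ H _] := sP a; rewrite (H i j x xi xj) mulrCA.
- move=> i z zi; rewrite sum_sectionE big1// => a _.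
  by have [_ _ H] := sP a; rewrite (H i z zi) mulr0.
Qed.

(** Evaluation at the points of pts is injective on sections. *)
Lemma plurigenus_le m (pts : seq (chart_index M * Cn)) :
  (forall f, pluricanonical_sections m f ->
    (forall ip, List.In ip pts -> f ip.1 ip.2 = 0) -> forall i z, f i z = 0) ->
  (plurigenus M m <= ((size pts)%:R : R)%:E)%E.
Proof.
move=> H; apply: ge_ereal_sup => _ [k [s [sP s_free]] <-].
rewrite lee_fin ler_nat leqNgt; apply/negP => Nk.
pose E : 'M[C]_(k, size pts) :=
  \matrix_(a, l) s a (tnth (in_tuple pts) l).1 (tnth (in_tuple pts) l).2.
have [c c0 cE] := wide_kernel E Nk.
move/eqP: c0; apply; apply/rowP => a; rewrite mxE.
apply: (s_free (fun a => c 0 a)).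
apply/funext => i; apply/funext => z.
apply: (H _ (pluricanonical_comb _ sP)) => ip ipin.
have [l <-] := In_tnth ipin.
have cEl : (c *m E) 0 l = 0 by rewrite cE mxE.
rewrite -cEl mxE sum_sectionE; apply: eq_bigr => b _.
by rewrite mxE.
Qed.

End Plurigenera.

(** * Logarithmic growth *)

Section Growth.
Variable R : realType.

(** The least q with m <= q^6 satisfies (q - 1)^6 < m and q <= 2 (q - 1), unless q = 1. *)
Lemma sixth_root (m : nat) : (0 < m)%N ->
  exists q, [/\ (0 < q)%N, (m <= q ^ 6)%N & (q ^ 6 <= 64 * m)%N].
Proof.
move=> m0; have ex : exists q, (m <= q ^ 6)%N.
  by exists m; rewrite -{1}(expn1 m) leq_pexp2l.
case: (ex_minnP ex) => q mq qmin; exists q.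
have q0 : (0 < q)%N by case: q mq {qmin} => //; rewrite exp0n// leqNgt m0.
split => //; case: q q0 mq qmin => // -[|q] _ mq qmin; first by rewrite exp1n; lia.
have : ~~ (m <= q.+1 ^ 6)%N by apply/negP => /qmin; rewrite ltnn.
rewrite -ltnNge => /ltnW h; apply: (@leq_trans (64 * q.+1 ^ 6)%N); last by rewrite leq_mul2l h orbT.
by rewrite (_ : 64 = 2 ^ 6)%N// -expnMn leq_exp2r//; lia.
Qed.

Lemma lne_le (x : \bar R) (r : R) : 0 < r -> (x <= r%:E)%E -> (lne x <= (ln r)%:E)%E.
Proof.
move=> r0; case: x => [p| |]; [|by rewrite leye_eq|by move=> _; exact: leNye].
rewrite lee_fin /= => pr; case: ifPn => [_|]; first by rewrite leNye.
by rewrite -ltNge => p0; rewrite lee_fin ler_ln ?posrE.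
Qed.

(** With q^6 <= 64 m, the hypothesis gives log P_m <= (d / 6) log m + O(1). *)
Lemma log_growth_le (P : nat -> \bar R) (K d : nat) :
  (forall q m : nat, (0 < q)%N -> (m <= q ^ 6)%N -> (P m <= ((K * q ^ d)%N%:R : R)%:E)%E) ->
  (limn_esup (fun m => lne (P m) / (ln m%:R)%:E)%E <= ((d%:R / 6 : R)%:E))%E.
Proof.
move=> HP; pose a : R := ln K.+1%:R + d%:R / 6 * ln 64.
have bound m : (1 < m)%N -> (lne (P m) <= (a + d%:R / 6 * ln m%:R)%:E)%E.
  move=> m1; have m0 : (0 < m)%N by exact: ltnW.
  have [q [q0 mq qm]] := sixth_root m0.
  have r0 : 0 < (K.+1 * q ^ d)%N%:R :> R by rewrite ltr0n muln_gt0 expn_gt0 q0.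
  have le1 : (P m <= ((K.+1 * q ^ d)%N%:R : R)%:E)%E.
    by apply: (le_trans (HP q m q0 mq)); rewrite lee_fin ler_nat leq_mul2r leqnSn orbT.
  apply: (le_trans (lne_le r0 le1)); rewrite lee_fin.
  have qr : 0 < q%:R :> R by rewrite ltr0n.
  rewrite natrM natrX lnM ?posrE ?exprn_gt0 ?ltr0n// lnXn//.
  have : ln (q%:R ^+ 6) <= ln (64 * m%:R) :> R.
    rewrite ler_ln ?posrE ?exprn_gt0 ?mulr_gt0 ?ltr0n//.
    by rewrite -natrX -natrM ler_nat.
  rewrite lnXn// lnM ?posrE ?ltr0n// => h.
  have h6 : ln q%:R <= (ln 64 + ln m%:R) / 6 :> R by rewrite ler_pdivlMr// mulr_natr.
  rewrite /a -addrA lerD2l -[leLHS]mulr_natl.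
  have -> : d%:R / 6 * ln 64 + d%:R / 6 * ln m%:R = d%:R * ((ln 64 + ln m%:R) / 6) :> R.
    by field.
  by rewrite ler_wpM2l.
apply/lee_addgt0Pr => e e0.
have [N HN] : exists N : nat, forall m, (N <= m)%N -> (1 < m)%N /\ a / ln m%:R <= e.
  pose N0 := Num.bound (expR (`|a| / e)).
  exists (maxn 2 N0) => m; rewrite geq_max => /andP[m2 mN]; split => //.
  have m1 : 1 < m%:R :> R by rewrite ltr1n.
  have lm : 0 < ln m%:R :> R by rewrite ln_gt0.
  rewrite ler_pdivrMr// (le_trans (ler_norm _))// mulrC -ler_pdivrMr//.
  rewrite -ler_expR lnK ?posrE; last by lra.
  have /archi_boundP/ltW h : 0 <= expR (`|a| / e) by exact: expR_ge0.
  by rewrite (le_trans h)// ler_nat.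
apply: (@le_trans _ _ (ereal_sup ((fun m => lne (P m) / (ln m%:R)%:E)%E @` [set m | (N <= m)%N]))).
  by apply: ereal_inf_lbound; exists [set m | (N <= m)%N] => //; exact: nbhs_infty_ge.
apply: ge_ereal_sup => _ [m /= /HN[m1 ae] <-].
have m1' : 1 < m%:R :> R by rewrite ltr1n.
have lm : 0 < ln m%:R :> R by rewrite ln_gt0.
have -> : (((ln m%:R)%:E)^-1 = ((ln m%:R)^-1 : R)%:E)%E by rewrite inver gt_eqF.
apply: (le_trans (lee_wpmul2r _ (bound m m1))); first by rewrite lee_fin invr_ge0 ltW.
rewrite -EFinM -EFinD lee_fin mulrDl mulfK ?gt_eqF//.
by rewrite addrC lerD2l.
Qed.

End Growth.

Theorem proposition1p8 (R : realType) (n : nat) (M : complexManifold R n)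
    (g : hermitianMetric M) (compactM : compact [set: M]) :
  (kodaira_dim M <= (((ricci_rank g)%:R + 2 * n%:R) / 3)%:E)%E /\
  ((ricci_rank g)%:R + 2 * n%:R) / 3
    = (ricci_rank g)%:R + 2 / 3 * (n%:R - (ricci_rank g)%:R) :> R.
Proof.
split; last by field.
have [K HK] := global_net g compactM.
have := @log_growth_le R (plurigenus M) K (4 * n + 2 * ricci_rank g) _.
rewrite (_ : _%:R / 6 = ((ricci_rank g)%:R + 2 * n%:R) / 3); last first.
  by rewrite natrD !natrM; field.
apply => q m q0 mq; have [pts sz H] := HK q m q0 mq.
by apply: (le_trans (plurigenus_le H)); rewrite lee_fin ler_nat.
Qed.
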